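(* Let $U\in\mathcal{B}$ be a simple adapted biprocess, $M=\int U(s)\,\sharp\, dX(s)$, $M(t)=\int_0^tU(s)\,\sharp\, dX(s)$, and let $p$ be a complex polynomial in one variable. Then $$p\Bigl(\int U\,\sharp\, dX\Bigr)=\sum_{k=1}^\infty\int\frac1{k!}\,\phi_{k+1}\bigl[\partial^k(p)(M(t))\,\sharp\,\mathfrak{m}_k(U(t),U(t),\dots,U(t))\bigr]\,\sharp\, d\Delta_k(t).$$
   Context: Setting. $\mathcal{A}$ is a finite von Neumann algebra with a faithful normal trace state $\phi$; $\|S\|_p=\phi[|S|^p]^{1/p}$, $\|S\|_\infty=\|S\|$ is the operator norm, $L^p(\mathcal{A},\phi)$ are the completions of $\mathcal{A}$. $(\mathcal{A}_t)_{t\ge0}$ is an increasing family of von Neumann subalgebras of $\mathcal{A}$. $\mu$ is a compactly supported freely infinitely divisible probability measure on $\mathbb{R}$ of variance $1$; $r_k$ are its free cumulants, and $(\mu_t)_{t\ge0}$ is the free convolution semigroup whose free cumulants are $t r_k$. $X$ is a fixed adapted free stochastic measure with distribution $\mu$: a map $I\mapsto X(I)$ from finite half-open intervals $I=[a,b)\subset[0,\infty)$ to self-adjoint elements of $\mathcal{A}$ such that $X(I_1)+X(I_2)=X(I_1\cup I_2)$ when $I_1\cap I_2=\emptyset$ and $I_1\cup I_2$ is an interval; $X(I)$ has distribution $\mu_{|I|}$; $X(I_1),\dots,X(I_n)$ are freely independent for disjoint $I_1,\dots,I_n$; $X(I)\in\mathcal{A}_t$ if $I\subset[0,t)$; and $X(I)$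 is freely independent from $\mathcal{A}_t$ if $I\cap[0,t)=\emptyset$. Put $X(t)=X([0,t))$. Diagonal measures. For $I=[a,b)$, $\Delta_k(I)=\lim_{N\to\infty}\sum_{i=1}^N X\bigl([a+\tfrac{i-1}{N}(b-a),a+\tfrac{i}{N}(b-a))\bigr)^k$, the limit being in operator norm (it is known to exist); $\Delta_k(t)=\Delta_k([0,t))$, $\Delta_1=X$. Each $\Delta_k$ is known to be an adapted process with freely independent stationary increments, and the free cumulants of $\Delta_k(t)$ are $r_n(\Delta_k(t))=t\,r_{nk}$. Biprocesses and integrals. A biprocess is a map $[0,\infty)\to\mathcal{A}\otimes\mathcal{A}^{op}$. $\mathcal{B}$ is the space of simple adapted biprocesses, spanned by $S\otimes T\,\mathbf{1}_{[a,b)}$ with $S,T\in\mathcal{A}_a$. For such a biprocess $\int (S\otimes T\mathbf{1}_{[a,b)})\,\sharp\, d\Delta_k=S(\Delta_k(b)-\Delta_k(a))T$, extended linearly; $\int_{t_1}^{t_2}U\,\sharp\, d\Delta_k=\int U\mathbf{1}_{[t_1,t_2)}\,\sharp\, d\Delta_k$. For non-simple adapted $W$ the integral is defined by continuous extension: if $W_n\in\mathcal{B}$ with $\int\|W_n-W\|_2^2ds\to0$ and $\|\int m(W_n-W)ds\|_2\to0$, then $\int W\,\sharp\, d\Delta_k$ is the limit of $\int W_n\,\sharp\, d\Delta_k$ in $L^2(\mathcal{A},\phi)$; here $m(S\otimes T)=ST$, and $\|\cdot\|_2$ on $\mathcal{A}\otimes\mathcal{A}^{op}$ comes from $\langle A\otimes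 B,C\otimes D\rangle=\phi[C^*A]\phi[BD^*]$. Notation. $\partial^k:\mathbb{C}[x]\to\mathbb{C}[x]^{\otimes(k+1)}$ is the linear map $\partial^k x^n=k!\sum_{i(0)+\dots+i(k)=n-k,\ i(j)\ge0}x^{i(0)}\otimes\dots\otimes x^{i(k)}$, and $\partial^k(p)(M)$ means that $M$ is substituted for $x$ in every tensor factor. The right action $\sharp\,\mathfrak{m}_k$ is the multilinear extension of $$(a_0\otimes a_1\otimes\dots\otimes a_k)\,\sharp\,\mathfrak{m}_k(A_1\otimes B_1,\dots,A_k\otimes B_k)=a_0A_1\otimes B_1a_1A_2\otimes\dots\otimes B_{k-1}a_{k-1}A_k\otimes B_ka_k .$$ For $k\ge2$, $\phi_k:\mathcal{A}^{\otimes k}\to\mathcal{A}\otimes\mathcal{A}$ is $\phi_k=\mathrm{id}\otimes\phi^{\otimes(k-2)}\otimes \mathrm{id}$, and its value is regarded as an element of $\mathcal{A}\otimes\mathcal{A}^{op}$.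
   Formalization: As printed the formula fails for polynomials with nonzero constant term (p = 1 gives 1 = 0); the left side is corrected to p(∫U♯dX) − p(0)·1, which is the printed formula whenever p(0) = 0. *)

(* Defs.v *)
From HB Require Import structures.
From mathcomp Require Import all_boot all_order all_algebra.
From mathcomp Require Import complex.
From mathcomp Require Import all_classical all_reals all_analysis.

Set Implicit Arguments.
Unset Strict Implicit.
Unset Printing Implicit Defensive.

Import Order.TTheory GRing.Theory Num.Theory.
Import numFieldNormedType.Exports.

Local Open Scope classical_set_scope.
Local Open Scope ring_scope.
Local Open Scope quotient_scope.
Local Open Scope complex_scope.

(* tpow n V is the n-th tensor power of the K-module V: formal linear          *)
(* combinations of n-tuples of vectors, two of them being identified when      *)
(* every multilinear map into a K-module takes the same value on both.         *)
Section TensorPower.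
Context (K : comNzRingType) (n : nat) (V : lmodType K).

Definition upd (v : {ffun 'I_n -> V}) (i : 'I_n) (x : V) : {ffun 'I_n -> V} :=
  [ffun j => if j == i then x else v j].

Definition multilinear (W : lmodType K) (f : {ffun 'I_n -> V} -> W) : Prop :=
  forall v i c x y, f (upd v i (c *: x + y)) = c *: f (upd v i x) + f (upd v i y).

Definition ftens : Type := seq (K * {ffun 'I_n -> V}).

Definition feval (W : lmodType K) (f : {ffun 'I_n -> V} -> W) (s : ftens) : W :=
  \sum_(p <- s) p.1 *: f p.2.

Definition feq (s t : ftens) : Prop :=
  forall (W : lmodType K) (f : {ffun 'I_n -> V} -> W),
    multilinear f -> feval f s = feval f t.

Definition feqb : rel ftens := fun s t => `[< feq s t >].

Lemma feqb_refl : reflexive feqb.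
Proof. by move=> s; apply/asboolP. Qed.

Lemma feqb_sym : symmetric feqb.
Proof. by move=> s t; apply/asboolP/asboolP => h W f mf; rewrite h. Qed.

Lemma feqb_trans : transitive feqb.
Proof.
by move=> t s u /asboolP st /asboolP tu; apply/asboolP => W f mf; rewrite st ?tu.
Qed.

Canonical feqb_equiv := EquivRel feqb feqb_refl feqb_sym feqb_trans.

Definition tpow : Type := {eq_quot feqb}.
HB.instance Definition _ := Choice.on tpow.
HB.instance Definition _ := EqQuotient.on tpow.

Lemma tpowP (s t : ftens) : reflect (feq s t) (\pi_tpow s == \pi_tpow t).
Proof. by rewrite piE; apply: asboolP. Qed.

Definition tlift (W : lmodType K) (f : {ffun 'I_n -> V} -> W) (x : tpow) : W :=
  feval f (repr x).

Lemma tlift_pi (W : lmodType K) (f : {ffun 'I_n -> V} -> W) (s : ftens) :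
  multilinear f -> tlift f (\pi_tpow s) = feval f s.
Proof.
move=> mf; have /tpowP h : \pi_tpow (repr (\pi_tpow s)) == \pi_tpow s.
  by rewrite reprK.
exact: h.
Qed.

Lemma feval_cat (W : lmodType K) (f : {ffun 'I_n -> V} -> W) (s t : ftens) :
  feval f (s ++ t) = feval f s + feval f t.
Proof. exact: big_cat. Qed.

Definition fscale (c : K) (s : ftens) : ftens := [seq (c * p.1, p.2) | p <- s].

Lemma feval_scale (W : lmodType K) (f : {ffun 'I_n -> V} -> W) c (s : ftens) :
  feval f (fscale c s) = c *: feval f s.
Proof.
rewrite /feval big_map scaler_sumr.
by apply: eq_bigr => p _ /=; rewrite scalerA.
Qed.

Definition tadd (x y : tpow) : tpow := \pi_tpow (repr x ++ repr y).
Definition tscale (c : K) (x : tpow) : tpow := \pi_tpow (fscale c (repr x)).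
Definition topp (x : tpow) : tpow := tscale (-1) x.
Definition tzero : tpow := \pi_tpow [::].

Lemma tpow_eqP (x y : tpow) :
  (forall (W : lmodType K) (f : {ffun 'I_n -> V} -> W),
    multilinear f -> tlift f x = tlift f y) -> x = y.
Proof.
move=> h; rewrite -(reprK x) -(reprK y); apply/eqP/tpowP => W f mf.
exact: h.
Qed.

Section Tlift.
Context (W : lmodType K) (f : {ffun 'I_n -> V} -> W) (mf : multilinear f).

Lemma tlift_add x y : tlift f (tadd x y) = tlift f x + tlift f y.
Proof. by rewrite tlift_pi// feval_cat. Qed.

Lemma tlift_scale c x : tlift f (tscale c x) = c *: tlift f x.
Proof. by rewrite tlift_pi// feval_scale. Qed.

Lemma tlift_zero : tlift f tzero = 0.
Proof. by rewrite tlift_pi// /feval big_nil. Qed.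

End Tlift.

Lemma taddA : associative tadd.
Proof. by move=> x y z; apply: tpow_eqP => W f mf; rewrite !tlift_add// addrA. Qed.

Lemma taddC : commutative tadd.
Proof. by move=> x y; apply: tpow_eqP => W f mf; rewrite !tlift_add// addrC. Qed.

Lemma tadd0 : left_id tzero tadd.
Proof.
by move=> x; apply: tpow_eqP => W f mf; rewrite tlift_add// tlift_zero// add0r.
Qed.

Lemma taddN : left_inverse tzero topp tadd.
Proof.
move=> x; apply: tpow_eqP => W f mf.
by rewrite tlift_add// tlift_scale// tlift_zero// scaleN1r addNr.
Qed.

HB.instance Definition _ := GRing.isZmodule.Build tpow taddA taddC tadd0 taddN.

Lemma tscaleA a b x : tscale a (tscale b x) = tscale (a * b) x.
Proof. by apply: tpow_eqP => W f mf; rewrite !tlift_scale// scalerA. Qed.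

Lemma tscale1 : left_id 1 tscale.
Proof. by move=> x; apply: tpow_eqP => W f mf; rewrite tlift_scale// scale1r. Qed.

Lemma tscaleDr : right_distributive tscale +%R.
Proof.
move=> c x y; apply: tpow_eqP => W f mf.
by rewrite tlift_scale// !tlift_add// !tlift_scale// scalerDr.
Qed.

Lemma tscaleDl x : {morph tscale^~ x : a b / a + b}.
Proof.
move=> a b; apply: tpow_eqP => W f mf.
by rewrite tlift_add// !tlift_scale// scalerDl.
Qed.

HB.instance Definition _ :=
  GRing.Zmodule_isLmodule.Build K tpow tscaleA tscale1 tscaleDr tscaleDl.

Definition tens (v : {ffun 'I_n -> V}) : tpow := \pi_tpow [:: (1, v)].

Lemma tlift_linear (W : lmodType K) (f : {ffun 'I_n -> V} -> W) :
  multilinear f -> linear (tlift f).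
Proof. by move=> mf c x y; rewrite tlift_add// tlift_scale. Qed.

Lemma tlift_tens (W : lmodType K) (f : {ffun 'I_n -> V} -> W) v :
  multilinear f -> tlift f (tens v) = f v.
Proof. by move=> mf; rewrite tlift_pi// /feval big_seq1 scale1r. Qed.

End TensorPower.

Definition tmap (K : comNzRingType) (n : nat) (V W : lmodType K) (g : V -> W) :
  tpow n V -> tpow n W := tlift (fun v => tens [ffun j => g (v j)]).

Section TensorOperations.
Context (K : comNzRingType).

(* The k-fold difference quotient, from polynomials to their (k+1)-st tensor   *)
(* power.  The exponents i(j) are at most n, hence range over a finite type.   *)
Definition dmono (k n : nat) : tpow k.+1 {poly K} :=
  \sum_(i : {ffun 'I_k.+1 -> 'I_n.+1} | (\sum_j i j + k == n)%N)
    tens [ffun j => 'X^(i j)].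

Definition dpoly (k : nat) (p : {poly K}) : tpow k.+1 {poly K} :=
  \sum_(n < size p) p`_n *: (k`!%:R *: dmono k n).

Context (A : algType K).

Definition subst (k : nat) (a : A) : tpow k {poly K} -> tpow k A :=
  tmap (fun q => horner_alg a q).

Definition tens2 (S T : A) : tpow 2 A :=
  tens [ffun i : 'I_2 => if i == ord0 then S else T].

Definition tmul : tpow 2 A -> A := tlift (fun v => v ord0 * v ord_max).

(* slot a v i is B_i a_i A_(i+1), where v j = A_(j+1) (x) B_(j+1); the missing *)
(* B_0 and A_(k+1) are 1.                                                      *)
Definition slot (k : nat) (a : {ffun 'I_k.+1 -> A})
    (v : 'I_k -> {ffun 'I_2 -> A}) (i : 'I_k.+1) : A :=
  (if unlift ord0 i is Some j then v j ord_max else 1) * a i *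
  (if unlift ord_max i is Some j then v j ord0 else 1).

Definition fcons (k : nat) (T : Type) (x : T) (v : 'I_k -> T) : 'I_k.+1 -> T :=
  fun i => if unlift ord0 i is Some j then v j else x.

(* Multilinear extension of F to k tensors, one argument at a time.            *)
Fixpoint mlift (W : lmodType K) (k : nat) :
    (('I_k -> {ffun 'I_2 -> A}) -> W) -> ('I_k -> tpow 2 A) -> W :=
  match k with
  | 0 => fun F _ => F (fun=> 0)
  | k'.+1 => fun F u =>
      tlift (fun x => mlift (fun v => F (fcons x v)) (fun j => u (lift ord0 j)))
            (u ord0)
  end.

Definition sharp_m (k : nat) (x : tpow k.+1 A) (u : 'I_k -> tpow 2 A) :
    tpow k.+1 A :=
  tlift (fun a : {ffun 'I_k.+1 -> A} =>
           mlift (fun v => tens (finfun (slot a v))) u) x.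

Definition phi_mid (phi : A -> K) (k : nat) : tpow k.+2 A -> tpow 2 A :=
  tlift (fun v => (\prod_(i < k.+2 | (i != ord0) && (i != ord_max)) phi (v i)) *:
                  tens2 (v ord0) (v ord_max)).

End TensorOperations.

Section Hilbert.
Context (R : realType) (H : lmodType R[i]) (dot : H -> H -> R[i]).

Definition hnorm (x : H) : R := Num.sqrt (complex.Re (dot x x)).

Definition hcvg (u : nat -> H) (l : H) : Prop :=
  hnorm (u n - l) @[n --> \oo] --> (0 : R).

Definition hcauchy (u : nat -> H) : Prop :=
  forall e : R, 0 < e ->
    exists N, forall m n, (N <= m)%N -> (N <= n)%N -> hnorm (u m - u n) < e.

Definition hcomplete : Prop :=
  forall u : nat -> H, hcauchy u -> exists l, hcvg u l.

Definition bounded_op (T : H -> H) : Prop :=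
  linear T /\ exists c : R, forall x, hnorm (T x) <= c * hnorm x.

Definition commutant (S : set (H -> H)) : set (H -> H) :=
  [set T | bounded_op T /\ forall s, S s -> T \o s = s \o T].

Definition bicommutant_closed (S : set (H -> H)) : Prop :=
  commutant (commutant S) = S.

End Hilbert.

(* A von Neumann algebra is given with a faithful unital *-representation rep  *)
(* on a Hilbert space whose range is its own bicommutant.                      *)
Record tracialVNA (R : realType) := TracialVNA {
  vna_alg :> algType R[i];
  vna_hilb : lmodType R[i];
  vna_dot : {dot vna_hilb for @Num.conj R[i]};
  vna_complete : hcomplete vna_dot;
  rep : vna_alg -> vna_hilb -> vna_hilb;
  star : vna_alg -> vna_alg;
  rep_bounded : forall a, bounded_op vna_dot (rep a);
  rep_inj : injective rep;
  rep_linear : forall c a b x, rep (c *: a + b) x = c *: rep a x + rep b x;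
  rep_mul : forall a b x, rep (a * b) x = rep a (rep b x);
  rep_one : forall x, rep 1 x = x;
  rep_star : forall a x y, vna_dot (rep a x) y = vna_dot x (rep (star a) y);
  rep_bicommutant : bicommutant_closed vna_dot (range rep);
  vna_le : vna_alg -> vna_alg -> Prop :=
    fun a b => forall x, 0 <= vna_dot (rep (b - a) x) x;
  tr : {scalar vna_alg};
  tr_one : tr 1 = 1;
  tr_ge0 : forall a, 0 <= tr (star a * a);
  tr_faithful : forall a, tr (star a * a) = 0 -> a = 0;
  tr_trace : forall a b, tr (a * b) = tr (b * a);
  tr_normal : forall (D : set vna_alg) (a : vna_alg),
    D !=set0 ->
    (forall d, D d -> star d = d) ->
    (forall d e, D d -> D e -> exists f, [/\ D f, vna_le d f & vna_le e f]) ->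
    star a = a ->
    (forall d, D d -> vna_le d a) ->
    (forall b, star b = b -> (forall d, D d -> vna_le d b) -> vna_le a b) ->
    complex.Re (tr a) = sup [set complex.Re (tr d) | d in D]
}.

Arguments tr {R _}.
Arguments vna_dot {R} _.

Section Algebra.
Context (R : realType) (A : tracialVNA R).

Definition opnorm (a : A) : R :=
  sup [set hnorm (vna_dot A) (rep a x)
      | x in [set x | hnorm (vna_dot A) x <= 1]].

Definition star_subalgebra (B : set A) : Prop :=
  [/\ B 1, (forall c a b, B a -> B b -> B (c *: a + b)),
      (forall a b, B a -> B b -> B (a * b)) & (forall a, B a -> B (star a))].

Definition vn_subalgebra (B : set A) : Prop :=
  star_subalgebra B /\ bicommutant_closed (vna_dot A) ((@rep R A) @` B).

Definition generated (S : set A) : set A :=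
  [set a | forall B, star_subalgebra B -> S `<=` B -> B a].

(* Free independence of a family of subsets is that of the unital              *)
(* *-subalgebras which they generate.                                          *)
Definition freely_independent (J : eqType) (S : J -> set A) : Prop :=
  forall w : seq (J * A),
    w != [::] ->
    sorted (fun u v : J * A => u.1 != v.1) w ->
    (forall u, u \in w -> generated (S u.1) u.2 /\ tr u.2 = 0) ->
    tr (\prod_(u <- w) u.2) = 0.

(* The form <A (x) B, C (x) D> = tr (star C * A) tr (B * star D).              *)
Definition tdot (x y : tpow 2 A) : R[i] :=
  \sum_(p <- repr x) \sum_(q <- repr y)
    p.1 * q.1^* * tr (star (q.2 ord0) * p.2 ord0)
                * tr (p.2 ord_max * star (q.2 ord_max)).

Definition tnorm2 (x : tpow 2 A) : R := Num.sqrt (complex.Re (tdot x x)).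

Record L2completion := L2Completion {
  L2 :> lmodType R[i];
  L2dot : {dot L2 for @Num.conj R[i]};
  L2_complete : hcomplete L2dot;
  L2emb : {linear A -> L2};
  L2emb_dot : forall a b, L2dot (L2emb a) (L2emb b) = tr (star b * a);
  L2emb_dense : forall x (e : R), 0 < e ->
    exists a, hnorm L2dot (x - L2emb a) < e
}.

End Algebra.

Arguments L2dot {R A} _.

Definition noncrossing (n : nat) (P : {set {set 'I_n}}) : bool :=
  [forall B in P, forall C in P, (B != C) ==>
    ~~ [exists i : 'I_n, exists j : 'I_n, exists k : 'I_n, exists l : 'I_n,
         [&& (i < j < k)%N, (k < l)%N, i \in B, j \in C, k \in B & l \in C]]].

Section Distributions.
Context (R : realType).
Local Notation distribution_on_R := (probability (measurableTypeR R) R).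

Definition compactly_supported (nu : distribution_on_R) : Prop :=
  exists K : R, nu (~` `[- K, K]) = 0%E.

Definition moment (nu : distribution_on_R) (n : nat) : R :=
  Rintegral nu setT (fun x : R => x ^+ n).

(* The moment-cumulant formula; it determines r n for n > 0.                   *)
Definition has_free_cumulants (nu : distribution_on_R) (r : nat -> R) : Prop :=
  forall n, (0 < n)%N ->
    moment nu n =
      \sum_(P : {set {set 'I_n}} | finset.partition P [set: 'I_n]%SET && noncrossing P)
         \prod_(B in P) r #|B|.

(* Free additive convolution adds free cumulants: the n-fold convolution power *)
(* of a compactly supported nu is mu iff the cumulants of mu are n times those *)
(* of nu.                                                                      *)
Definition freely_infinitely_divisible (mu : distribution_on_R) : Prop :=
  forall n, (0 < n)%N ->
    exists (nu : distribution_on_R) (r : nat -> R),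
      [/\ compactly_supported nu, has_free_cumulants nu r &
          has_free_cumulants mu (fun k => n%:R * r k)].

Definition free_convolution_semigroup (mut : R -> distribution_on_R)
    (r : nat -> R) : Prop :=
  forall t, 0 <= t ->
    compactly_supported (mut t) /\
    has_free_cumulants (mut t) (fun k => t * r k).

Definition has_distribution (A : tracialVNA R) (a : A) (nu : distribution_on_R) :
    Prop :=
  forall n, tr (a ^+ n) = (moment nu n)%:C.

End Distributions.

Section Stochastic.
Context (R : realType) (A : tracialVNA R) (At : R -> set A).

Definition filtration : Prop :=
  (forall t, 0 <= t -> vn_subalgebra (At t)) /\
  (forall s t, 0 <= s -> s <= t -> At s `<=` At t).

(* An interval [a, b) with 0 <= a <= b is encoded by its end points, X a b     *)
(* being the value at [a, b).                                                  *)
Definition free_stochastic_measure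
    (mut : R -> probability (measurableTypeR R) R) (X : R -> R -> A) : Prop :=
  [/\ (forall a b, 0 <= a -> a <= b -> star (X a b) = X a b),
      (forall a b c, 0 <= a -> a <= b -> b <= c -> X a b + X b c = X a c),
      (forall a b, 0 <= a -> a <= b -> has_distribution (X a b) (mut (b - a))),
      (forall (n : nat) (a b : 'I_n -> R),
         (forall i, 0 <= a i /\ a i <= b i) ->
         (forall i j, i != j -> `[a i, b i[ `&` `[a j, b j[ = set0) ->
         freely_independent (fun i => [set X (a i) (b i)])) &
      (forall a b t, 0 <= a -> a <= b -> 0 <= t ->
         (`[a, b[ `<=` `[0, t[ -> At t (X a b)) /\
         (`[a, b[ `&` `[0, t[ = set0 ->
          freely_independent
            (fun i : bool => if i then [set X a b] else At t)))].

Definition diagonal_sum (X : R -> R -> A) (k : nat) (a b : R) (N : nat) : A :=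
  \sum_(1 <= i < N.+1) X (a + (i.-1)%:R / N%:R * (b - a))
                         (a + i%:R / N%:R * (b - a)) ^+ k.

(* Delta k a b is the operator norm limit defining the k-th diagonal measure   *)
(* of [a, b).                                                                  *)
Definition diagonal_measures (X : R -> R -> A) (Delta : nat -> R -> R -> A) :
    Prop :=
  forall k a b, (0 < k)%N -> 0 <= a -> a <= b ->
    opnorm (diagonal_sum X k a b N - Delta k a b) @[N --> \oo] --> (0 : R).

(* Biprocesses are functions on R whose values at negative times are           *)
(* irrelevant.                                                                 *)
Definition biprocess := R -> tpow 2 A.

(* ((a, b), (S, T)) stands for the step S (x) T 1_[a, b).                       *)
Definition step : Type := (R * R) * (A * A).
Definition lo (e : step) : R := e.1.1.
Definition hi (e : step) : R := e.1.2.
Definition lft (e : step) : A := e.2.1.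
Definition rgt (e : step) : A := e.2.2.

Definition adapted_step (e : step) : Prop :=
  [/\ 0 <= lo e, lo e <= hi e, At (lo e) (lft e) & At (lo e) (rgt e)].

Definition step_sum (s : seq step) (t : R) : tpow 2 A :=
  \sum_(e <- s) (if lo e <= t < hi e then tens2 (lft e) (rgt e) else 0).

Definition represents (s : seq step) (U : biprocess) : Prop :=
  {in s, forall e, adapted_step e} /\ forall t, 0 <= t -> U t = step_sum s t.

Definition simple (U : biprocess) : Prop := exists s, represents s U.

(* Linear extension of S (x) T 1_[a, b) |-> S (D b - D a) T, computed on any   *)
(* presentation of U as a combination of steps; 0 if U is not simple.          *)
Definition sint (D : R -> A) (U : biprocess) : A :=
  xget 0 [set J | exists2 s, represents s U &
    J = \sum_(e <- s) lft e * (D (hi e) - D (lo e)) * rgt e].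

Definition windowed (t1 t2 : R) (U : biprocess) : biprocess :=
  fun t => if t1 <= t < t2 then U t else 0.

Definition adapted (W : biprocess) : Prop :=
  forall t, 0 <= t -> exists2 s : seq (A * A),
    {in s, forall p, At t p.1 /\ At t p.2} &
    W t = \sum_(p <- s) tens2 p.1 p.2.

Context (L : L2completion A).
Local Notation leb := (@lebesgue_measure R).
Local Notation times := ([set` `[0%R, +oo[%R] : set R).

(* xi is the integral of f over [0, oo), in the weak sense; real parts suffice *)
(* since eta may be multiplied by i.                                           *)
Definition is_L2_integral (f : R -> L) (xi : L) : Prop :=
  forall eta : L,
    leb.-integrable times (fun s => (complex.Re (L2dot L (f s) eta))%:E) /\
    Rintegral leb times (fun s => complex.Re (L2dot L (f s) eta)) =
      complex.Re (L2dot L xi eta).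

Definition approximates (Wn : nat -> biprocess) (W : biprocess) : Prop :=
  [/\ (forall n, simple (Wn n)),
      (forall n, measurable_fun times (fun s : R => tnorm2 (Wn n s - W s))),
      (\int[leb]_(s in times) (tnorm2 (Wn n s - W s) ^+ 2)%:E)%E
        @[n --> \oo] --> (0 : \bar R)%E &
      exists2 xi : nat -> L,
        (forall n, is_L2_integral (fun s => L2emb L (tmul (Wn n s - W s))) (xi n))
        & hcvg (L2dot L) xi 0].

Definition is_sint (D : R -> A) (W : biprocess) (J : L) : Prop :=
  [/\ adapted W,
      exists Wn, approximates Wn W &
      forall Wn, approximates Wn W ->
        hcvg (L2dot L) (fun n => L2emb L (sint D (Wn n))) J].

End Stochastic.

(* Main.v *)
Require Import Defs.
From mathcomp Require Import all_boot all_order all_algebra.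
From mathcomp Require Import complex.
From mathcomp Require Import all_classical all_reals all_analysis.
From mathcomp Require Import measurable_realfun.
From mathcomp Require Import ring lra zify.

Set Implicit Arguments.
Unset Strict Implicit.
Unset Printing Implicit Defensive.

Import Order.TTheory GRing.Theory Num.Theory.
Import numFieldNormedType.Exports.

Local Open Scope classical_set_scope.
Local Open Scope ring_scope.
Local Open Scope complex_scope.

(** On a short interval [r, r') the biprocess U is a constant sum of tensors
    S (x) T with S and T in At r, so that M (r') = M (r) + h, where h is the
    sum of the S Y T and Y = X r r' is free from At r. Expanding p (M (r) + h)
    gives words b0 Y b1 Y ... Y bk with all gaps b0, ..., bk in At r
    (word_expansion). By freeness such a word is, up to a negligible error,
    tr b1 ... tr b(k-1) b0 Y^k bk: the inner gaps are replaced by their traces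
    (gap_replacement). The sum over all words with k letters is then exactly
    the k-th integrand of the theorem at time r, acting on Y^k
    (integrand_formula), and the sums of the powers Y^k over the cells of a
    subdivision converge to the k-th diagonal measure. Summing over the cells,
    p (M) - p (0) is approximated by Riemann sums of the integrals of the
    theorem (ito_refined). There are only finitely many nonzero terms, since
    the k-th derivative of p vanishes for k > deg p.

    An error on a cell of length d is negligible when its norm is O(d) and its
    conditional expectation given the past is O(d^(3/2)): errors on different
    cells are then almost orthogonal, and about 1/d of them add up to
    O(sqrt d) (block, small_incr, block_sum). Conditional expectations are
    only used by duality, as bounds on tr (x E) for x in the past. The basic
    example is Y c Y for a centered c in the past: the fourth order moment
    formula of free variables (free_prod4) gives it the norm tr (Y^2) |c|,
    and this yields the bound on all words that have a centered gap
    (bad_word_small). The argument also needs operator norm bounds on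
    increments which are uniform on bounded intervals (X_mulbd); these come
    from the fact that the centered X 0 t is a compression of the centered
    X 0 T for T > t.

    The integrals are handled in three steps. First, Delta k 0 b - Delta k 0 a
    is a limit of sums of k-th powers over subdivisions of [a, b), which is
    shown by interleaving the even subdivisions of [0, a) and [0, b)
    (fine_cells_ex). Secondly, on step biprocesses V the integral against the
    k-th diagonal measure is bounded by the L2 norm of V and the norm of the
    integral of the product m (V), the two quantities in the definition of
    approximation (step_integral_bound); here one needs that the form on the
    tensor square is positive, which follows from Gram-Schmidt
    orthogonalization of the left factors (tdot_ge0). Thirdly, the integrands
    are Hoelder continuous of exponent 1/2 on each interval where U is
    constant, so their discretizations on refined grids approximate them; the
    weak integrals in L2 are limits of Riemann sums (weak_integral_window).
    Together these facts give the existence of the integrals, their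
    independence of the approximation, and their value as the limit of the
    Riemann sums above (is_sint_ex). *)

(** * Positive semidefinite Hermitian forms *)

Section ComplexReal.
Context (R : realType).
Local Notation C := R[i].
Local Notation Re := complex.Re.
Implicit Types z w : C.

Lemma ReD z w : Re (z + w) = Re z + Re w.
Proof. by case: z w => [a b] [c d]. Qed.

Lemma ReN z : Re (- z) = - Re z.
Proof. by case: z. Qed.

Lemma ReB z w : Re (z - w) = Re z - Re w.
Proof. by rewrite ReD ReN. Qed.

Lemma Re_sum (I : Type) (s : seq I) (P : pred I) (f : I -> C) :
  Re (\sum_(i <- s | P i) f i) = \sum_(i <- s | P i) Re (f i).
Proof. by apply: (big_morph _ ReD). Qed.

Lemma Re_rM (c : R) z : Re (c%:C * z) = c * Re z.
Proof. by case: z => a b /=; rewrite mul0r subr0. Qed.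

Lemma Re_conj z : Re (Num.conj z) = Re z.
Proof. by case: z. Qed.

Lemma conjcE z : Num.conj z = conjc z.
Proof. by []. Qed.

Lemma normrC z : `|z| = (Normc.normc z)%:C.
Proof. by []. Qed.

Lemma normc_ge0 z : 0 <= Normc.normc z.
Proof. by rewrite -ler0c -normrC. Qed.

Lemma Re_le_normc z : `|Re z| <= Normc.normc z.
Proof. by rewrite -lecR -normrC; exact: normc_ge_Re. Qed.

Lemma normc_sqr z : Normc.normc z ^+ 2 = Re (z * Num.conj z).
Proof.
case: z => a b /=; rewrite sqr_sqrtr ?addr_ge0 ?sqr_ge0//.
by rewrite mulrN opprK !expr2.
Qed.

Lemma normcR (c : R) : Normc.normc c%:C = `|c|.
Proof. by rewrite /= expr0n /= addr0 sqrtr_sqr. Qed.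

Lemma normcJ z : Normc.normc (Num.conj z) = Normc.normc z.
Proof. by case: z => a b /=; rewrite sqrrN. Qed.

(** Rotating z to the positive real axis reduces bounds on moduli to bounds
    on real parts. *)
Lemma normc_phase z : exists w, Normc.normc w = 1 /\ Re (w * z) = Normc.normc z.
Proof.
have [->|z0] := eqVneq z 0.
  by exists 1; rewrite mulr0 Normc.normc1 Normc.normc0.
have nz0 : Normc.normc z != 0 by apply: contra_neq z0 => /Normc.eq0_normc.
exists ((Normc.normc z)^-1%:C * Num.conj z); split.
  rewrite Normc.normcM normcR normcJ ger0_norm ?invr_ge0 ?normc_ge0//.
  by rewrite mulVf.
rewrite -mulrA Re_rM (mulrC (Num.conj z)) -normc_sqr expr2.
by rewrite mulrA mulVf// mul1r.
Qed.

End ComplexReal.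

Section SemiInnerProduct.
Context (R : realType) (H : lmodType R[i]) (d : H -> H -> R[i]).
Local Notation Re := complex.Re.
Local Notation normc := Normc.normc.

(** One theory covers the trace form on the algebra, the form on its tensor
    square and the inner products of the Hilbert spaces. *)
Record semi_inner : Prop := SemiInner {
  semi_lin : forall c x y z, d (c *: x + y) z = c * d x z + d y z;
  semi_herm : forall x y, d y x = Num.conj (d x y);
  semi_ge0 : forall x, 0 <= Re (d x x) }.

Hypothesis hd : semi_inner.
Local Notation nm := (hnorm d).

Lemma semiDl x y z : d (x + y) z = d x z + d y z.
Proof. by rewrite -[x]scale1r (semi_lin hd) mul1r scale1r. Qed.

Lemma semi0l z : d 0 z = 0.
Proof. by apply: (addrI (d 0 z)); rewrite -semiDl !addr0. Qed.

Lemma semiZl c x z : d (c *: x) z = c * d x z.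
Proof. by rewrite -[c *: x]addr0 (semi_lin hd) semi0l addr0. Qed.

Lemma semiNl x z : d (- x) z = - d x z.
Proof. by rewrite -scaleN1r semiZl mulN1r. Qed.

Lemma semiDr x y z : d z (x + y) = d z x + d z y.
Proof.
by rewrite (semi_herm hd (x + y) z) semiDl rmorphD (semi_herm hd x z) (semi_herm hd y z).
Qed.

Lemma semiZr c x z : d z (c *: x) = Num.conj c * d z x.
Proof. by rewrite (semi_herm hd (c *: x) z) semiZl rmorphM (semi_herm hd x z). Qed.

Lemma semiNr x z : d z (- x) = - d z x.
Proof. by rewrite (semi_herm hd (- x) z) semiNl rmorphN (semi_herm hd x z). Qed.

Lemma Re_semiC x y : Re (d x y) = Re (d y x).
Proof. by rewrite (semi_herm hd y x) Re_conj. Qed.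

Lemma hnorm_ge0 x : 0 <= nm x. Proof. exact: sqrtr_ge0. Qed.

Lemma hnorm_sqr x : nm x ^+ 2 = Re (d x x).
Proof. by rewrite sqr_sqrtr ?(semi_ge0 hd). Qed.

Lemma hnorm0 : nm 0 = 0.
Proof. by rewrite /hnorm semi0l sqrtr0. Qed.

Lemma hnormZ c x : nm (c *: x) = normc c * nm x.
Proof.
apply/eqP; rewrite -(eqrXn2 (n := 2)) ?mulr_ge0 ?normc_ge0 ?hnorm_ge0//.
rewrite exprMn !hnorm_sqr semiZl semiZr mulrA normc_sqr.
have -> : c * Num.conj c = (normc c ^+ 2)%:C.
  by rewrite -normCK normrC -rmorphXn.
by rewrite Re_rM.
Qed.

Lemma hnormN x : nm (- x) = nm x.
Proof. by rewrite /hnorm semiNl semiNr opprK. Qed.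

Lemma hnormBC x y : nm (x - y) = nm (y - x).
Proof. by rewrite -hnormN opprB. Qed.

Lemma hnormD_sqr x y : nm (x + y) ^+ 2 = nm x ^+ 2 + 2 * Re (d x y) + nm y ^+ 2.
Proof.
rewrite !hnorm_sqr semiDl !semiDr !ReD (Re_semiC y x); ring.
Qed.

Lemma cauchy_schwarz_Re x y : `|Re (d x y)| <= nm x * nm y.
Proof.
rewrite -(ler_pXn2r (n := 2)) ?nnegrE ?mulr_ge0 ?hnorm_ge0//.
rewrite exprMn real_normK ?num_real//.
set b := Re _; set p := nm x ^+ 2; set q := nm y ^+ 2.
have key (t : R) : 0 <= p + 2 * t * b + t ^+ 2 * q.
  have := sqr_ge0 (nm (x + t%:C *: y)); rewrite hnormD_sqr hnormZ normcR exprMn.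
  rewrite real_normK ?num_real// semiZr conjcE conjc_real Re_rM.
  by rewrite -/b -/p -/q mulrA.
have p0 : 0 <= p by exact: sqr_ge0.
have q0 : 0 <= q by exact: sqr_ge0.
have [q00|qn0] := eqVneq q 0.
  have [->|bn0] := eqVneq b 0; first by rewrite expr0n mulr_ge0.
  have := key (- (p + 1) / (2 * b)); rewrite q00 mulr0 addr0.
  have -> : 2 * (- (p + 1) / (2 * b)) * b = - (p + 1) by field.
  by rewrite opprD addrA subrr add0r ler0N1.
have := key (- b / q).
have -> : p + 2 * (- b / q) * b + (- b / q) ^+ 2 * q = (p * q - b ^+ 2) / q by field.
by rewrite pmulr_lge0 ?invr_gt0 ?lt_def ?qn0// subr_ge0.
Qed.

Lemma cauchy_schwarz x y : normc (d x y) <= nm x * nm y.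
Proof.
have [w [w1 <-]] := normc_phase (d x y).
rewrite -semiZl; apply: le_trans (ler_norm _) _.
by apply: le_trans (cauchy_schwarz_Re _ _) _; rewrite hnormZ w1 mul1r.
Qed.

Lemma hnormD x y : nm (x + y) <= nm x + nm y.
Proof.
rewrite -(ler_pXn2r (n := 2)) ?nnegrE ?addr_ge0 ?hnorm_ge0//.
rewrite hnormD_sqr sqrrD lerD2r lerD2l -[leRHS]mulr_natl.
by rewrite ler_pM2l// (le_trans (ler_norm _)) ?cauchy_schwarz_Re.
Qed.

Lemma hnormB x y : nm (x - y) <= nm x + nm y.
Proof. by apply: le_trans (hnormD _ _) _; rewrite hnormN. Qed.

Lemma hnorm_sum (I : Type) (s : seq I) (P : pred I) (f : I -> H) :
  nm (\sum_(i <- s | P i) f i) <= \sum_(i <- s | P i) nm (f i).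
Proof.
elim/big_rec2: _ => [|i y x _ IH]; first by rewrite hnorm0.
by apply: le_trans (hnormD _ _) _; rewrite lerD2l.
Qed.

Lemma ler_hnormB x y : `|nm x - nm y| <= nm (x - y).
Proof.
have h u v : nm u - nm v <= nm (u - v).
  by rewrite lerBlDr; apply: le_trans (hnormD _ _); rewrite subrK.
by rewrite ler_norml h andbT lerNl opprB hnormBC h.
Qed.

Lemma hnorm_triangle3 z x y : nm (x - y) <= nm (x - z) + nm (z - y).
Proof. by apply: le_trans (hnormD _ _); rewrite addrA subrK. Qed.

Lemma hnormB_sqr_le x y : nm (x - y) ^+ 2 <= 2 * (nm x ^+ 2 + nm y ^+ 2).
Proof.
have := sqr_ge0 (nm (x + y)); rewrite !hnormD_sqr semiNr ReN hnormN; lra.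
Qed.

Lemma Re_semi_suml (I : Type) (s : seq I) (P : pred I) (f : I -> H) z :
  d (\sum_(i <- s | P i) f i) z = \sum_(i <- s | P i) d (f i) z.
Proof. by apply: (big_morph (d^~ z)) => [x y|]; rewrite ?semiDl ?semi0l. Qed.

End SemiInnerProduct.

Lemma dot_semi_inner (R : realType) (H : lmodType R[i])
    (d : {dot H for @Num.conj R[i]}) : semi_inner d.
Proof.
split => [c x y z|x y|x].
- exact: linearPl.
- by rewrite hermC /= expr0 mul1r.
- by have := dnorm_ge0 d x; rewrite lecE => /andP[].
Qed.

Lemma dot_inj (R : realType) (H : lmodType R[i])
    (d : {dot H for @Num.conj R[i]}) x y : (forall z, complex.Re (d x z) = complex.Re (d y z)) -> x = y.
Proof.
move=> h; apply/eqP; rewrite -subr_eq0 -(dnorm_eq0 d) eq_complex/=.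
have := dnorm_ge0 d (x - y); rewrite lecE => /andP[/eqP -> _]/=.
by rewrite linearBl ReB h subrr !eqxx.
Qed.

Lemma hnorm_eq0 (R : realType) (H : lmodType R[i])
    (d : {dot H for @Num.conj R[i]}) x : hnorm d x = 0 -> x = 0.
Proof.
move=> h; apply/eqP; rewrite -(dnorm_eq0 d) eq_complex/=.
have := dnorm_ge0 d x; rewrite lecE => /andP[/eqP -> _]/=.
by rewrite -(hnorm_sqr (dot_semi_inner d)) h expr0n eqxx.
Qed.

(** * The trace of a tracial von Neumann algebra *)

Section TraceGeometry.
Context (R : realType) (A : tracialVNA R).
Local Notation Re := complex.Re.
Local Notation normc := Normc.normc.
Local Notation dot := (vna_dot A).
Implicit Types (a b x y z : A) (c : R[i]) (u v : vna_hilb A).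

Let hdot : semi_inner dot := dot_semi_inner dot.

Lemma rep_eqP a b : (forall u v, dot (rep a u) v = dot (rep b u) v) -> a = b.
Proof.
move=> h; apply: (@rep_inj _ A); apply: funext => u; apply: (dot_inj (d := dot)) => v.
by rewrite h.
Qed.

Lemma rep_starl a u v : dot (rep (star a) u) v = dot u (rep a v).
Proof. by rewrite (semi_herm hdot v) -rep_star -(semi_herm hdot). Qed.

Lemma repD a b u : rep (a + b) u = rep a u + rep b u.
Proof. by rewrite -{1}[a]scale1r rep_linear scale1r. Qed.

Lemma rep0 u : rep (0 : A) u = 0.
Proof. by apply: (addrI (rep (0 : A) u)); rewrite -repD !addr0. Qed.

Lemma repZ c a u : rep (c *: a) u = c *: rep a u.
Proof. by rewrite -[c *: a]addr0 rep_linear rep0 addr0. Qed.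

Lemma repB a b u : rep (a - b) u = rep a u - rep b u.
Proof. by rewrite repD -[- b]scaleN1r repZ scaleN1r. Qed.

Lemma starK : involutive (@star R A).
Proof. by move=> a; apply: rep_eqP => u v; rewrite rep_starl -rep_star. Qed.

Lemma starM a b : star (a * b) = star b * star a.
Proof.
apply: rep_eqP => u v.
by rewrite !(rep_mul, rep_starl).
Qed.

Lemma star_linear c a b : star (c *: a + b) = Num.conj c *: star a + star b.
Proof.
apply: rep_eqP => u v.
rewrite rep_starl !rep_linear (semiDl hdot) (semiZl hdot) !rep_starl.
by rewrite (semiDr hdot) (semiZr hdot).
Qed.

Lemma starD a b : star (a + b) = star a + star b.
Proof. by rewrite -[a]scale1r star_linear rmorph1 !scale1r. Qed.

Lemma star0 : star (0 : A) = 0.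
Proof. by apply: (addrI (star (0 : A))); rewrite -starD !addr0. Qed.

Lemma starZ c a : star (c *: a) = Num.conj c *: star a.
Proof. by rewrite -[c *: a]addr0 star_linear star0 addr0. Qed.

Lemma starN a : star (- a) = - star a.
Proof. by rewrite -[- a]scaleN1r starZ rmorphN rmorph1 scaleN1r. Qed.

Lemma starB a b : star (a - b) = star a - star b.
Proof. by rewrite starD starN. Qed.

Lemma star1 : star (1 : A) = 1.
Proof. by rewrite -[LHS]mulr1 -{2}[1 : A]starK -starM mulr1 starK. Qed.

Lemma starX a n : star (a ^+ n) = star a ^+ n.
Proof. by elim: n => [|n IH]; rewrite ?expr0 ?star1// exprS starM IH exprSr. Qed.

Lemma star_sum (I : Type) (s : seq I) (P : pred I) (f : I -> A) :
  star (\sum_(i <- s | P i) f i) = \sum_(i <- s | P i) star (f i).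
Proof. by apply: (big_morph _ starD star0). Qed.

Lemma trD a b : tr (a + b) = tr a + tr b. Proof. exact: linearD. Qed.
Lemma trZ c a : tr (c *: a) = c * tr a. Proof. exact: linearZ. Qed.
Lemma trB a b : tr (a - b) = tr a - tr b. Proof. exact: linearB. Qed.
Lemma tr_scalar c : tr (c%:A : A) = c. Proof. by rewrite trZ tr_one mulr1. Qed.

(** The trace is Hermitian because its values at the positive elements (1 +
    a)^* (1 + a) and (1 + i a)^* (1 + i a) are real. *)
Lemma tr_star a : tr (star a) = Num.conj (tr a).
Proof.
have h b : complex.Im (tr (star b * b)) = 0 by apply: ger0_Im; exact: tr_ge0.
have h1 := h (1 + a); have h2 := h (1 + 'i *: a).
have := h a; have h0 := h (1 : A).
move: h1 h2 h0.
rewrite !starD !star1 !starZ !(mulrDl, mulrDr, mul1r, mulr1).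
rewrite -!scalerAl -!scalerAr !(trD, trZ, tr_one).
case: (tr a) => p q; case: (tr (star a)) => r s; case: (tr (star a * a)) => u v.
simpc => h1 h2 h0 h3.
move: h1 h2 h3 => /= h1 h2 h3; rewrite conjcE.
by apply/eqP; rewrite eq_complex/=; apply/andP; split; apply/eqP; lra.
Qed.

Definition trd x y : R[i] := tr (star y * x).

Lemma trd_semi : semi_inner trd.
Proof.
split=> [c x y z|x y|x]; rewrite /trd.
- by rewrite mulrDr -scalerAr trD trZ.
- by rewrite -tr_star starM starK.
- by have := tr_ge0 x; rewrite lecE => /andP[].
Qed.

(** The norm of L2 for the trace. *)
Definition nrm x : R := hnorm trd x.

Lemma nrm_ge0 x : 0 <= nrm x. Proof. exact: hnorm_ge0. Qed.
Lemma nrm_sqr x : nrm x ^+ 2 = Re (tr (star x * x)).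
Proof. by rewrite (hnorm_sqr trd_semi). Qed.
Lemma nrm0 : nrm 0 = 0. Proof. exact: (hnorm0 trd_semi). Qed.
Lemma nrm1 : nrm 1 = 1.
Proof. by rewrite /nrm /hnorm /trd star1 mul1r tr_one sqrtr1. Qed.
Lemma nrmZ c x : nrm (c *: x) = normc c * nrm x. Proof. exact: (hnormZ trd_semi). Qed.
Lemma nrmN x : nrm (- x) = nrm x. Proof. exact: (hnormN trd_semi). Qed.
Lemma nrmD x y : nrm (x + y) <= nrm x + nrm y. Proof. exact: (hnormD trd_semi). Qed.
Lemma nrmB x y : nrm (x - y) <= nrm x + nrm y. Proof. exact: (hnormB trd_semi). Qed.
Lemma nrmBC x y : nrm (x - y) = nrm (y - x). Proof. exact: (hnormBC trd_semi). Qed.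
Lemma nrm_sum (I : Type) (s : seq I) (P : pred I) (f : I -> A) :
  nrm (\sum_(i <- s | P i) f i) <= \sum_(i <- s | P i) nrm (f i).
Proof. exact: (hnorm_sum trd_semi). Qed.

Lemma nrm_star x : nrm (star x) = nrm x.
Proof. by rewrite /nrm /hnorm /trd starK tr_trace. Qed.

Lemma tr_le_nrm x y : normc (tr (x * y)) <= nrm x * nrm y.
Proof. by have := cauchy_schwarz trd_semi y (star x); rewrite /trd starK -/(nrm _) -/(nrm _) nrm_star mulrC. Qed.

Lemma tr_le_nrm1 x : normc (tr x) <= nrm x.
Proof. by have := tr_le_nrm x 1; rewrite mulr1 nrm1 mulr1. Qed.

(** For a <= b the set {a, b} is directed with least upper bound b, so that
    normality makes the trace of b the supremum of the traces of a and b. *)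
Lemma Re_tr_le a b : star a = a -> star b = b -> vna_le a b -> Re (tr a) <= Re (tr b).
Proof.
move=> sa sb ab.
have vna_lexx (d : A) : vna_le d d.
  by move=> x; rewrite subrr rep0 (semi0l hdot).
have -> : Re (tr b) = sup [set Re (tr d) | d in [set a; b]].
  apply: tr_normal => //.
  - by exists a; left.
  - by move=> d [] ->.
  - by move=> d e [] -> [] ->; exists b; split => //; right.
  - by move=> d [] ->.
  - by move=> d _ h; apply: h; right.
apply: sup_ubound; last by exists a => //; left.
by exists (Num.max (Re (tr a)) (Re (tr b))) => _ [d [] -> <-]; rewrite le_max lexx ?orbT.
Qed.

(** The form in which bounds on operator norms are used: it is stable under
    sums and products, and it speaks of the 2-norm only. *)
Definition mulbd (K : R) a := 0 <= K /\ forall x, nrm (a * x) <= K * nrm x /\ nrm (x * a) <= K * nrm x.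

Lemma mulbd_ge0 K a : mulbd K a -> 0 <= K. Proof. by case. Qed.
Lemma mulbd_l K a x : mulbd K a -> nrm (a * x) <= K * nrm x.
Proof. by case=> _ /(_ x)[]. Qed.
Lemma mulbd_r K a x : mulbd K a -> nrm (x * a) <= K * nrm x.
Proof. by case=> _ /(_ x)[]. Qed.
Lemma mulbd_nrm K a : mulbd K a -> nrm a <= K.
Proof. by move=> h; have := mulbd_l 1 h; rewrite mulr1 nrm1 mulr1. Qed.

Lemma mulbd_left K a : 0 <= K -> star a = a -> (forall x, nrm (a * x) <= K * nrm x) -> mulbd K a.
Proof.
move=> K0 sa h; split => // x; split => //.
by rewrite -nrm_star starM sa (le_trans (h _))// nrm_star.
Qed.

Lemma mulbdW K K' a : K <= K' -> mulbd K a -> mulbd K' a.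
Proof.
move=> KK h; split; first exact: le_trans (mulbd_ge0 h) KK.
move=> x; split; [apply: le_trans (mulbd_l x h) _|apply: le_trans (mulbd_r x h) _];
  by rewrite ler_wpM2r ?nrm_ge0.
Qed.

Lemma mulbd1 : mulbd 1 1.
Proof. by split => // x; rewrite mul1r mulr1 mul1r. Qed.

Lemma mulbdM K K' a b : mulbd K a -> mulbd K' b -> mulbd (K * K') (a * b).
Proof.
move=> ha hb; have K0 := mulbd_ge0 ha; have K'0 := mulbd_ge0 hb.
split; first exact: mulr_ge0.
move=> x; split.
- rewrite -!mulrA; apply: le_trans (mulbd_l _ ha) _.
  by rewrite ler_wpM2l// mulbd_l.
- rewrite [x * _]mulrA [K * K']mulrC -[K' * K * _]mulrA; apply: le_trans (mulbd_r _ hb) _.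
  by rewrite ler_wpM2l// mulbd_r.
Qed.

Lemma mulbdD K K' a b : mulbd K a -> mulbd K' b -> mulbd (K + K') (a + b).
Proof.
move=> ha hb; split; first by rewrite addr_ge0 ?(mulbd_ge0 ha) ?(mulbd_ge0 hb).
by move=> x; rewrite mulrDl mulrDr mulrDl; split;
  (apply: le_trans (nrmD _ _) _; rewrite lerD ?mulbd_l ?mulbd_r).
Qed.

Lemma mulbdZ K a c : mulbd K a -> mulbd (normc c * K) (c *: a).
Proof.
move=> ha; split; first by rewrite mulr_ge0 ?normc_ge0 ?(mulbd_ge0 ha).
by move=> x; rewrite -scalerAl -scalerAr !nrmZ -!mulrA; split;
  rewrite ler_wpM2l ?normc_ge0// ?mulbd_l ?mulbd_r.
Qed.

Lemma mulbdN K a : mulbd K a -> mulbd K (- a).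
Proof. by case=> K0 h; split => // x; rewrite mulNr mulrN !nrmN. Qed.

Lemma mulbdB K K' a b : mulbd K a -> mulbd K' b -> mulbd (K + K') (a - b).
Proof. by move=> ha hb; apply: mulbdD => //; apply: mulbdN. Qed.

Lemma mulbdX K a n : mulbd K a -> mulbd (K ^+ n) (a ^+ n).
Proof.
by move=> ha; elim: n => [|n IH]; [exact: mulbd1|rewrite !exprS; apply: mulbdM].
Qed.

Lemma mulbd_lr K K' a b x : mulbd K a -> mulbd K' b -> nrm (a * x * b) <= K * K' * nrm x.
Proof.
move=> ha hb; apply: le_trans (mulbd_r _ hb) _.
by rewrite [K * K']mulrC -mulrA ler_wpM2l ?(mulbd_ge0 hb)// mulbd_l.
Qed.

(** The quadratic form of c^2 x^* x - (a x)^* (a x) is nonnegative, hence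
    its trace is. *)
Lemma rep_mulbd_l a (c : R) x : 0 <= c ->
  (forall v, hnorm dot (rep a v) <= c * hnorm dot v) -> nrm (a * x) <= c * nrm x.
Proof.
move=> c0 h.
rewrite -(ler_pXn2r (n := 2)) ?nnegrE ?mulr_ge0 ?nrm_ge0// exprMn !nrm_sqr.
rewrite -Re_rM -trZ; apply: Re_tr_le.
- by rewrite starM starK.
- by rewrite starZ starM starK conjcE conjc_real.
move=> v; rewrite repB repZ (semiDl hdot) (semiNl hdot) (semiZl hdot).
rewrite !rep_mul !starM !rep_mul !rep_starl.
have real (w : vna_hilb A) : dot w w = (hnorm dot w ^+ 2)%:C.
  rewrite (hnorm_sqr hdot) -[LHS]RRe_real//.
  by rewrite realE; have := dnorm_ge0 dot w => ->.
rewrite !real -rmorphM -rmorphB ler0c subr_ge0 -exprMn.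
by rewrite ler_pXn2r ?nnegrE ?mulr_ge0 ?hnorm_ge0.
Qed.

Lemma rep_mulbd a (c : R) : 0 <= c ->
  (forall v, hnorm dot (rep a v) <= c * hnorm dot v) -> mulbd c a.
Proof.
move=> c0 h; split => // x; split; first exact: rep_mulbd_l.
rewrite -nrm_star starM -(nrm_star x); apply: rep_mulbd_l => // v.
have [->|v0] := eqVneq (hnorm dot (rep (star a) v)) 0.
  by rewrite mulr_ge0 ?hnorm_ge0.
have pos : 0 < hnorm dot (rep (star a) v) by rewrite lt_def v0 hnorm_ge0.
rewrite -(ler_pM2l pos) -expr2 (hnorm_sqr hdot) rep_starl.
apply: le_trans (ler_norm _) _; apply: le_trans (cauchy_schwarz_Re hdot _ _) _.
by rewrite [leRHS]mulrA [leRHS]mulrC ler_wpM2l ?hnorm_ge0// mulrC.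
Qed.

Lemma mulbd_ex a : exists K, mulbd K a.
Proof.
have [_ [c hc]] := rep_bounded a.
exists (Num.max c 0); apply: rep_mulbd => [|v]; first by rewrite le_max lexx orbT.
by apply: le_trans (hc v) _; rewrite ler_wpM2r ?hnorm_ge0// le_max lexx.
Qed.

Lemma opnorm_has_ubound a :
  has_ubound [set hnorm dot (rep a u) | u in [set u | hnorm dot u <= 1]].
Proof.
have [_ [c hc]] := rep_bounded a.
exists (Num.max c 0) => _ [u /= u1 <-]; apply: le_trans (hc u) _.
apply: (@le_trans _ _ (Num.max c 0 * hnorm dot u)).
  by rewrite ler_wpM2r ?hnorm_ge0// le_max lexx.
by rewrite ler_piMr// le_max lexx orbT.
Qed.

Lemma opnorm_bound a v : hnorm dot (rep a v) <= opnorm a * hnorm dot v.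
Proof.
have [lin [c hc]] := rep_bounded a.
have [v0|v0] := eqVneq (hnorm dot v) 0.
  by have := hc v; rewrite v0 !mulr0.
have vpos : 0 < hnorm dot v by rewrite lt_def v0 hnorm_ge0.
rewrite -ler_pdivrMr//; apply: (sup_ubound (opnorm_has_ubound a)).
exists ((hnorm dot v)^-1%:C *: v) => /=.
  by rewrite (hnormZ hdot) normcR ger0_norm ?invr_ge0 ?hnorm_ge0// mulVf.
have h0 : rep a 0 = 0.
  have := lin 1 0 0; rewrite !scale1r addr0 => /esym h.
  by apply: (addrI (rep a 0)); rewrite addr0.
rewrite -[X in rep a X]addr0 lin h0 addr0.
by rewrite (hnormZ hdot) normcR ger0_norm ?invr_ge0 ?hnorm_ge0// mulrC.
Qed.

Lemma opnorm_ge0 a : 0 <= opnorm a.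
Proof.
apply: le_trans (sup_ubound (opnorm_has_ubound a) _); first exact: (hnorm_ge0 dot (rep a 0)).
by exists 0 => //=; rewrite (hnorm0 hdot).
Qed.

Lemma nrm_le_opnorm a : nrm a <= opnorm a.
Proof.
have := @rep_mulbd_l a (opnorm a) 1 (opnorm_ge0 a) (opnorm_bound a).
by rewrite mulr1 nrm1 mulr1.
Qed.

End TraceGeometry.

(** * Free increments *)

Section Levy.
Context (R : realType) (A : tracialVNA R).

(** What the theorem uses of a free stochastic measure. The moments enter
    only through their first order in the length of the interval; kap n is
    the n-th free cumulant of the distribution of an increment of length 1. *)
Record free_increments (At : R -> set A) (X : R -> R -> A)
    (m : nat -> R -> R) (kap : nat -> R) : Prop := FreeIncrements {
  fi_one : forall t, 0 <= t -> At t 1;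
  fi_lin : forall t c x y, 0 <= t -> At t x -> At t y -> At t (c *: x + y);
  fi_mul : forall t x y, 0 <= t -> At t x -> At t y -> At t (x * y);
  fi_star : forall t x, 0 <= t -> At t x -> At t (star x);
  fi_mono : forall s t x, 0 <= s -> s <= t -> At s x -> At t x;
  fi_sa : forall a b, 0 <= a -> a <= b -> star (X a b) = X a b;
  fi_add : forall a b c, 0 <= a -> a <= b -> b <= c -> X a b + X b c = X a c;
  fi_adapted : forall a b, 0 <= a -> a <= b -> At b (X a b);
  fi_free : forall a b, 0 <= a -> a <= b ->
    freely_independent (fun i : bool => if i then [set X a b] else At a);
  fi_tr : forall a b n, 0 <= a -> a <= b -> tr (X a b ^+ n) = (m n (b - a))%:C;
  fi_mom : forall n T, (0 < n)%N -> exists2 C, 0 <= C &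
    forall t, 0 <= t -> t <= T -> `|m n t - kap n * t| <= C * t ^+ 2 }.

(** Each block of a partition contributes a factor t to the moment, so that
    the one-block partition gives the first order term. *)
Lemma cumulant_moment_order (r : nat -> R) (n : nat) :
  (0 < n)%N -> exists kap, forall T, exists2 C, 0 <= C & forall t, 0 <= t -> t <= T ->
   `|\sum_(P : {set {set 'I_n}} | finset.partition P [set: 'I_n]%SET && noncrossing P)
         \prod_(B in P) (t * r #|B|) - kap * t| <= C * t ^+ 2.
Proof.
move=> n0.
pose w (P : {set {set 'I_n}}) := \prod_(B in P) r #|B|.
pose good (P : {set {set 'I_n}}) := finset.partition P [set: 'I_n]%SET && noncrossing P.
exists (\sum_(P | good P && (#|P| == 1)%N) w P) => T.
exists (\sum_(P | good P && (#|P| != 1)%N) `|w P| * (1 + `|T|) ^+ #|P|).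
  by apply: sumr_ge0 => P _; rewrite mulr_ge0// exprn_ge0// addr_ge0.
move=> t t0 tT.
have -> : \sum_(P | good P) \prod_(B in P) (t * r #|B|) = \sum_(P | good P) t ^+ #|P| * w P.
  by apply: eq_bigr => P _; rewrite big_split/= prodr_const.
rewrite (bigID (fun P : {set {set 'I_n}} => #|P| == 1)%N)/=.
rewrite (eq_bigr (fun P => w P * t)); last first.
  by move=> P /andP[_ /eqP ->]; rewrite expr1 mulrC.
(* The partitions with one block cancel against kap * t; the others have a
   factor t^2. *)
rewrite -mulr_suml addrAC subrr add0r mulr_suml.
apply: le_trans (ler_norm_sum _ _ _) _; apply: ler_sum => P /andP[/andP[partP _] cP].
rewrite normrM mulrC -!mulrA ler_wpM2l// ger0_norm ?exprn_ge0//.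
have : (1 < #|P|)%N.
  rewrite ltn_neqAle eq_sym cP/= card_gt0.
  apply/negP => /eqP P0; move: partP; rewrite P0.
  move=> /andP[/eqP]; rewrite /finset.cover big_set0 => /setP/(_ (Ordinal n0)).
  by rewrite !inE.
case: #|P| => [//|[//|k]] _.
rewrite -[in leLHS](addn2 k) exprD ler_wpM2r ?exprn_ge0//.
have tT1 : t <= 1 + `|T| by apply: le_trans tT _; apply: le_trans (ler_norm _) _; rewrite lerDr.
apply: (@le_trans _ _ ((1 + `|T|) ^+ k)).
  by rewrite lerXn2r// nnegrE// addr_ge0.
by rewrite ler_weXn2l ?lerDl// leqW.
Qed.

Lemma free_stochastic_measure_increments (At : R -> set A) (HAt : filtration At)
    (r : nat -> R) (mut : R -> probability (measurableTypeR R) R)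
    (Hmut : free_convolution_semigroup mut r)
    (X : R -> R -> A) (HX : free_stochastic_measure At mut X) :
  exists m kap, free_increments At X m kap.
Proof.
case: HAt => Avn Amono; case: HX => Xsa Xadd Xdist _ Xfree.
have Asub t : 0 <= t -> star_subalgebra (At t) by move=> /Avn[].
pose kapP n := cumulant_moment_order r (n := n.+1) isT.
pose kap n := if n is n'.+1 then projT1 (cid (kapP n')) else 0.
exists (fun n t => moment (mut t) n), kap; split => //.
- by move=> t /Asub[].
- by move=> t c x y /Asub[_ h _ _]; exact: h.
- by move=> t x y /Asub[_ _ h _]; exact: h.
- by move=> t x /Asub[_ _ _ h]; exact: h.
- by move=> s t x s0 st; apply: Amono.
- move=> a b a0 ab; apply: (Xfree a b b a0 ab (le_trans a0 ab)).1.
  by move=> x /=; rewrite !in_itv/= => /andP[ax ->]; rewrite (le_trans a0).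
- move=> a b a0 ab; apply: (Xfree a b a a0 ab a0).2.
  apply/seteqP; split => // x [] /=; rewrite !in_itv/= => /andP[ax _] /andP[_].
  by rewrite ltNge ax.
- by move=> a b n a0 ab; apply: Xdist.
- move=> [//|n] T _; rewrite /kap; case: cid => /= k /(_ T)[C C0 hC].
  exists C => // t t0 tT; have [_ hc] := Hmut t t0.
  by rewrite (hc n.+1 isT); exact: hC.
Qed.

Context (At : R -> set A) (X : R -> R -> A) (m : nat -> R -> R) (kap : nat -> R).
Hypothesis hX : free_increments At X m kap.
Implicit Types (x y z : A) (s t a b : R).

Lemma AtD t x y : 0 <= t -> At t x -> At t y -> At t (x + y).
Proof. by move=> t0 hx hy; rewrite -[x]scale1r; apply: (fi_lin hX). Qed.

Lemma At0 t : 0 <= t -> At t 0.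
Proof.
by move=> t0; rewrite -(addNr 1) -scaleN1r; apply: (fi_lin hX) => //; apply: (fi_one hX).
Qed.

Lemma AtZ t c x : 0 <= t -> At t x -> At t (c *: x).
Proof. by move=> t0 hx; rewrite -[c *: x]addr0; apply: (fi_lin hX) => //; apply: At0. Qed.

Lemma AtN t x : 0 <= t -> At t x -> At t (- x).
Proof. by move=> t0 hx; rewrite -scaleN1r; apply: AtZ. Qed.

Lemma AtB t x y : 0 <= t -> At t x -> At t y -> At t (x - y).
Proof. by move=> t0 hx hy; apply: AtD => //; apply: AtN. Qed.

Lemma At_scalar t c : 0 <= t -> At t c%:A.
Proof. by move=> t0; apply: AtZ => //; apply: (fi_one hX). Qed.

Lemma AtX t x n : 0 <= t -> At t x -> At t (x ^+ n).
Proof.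
move=> t0 hx; elim: n => [|n IH]; first exact: (fi_one hX).
by rewrite exprS; apply: (fi_mul hX).
Qed.

Lemma At_sum t (I : Type) (s : seq I) (P : pred I) (f : I -> A) :
  0 <= t -> (forall i, P i -> At t (f i)) -> At t (\sum_(i <- s | P i) f i).
Proof.
move=> t0 h; elim/big_rec: _ => [|i x Pi hx]; first exact: At0.
by apply: AtD => //; apply: h.
Qed.

Lemma At_incr a b t : 0 <= a -> a <= b -> b <= t -> At t (X a b).
Proof.
by move=> a0 ab bt; apply: (fi_mono hX (le_trans a0 ab) bt); apply: (fi_adapted hX).
Qed.

Lemma X_refl a : 0 <= a -> X a a = 0.
Proof.
by move=> a0; apply: (addrI (X a a)); rewrite (fi_add hX)// addr0.
Qed.

Lemma generatedD (S : set A) c x y : generated S x -> generated S y -> generated S (c *: x + y).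
Proof. by move=> hx hy B hB SB; case: (hB) => _ h _ _; apply: h; [apply: hx|apply: hy]. Qed.

Lemma generated_scalar (S : set A) c : generated S c%:A.
Proof.
move=> B hB _; case: (hB) => B1 h _ _.
have B0 : B 0 by rewrite -(addNr 1) -scaleN1r; apply: h.
by rewrite -[c%:A]addr0; apply: h.
Qed.

Lemma generatedM (S : set A) x y : generated S x -> generated S y -> generated S (x * y).
Proof. by move=> hx hy B hB SB; case: (hB) => _ _ h _; apply: h; [apply: hx|apply: hy]. Qed.

Lemma generated_sub (S : set A) x : S x -> generated S x.
Proof. by move=> Sx B _; apply. Qed.

Lemma generatedX (S : set A) x n : generated S x -> generated S (x ^+ n).
Proof.
move=> hx; elim: n => [|n IH]; first by rewrite -[x ^+ 0]scale1r; apply: generated_scalar.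
by rewrite exprS; apply: generatedM.
Qed.

Definition centered x : A := x - (tr x)%:A.

Lemma tr_centered x : tr (centered x) = 0.
Proof. by rewrite trB tr_scalar subrr. Qed.

Lemma centeredK x : x = centered x + (tr x)%:A. Proof. by rewrite subrK. Qed.

Lemma At_centered t x : 0 <= t -> At t x -> At t (centered x).
Proof. by move=> t0 hx; apply: AtB => //; apply: At_scalar. Qed.

Lemma generated_centered (S : set A) x : generated S x -> generated S (centered x).
Proof.
by move=> hx; rewrite /centered addrC -scaleNr; apply: generatedD => //; have := @generated_scalar S 1; rewrite scale1r.
Qed.

Section Free.
Context (a b : R) (a0 : 0 <= a) (ab : a <= b).
Local Notation gen := (generated [set X a b]).

Lemma incr_gen n : gen (X a b ^+ n).
Proof. by apply: generatedX; apply: generated_sub. Qed.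

Lemma free_prod2 x y : At a x -> gen y -> tr (x * y) = tr x * tr y.
Proof.
move=> hx hy; have := fi_free hX a0 ab (w := [:: (false, centered x); (true, centered y)]) isT.
rewrite !big_cons big_nil mulr1 /= => /(_ isT).
have h : tr (centered x * centered y) = tr (x * y) - tr x * tr y.
  rewrite /centered mulrBl mulrBr !mulrBr !trB -!scalerAl -!scalerAr !mul1r !mulr1 !trZ tr_one.
  ring.
rewrite h => /(_ _)/eqP; rewrite subr_eq0 => H; apply/eqP; apply: H.
move=> u; rewrite !inE => /orP[]/eqP -> /=; rewrite tr_centered; split => //.
- by apply: generated_sub; apply: At_centered.
- exact: generated_centered.
Qed.

Lemma free_centered4 x y z w : At a x -> gen y -> At a z -> gen w ->
  tr x = 0 -> tr y = 0 -> tr z = 0 -> tr w = 0 -> tr (x * y * z * w) = 0.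
Proof.
move=> hx hy hz hw x0 y0 z0 w0.
have := fi_free hX a0 ab (w := [:: (false, x); (true, y); (false, z); (true, w)]) isT isT.
rewrite !big_cons big_nil mulr1 /= !mulrA; apply.
by move=> u; rewrite !inE => /or4P[]/eqP -> /=; split => //; exact: generated_sub.
Qed.

(** Expanding one factor at a time into its centered part and its trace
    leaves alternating products of centered elements, whose trace is 0. *)
Lemma free_prod4 x y z w : At a x -> gen y -> At a z -> gen w ->
  tr (x * y * z * w) = tr x * tr z * tr (y * w) + tr (x * z) * tr y * tr w
                       - tr x * tr z * tr y * tr w.
Proof.
move=> hx hy hz hw.
have hx' := At_centered a0 hx; have hz' := At_centered a0 hz.
have hy' := generated_centered hy; have hw' := generated_centered hw.
have lin1 c p q u v : tr ((p + c%:A) * q * u * v) = tr (p * q * u * v) + c * tr (q * u * v).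
  by rewrite !mulrDl trD -!scalerAl mul1r trZ.
have lin2 c p q u v : tr (q * (p + c%:A) * u * v) = tr (q * p * u * v) + c * tr (q * u * v).
  by rewrite mulrDr !mulrDl trD -scalerAr -!scalerAl mulr1 trZ.
have lin3 c p q u v : tr (q * u * (p + c%:A) * v) = tr (q * u * p * v) + c * tr (q * u * v).
  by rewrite mulrDr !mulrDl trD -scalerAr -!scalerAl mulr1 trZ.
have lin4 c p q u v : tr (q * u * v * (p + c%:A)) = tr (q * u * v * p) + c * tr (q * u * v).
  by rewrite mulrDr trD -scalerAr mulr1 trZ.
have e1 : tr (x * y * z * w) = tr (centered x * y * z * w) + tr x * tr z * tr (y * w).
  rewrite {1}[x]centeredK lin1; congr (_ + _).
  have -> : tr (y * z * w) = tr (z * (w * y)) by rewrite -[y * z * w]mulrA tr_trace mulrA.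
  by rewrite (free_prod2 hz (generatedM hw hy)) mulrA (tr_trace w y).
have e2 : tr (centered x * y * z * w) =
    tr (centered x * centered y * z * w) + tr (centered x * z) * tr y * tr w.
  rewrite {1}[y]centeredK lin2 (free_prod2 (fi_mul hX a0 hx' hz) hw).
  by congr (_ + _); rewrite mulrCA mulrA.
have e3 : tr (centered x * centered y * z * w) = tr (centered x * centered y * centered z * w).
  rewrite {1}[z]centeredK lin3 -[centered x * centered y * w]mulrA.
  by rewrite (free_prod2 hx' (generatedM hy' hw)) tr_centered mul0r mulr0 addr0.
have e4 : tr (centered x * centered y * centered z * w) = 0.
  rewrite [w in LHS]centeredK lin4 (free_centered4 hx' hy' hz' hw') ?tr_centered// add0r.
  rewrite tr_trace mulrA (free_prod2 (fi_mul hX a0 hz' hx') hy').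
  by rewrite tr_centered !mulr0.
have e5 : tr (centered x * z) = tr (x * z) - tr x * tr z.
  by rewrite [centered x]/centered mulrBl trB -scalerAl mul1r trZ.
rewrite e1 e2 e3 e4 e5; ring.
Qed.

End Free.
End Levy.

(** * Uniform bounds on increments *)

Section PowerBound.
Context (R : realType) (A : tracialVNA R).

Lemma bernoulli_ineq (q : R) n : 1 <= q -> 1 + n%:R * (q - 1) <= q ^+ n.
Proof.
move=> q1; elim: n => [|n IH]; first by rewrite mul0r addr0 expr0.
rewrite exprS -natr1.
have h : 0 <= n%:R * (q - 1) by rewrite mulr_ge0// subr_ge0.
have : q * (1 + n%:R * (q - 1)) <= q * q ^+ n by rewrite ler_wpM2l// (le_trans _ q1).
nra.
Qed.

(** The norms of the powers of a self-adjoint element determine its operator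
    norm: f n = |Y^n x| satisfies f n ^2 <= f (2n) f 0 and grows at most
    like K^n, whence f 1 <= K f 0. *)
Lemma power_mulbd (Y : A) (K : R) : 0 <= K -> star Y = Y ->
  (forall n, nrm (Y ^+ n.+1) <= K * nrm (Y ^+ n)) -> mulbd K Y.
Proof.
move=> K0 sY hY; apply: mulbd_left => // x.
have pw n : nrm (Y ^+ n) <= K ^+ n.
  elim: n => [|n IH]; first by rewrite !expr0 nrm1.
  by apply: le_trans (hY n) _; rewrite exprS ler_wpM2l.
pose f n := nrm (Y ^+ n * x).
have fsq n : f n ^+ 2 = complex.Re (tr (star x * (Y ^+ (n * 2) * x))).
  by rewrite /f nrm_sqr starM starX sY muln2 -addnn exprD !mulrA.
have f0 : f 0%N = nrm x by rewrite /f expr0 mul1r.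
have sub n : f n ^+ 2 <= f (n * 2)%N * f 0%N.
  rewrite fsq f0; apply: le_trans (ler_norm _) _; apply: le_trans (Re_le_normc _) _.
  by rewrite mulrC -(nrm_star x); exact: tr_le_nrm.
have grow n : f n ^+ 2 <= nrm (x * star x) * (K ^+ n) ^+ 2.
  rewrite fsq; apply: le_trans (ler_norm _) _; apply: le_trans (Re_le_normc _) _.
  rewrite tr_trace -mulrA tr_trace; apply: le_trans (tr_le_nrm _ _) _.
  by rewrite -exprM ler_wpM2l ?nrm_ge0.
have -> : nrm (Y * x) = f 1%N by rewrite /f expr1.
rewrite -f0 leNgt; apply/negP => lt1.
have f0ge : 0 <= f 0%N by rewrite f0 nrm_ge0.
have [f00|f0n] := eqVneq (f 0%N) 0.
  have := sub 1%N; rewrite f00 mulr0 => h; move: lt1; rewrite f00 mulr0.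
  move=> f1; have : 0 < f 1%N ^+ 2 by rewrite exprn_gt0.
  by rewrite ltNge h.
have f0p : 0 < f 0%N by rewrite lt_def f0n.
pose g := f 1%N / f 0%N.
have Kg : K < g by rewrite /g ltr_pdivlMr.
have g0 : 0 < g by apply: le_lt_trans Kg.
(* Repeated squaring: if |Y x| > K |x|, then |Y^n x| grows faster than K^n
   along n = 2^j. *)
have low j : g ^+ (2 ^ j) * f 0%N <= f (2 ^ j)%N.
  elim: j => [|j IH]; first by rewrite expn0 expr1 /g divfK.
  have := sub (2 ^ j)%N; rewrite -expnSr -(ler_pM2r f0p) => h.
  rewrite -(ler_pM2r f0p); apply: le_trans (_ : f (2 ^ j)%N ^+ 2 <= _); last first.
    by rewrite -(ler_pM2r f0p).
  rewrite expnSr exprM -mulrA -expr2 -exprMn.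
  by rewrite lerXn2r// nnegrE ?mulr_ge0 ?exprn_ge0 ?nrm_ge0// ltW.
pose D := nrm (x * star x).
have D0 : 0 <= D by exact: nrm_ge0.
have key j : (g ^+ (2 ^ j)) ^+ 2 * f 0%N ^+ 2 <= D * (K ^+ (2 ^ j)) ^+ 2.
  apply: le_trans (grow _); rewrite -exprMn lerXn2r// nnegrE ?nrm_ge0//.
  by rewrite mulr_ge0 ?exprn_ge0// ltW.
have [K00|Kn] := eqVneq K 0.
  have := key 0%N; rewrite K00 expn0 !expr1 expr0n mulr0 => h.
  by have : 0 < g ^+ 2 * f 0%N ^+ 2 by [rewrite mulr_gt0 ?exprn_gt0]; rewrite ltNge h.
have Kp : 0 < K by rewrite lt_def Kn.
pose q := g / K.
have q1 : 1 < q by rewrite /q ltr_pdivlMr// mul1r.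
have key2 j : q ^+ (2 ^ j * 2) <= D / f 0%N ^+ 2.
  rewrite ler_pdivlMr ?exprn_gt0// /q expr_div_n mulrAC ler_pdivrMr ?exprn_gt0//.
  by rewrite !exprM.
pose B := D / f 0%N ^+ 2.
have B0 : 0 <= B by rewrite divr_ge0// exprn_ge0.
have [n hn] : exists n, B < n%:R * (q - 1).
  exists (Num.trunc (B / (q - 1))).+1.
  rewrite -ltr_pdivrMr ?subr_gt0//.
  by case/andP: (Num.Theory.trunc_itv (divr_ge0 B0 (ltW (etrans (subr_gt0 _ _) q1)))).
have := key2 n; rewrite leNgt => /negP; apply.
apply: lt_le_trans hn _; apply: (@le_trans _ _ (1 + n%:R * (q - 1))).
  by rewrite lerDr.
apply: le_trans (bernoulli_ineq n (ltW q1)) _.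
rewrite ler_weXn2l ?(ltW q1)//.
by apply: leq_trans (ltnW (ltn_expl n (isT : 1 < 2)%N)) _; rewrite muln2 -addnn leq_addr.
Qed.

End PowerBound.

Section IncrementBounds.
Context (R : realType) (A : tracialVNA R).
Context (At : R -> set A) (X : R -> R -> A) (m : nat -> R -> R) (kap : nat -> R).
Hypothesis hX : free_increments At X m kap.
Local Notation normc := Normc.normc.
Implicit Types (x y z : A) (s t a b : R).

Lemma moment_linear_bound n T : (0 < n)%N -> exists2 C, 0 <= C &
  forall t, 0 <= t -> t <= T -> `|m n t| <= C * t.
Proof.
move=> n0; have [C C0 hC] := fi_mom hX T n0.
exists (`|kap n| + C * `|T|); first by rewrite addr_ge0// mulr_ge0.
move=> t t0 tT; rewrite -[m n t](subrK (kap n * t)).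
apply: le_trans (ler_normD _ _) _; rewrite normrM (ger0_norm t0) addrC mulrDl lerD2l.
apply: le_trans (hC t t0 tT) _; rewrite -mulrA ler_wpM2l// expr2 ler_wpM2r//.
by apply: le_trans tT _; exact: ler_norm.
Qed.

Lemma tr_X a b : 0 <= a -> a <= b -> tr (X a b) = (m 1 (b - a))%:C.
Proof. by move=> a0 ab; rewrite -(fi_tr hX 1 a0 ab) expr1. Qed.

Lemma nrm_Xn_sqr a b n : 0 <= a -> a <= b -> nrm (X a b ^+ n) ^+ 2 = m (n * 2) (b - a).
Proof.
by move=> a0 ab; rewrite nrm_sqr starX (fi_sa hX)// -exprD addnn -muln2 (fi_tr hX).
Qed.

Lemma nrm_X_sqr a b : 0 <= a -> a <= b -> nrm (X a b) ^+ 2 = m 2 (b - a).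
Proof. by move=> a0 ab; have := nrm_Xn_sqr 1 a0 ab; rewrite expr1 mul1n. Qed.

(** X 0 t minus its mean is the compression to At t of X 0 T minus its mean,
    hence its powers grow no faster than the operator norm of the latter;
    this gives a bound on X that is uniform in the interval. *)
Lemma X_mulbd T : 0 <= T -> exists K, forall a b, 0 <= a -> a <= b -> b <= T -> mulbd K (X a b).
Proof.
move=> T0; have [K hK] := mulbd_ex (centered (X 0 T)).
have K0 := mulbd_ge0 hK.
have [C C0 hC] := moment_linear_bound T (isT : 0 < 1)%N.
have bd t : 0 <= t -> t <= T -> mulbd (K + C * T) (X 0 t).
  move=> t0 tT; have hXt := fi_adapted hX (lexx 0) t0.
  pose Y := centered (X 0 t).
  have AY n : At t (Y ^+ n) by apply: (AtX hX) => //; apply: (At_centered hX).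
  have sY : star Y = Y.
    rewrite /Y /centered starB starZ star1 (fi_sa hX)// tr_X// conjcE conjc_real//.
  (* The difference of the two centered increments is free from At t. *)
  have compress z x : At t z -> At t x ->
      tr (z * Y * x) = tr (z * centered (X 0 T) * x).
    move=> hz hx.
    have -> : centered (X 0 T) = Y + centered (X t T).
      rewrite /Y /centered -(fi_add hX (lexx 0) t0 tT) trD scalerDl opprD.
      by rewrite addrACA.
    have trDm p q : tr (z * (p + q) * x) = tr (z * p * x) + tr (z * q * x).
      by rewrite mulrDr mulrDl trD.
    rewrite (trDm Y (centered (X t T))).
    have -> : tr (z * centered (X t T) * x) = 0.
      rewrite tr_trace mulrA (free_prod2 hX t0 tT); last 2 first.
      - exact: (fi_mul hX).
      - by apply: generated_centered; apply: generated_sub.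
      by rewrite tr_centered mulr0.
    by rewrite addr0.
  have hY : mulbd K Y.
    apply: power_mulbd => // n.
    have [->|nz] := eqVneq (nrm (Y ^+ n.+1)) 0; first by rewrite mulr_ge0 ?nrm_ge0.
    have np : 0 < nrm (Y ^+ n.+1) by rewrite lt_def nz nrm_ge0.
    rewrite -(ler_pM2l np) -expr2 nrm_sqr starX sY [in X in _ * X]exprS mulrA.
    rewrite compress//; apply: le_trans (ler_norm _) _; apply: le_trans (Re_le_normc _) _.
    rewrite -mulrA; apply: le_trans (tr_le_nrm _ _) _.
    by rewrite ler_wpM2l ?nrm_ge0// mulbd_l.
  rewrite [X 0 t]centeredK -/Y; apply: mulbdD => //.
  apply: (@mulbdW _ _ (normc (tr (X 0 t)) * 1)); last exact: mulbdZ (mulbd1 A).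
  rewrite mulr1 tr_X// normcR subr0; apply: le_trans (hC t t0 tT) _.
  by rewrite ler_wpM2l.
exists ((K + C * T) + (K + C * T)) => a b a0 ab bT.
have -> : X a b = X 0 b - X 0 a by rewrite -(fi_add hX (lexx 0) a0 ab) addrAC subrr add0r.
by apply: mulbdB; apply: bd => //; [exact: le_trans ab|exact: le_trans bT].
Qed.

(** This is where freeness makes words small: the norm is of the order of
    the length of the interval, and not of its square root as for a single
    increment. *)
Lemma nrm_sandwich_centered a b c : 0 <= a -> a <= b -> At a c -> tr c = 0 ->
  nrm (X a b * c * X a b) = m 2 (b - a) * nrm c.
Proof.
move=> a0 ab hc c0.
have m2 : 0 <= m 2 (b - a) by rewrite -nrm_X_sqr// exprn_ge0// nrm_ge0.
apply/eqP; rewrite -(eqrXn2 (n := 2)) ?mulr_ge0 ?nrm_ge0// exprMn !nrm_sqr.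
rewrite !starM (fi_sa hX)//.
have -> : tr (X a b * (star c * X a b) * (X a b * c * X a b)) =
    tr (star c * (X a b ^+ 2) * c * (X a b ^+ 2)).
  by rewrite -!mulrA tr_trace !expr2 !mulrA.
have g2 := @incr_gen _ _ X a b 2.
rewrite (free_prod4 hX a0 ab)//; last exact: (fi_star hX).
rewrite c0 !(mulr0, mul0r, subr0, add0r) (fi_tr hX)//.
by rewrite -mulrA -rmorphM mulrC Re_rM expr2.
Qed.

Lemma sandwich_two a b x c : 0 <= a -> a <= b -> At a x -> At a c -> tr c = 0 ->
  tr (x * X a b * c * X a b) = tr (x * c) * (m 1 (b - a) ^+ 2)%:C.
Proof.
move=> a0 ab hx hc c0; have g := @incr_gen _ _ X a b 1; rewrite expr1 in g.
rewrite (free_prod4 hX a0 ab)// c0 !(mulr0, mul0r, subr0, add0r) tr_X//.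
by rewrite -mulrA -rmorphM expr2.
Qed.

End IncrementBounds.

(** * Increments orthogonal to the past *)

Section Blocks.
Context (R : realType) (A : tracialVNA R).
Context (At : R -> set A) (X : R -> R -> A) (m : nat -> R -> R) (kap : nat -> R).
Hypothesis hX : free_increments At X m kap.
Local Notation Re := complex.Re.
Local Notation normc := Normc.normc.
Implicit Types (x y z E F P : A) (s t u a b : R).

(** Adding E to an element of the past is controlled by a drift al and a
    quadratic variation be. The bound is an implication between bounds of
    the shape a + sqrt b, because in this form blocks over successive
    intervals compose by addition of al and of be. *)
Definition block s t E (al be : R) : Prop :=
  [/\ At t E, 0 <= al, 0 <= be & forall P, At s P -> forall a b, 0 <= a -> 0 <= b ->
    nrm P <= a + Num.sqrt b -> nrm (P + E) <= (a + al) + Num.sqrt (b + be)].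

(** Here al bounds the conditional expectation of E given At s, expressed by
    duality, and ga bounds E itself. *)
Definition small_incr s t E (al ga : R) : Prop :=
  [/\ At t E, 0 <= al, 0 <= ga, (forall x, At s x -> normc (tr (x * E)) <= al * nrm x) & nrm E <= ga].

(** In the square of |P + E| the mixed term is at most 2 al |P|, so that
    only al adds to the norm of P and ga is added in quadratic mean. *)
Lemma small_incr_block s t E al ga : 0 <= s ->
  small_incr s t E al ga -> block s t E al (ga ^+ 2).
Proof.
move=> s0 [hE al0 ga0 h1 h2]; split; rewrite ?sqr_ge0// => P hP a b a0 b0 hP1.
set p := Num.sqrt b; set q := Num.sqrt _.
have p0 : 0 <= p by exact: sqrtr_ge0.
have q0 : 0 <= q by exact: sqrtr_ge0.
have pq : q ^+ 2 = p ^+ 2 + ga ^+ 2 by rewrite /q /p !sqr_sqrtr ?addr_ge0 ?sqr_ge0.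
have plq : p <= q by rewrite ler_wsqrtr// lerDl sqr_ge0.
rewrite -(ler_pXn2r (n := 2)) ?nnegrE ?addr_ge0 ?nrm_ge0//.
rewrite (hnormD_sqr (trd_semi A)) (Re_semiC (trd_semi A)) /trd -/(nrm P) -/(nrm E).
have c1 : Re (tr (star P * E)) <= al * nrm P.
  apply: le_trans (ler_norm _) _; apply: le_trans (Re_le_normc _) _.
  by rewrite -[nrm P]nrm_star; apply: h1; apply: (fi_star hX).
have c2 : nrm E ^+ 2 <= ga ^+ 2 by rewrite ler_pXn2r// nnegrE ?nrm_ge0.
have c3 : nrm P ^+ 2 <= (a + p) ^+ 2 by rewrite ler_pXn2r// nnegrE ?nrm_ge0// addr_ge0.
have c4 : al * nrm P <= al * (a + p) by rewrite ler_wpM2l.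
have c5 : al * p <= al * q by rewrite ler_wpM2l.
have c6 : a * p <= a * q by rewrite ler_wpM2l.
have c7 : 0 <= al ^+ 2 by exact: sqr_ge0.
nra.
Qed.

Lemma block_comp s t u E F al be al' be' : 0 <= s -> s <= t -> t <= u ->
  block s t E al be -> block t u F al' be' -> block s u (E + F) (al + al') (be + be').
Proof.
move=> s0 st tu [hE al0 be0 h] [hF al0' be0' h'].
have t0 := le_trans s0 st; have u0 := le_trans t0 tu.
split; rewrite ?addr_ge0//.
  by apply: (AtD hX) => //; apply: (fi_mono hX t0 tu).
move=> P hP a b a0 b0 hPab; rewrite addrA [a + _]addrA [b + _]addrA.
apply: h'; rewrite ?addr_ge0//; last exact: h.
by apply: (AtD hX) => //; apply: (fi_mono hX s0 st).
Qed.

Lemma block0 s : 0 <= s -> block s s 0 0 0.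
Proof. by move=> s0; split => //; [exact: (At0 hX)|move=> P _ a b _ _; rewrite !addr0]. Qed.

Lemma block_sum (tau : nat -> R) (E : nat -> A) (al be : nat -> R) n :
  0 <= tau 0%N -> (forall i, (i < n)%N -> tau i <= tau i.+1) ->
  (forall i, (i < n)%N -> block (tau i) (tau i.+1) (E i) (al i) (be i)) ->
  block (tau 0%N) (tau n) (\sum_(i < n) E i) (\sum_(i < n) al i) (\sum_(i < n) be i)
  /\ tau 0%N <= tau n.
Proof.
move=> t0; elim: n => [|n IH] hmono hb.
  by rewrite !big_ord0; split => //; exact: block0.
have [|| hB le0] := IH; [by move=> i ? ; apply: hmono; rewrite ltnW|
  by move=> i ?; apply: hb; rewrite ltnW|].
rewrite !big_ord_recr /=; split; last exact: le_trans (hmono _ _).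
by apply: (@block_comp _ (tau n)) => //; [exact: hmono|exact: hb].
Qed.

Lemma block_nrm s t E al be : 0 <= s -> block s t E al be -> nrm E <= al + Num.sqrt be.
Proof.
move=> s0 [_ _ _ /(_ 0 (At0 hX s0) 0 0 (lexx 0) (lexx 0))].
by rewrite nrm0 sqrtr0 addr0 !add0r; apply.
Qed.

Lemma blockW s t E al be al' be' : al <= al' -> be <= be' ->
  block s t E al be -> block s t E al' be'.
Proof.
move=> hal hbe [hE al0 be0 h]; split => //.
- exact: le_trans hal.
- exact: le_trans hbe.
move=> P hP a b a0 b0 hh; apply: le_trans (h P hP a b a0 b0 hh) _.
by rewrite lerD// ?lerD2l// ler_wsqrtr// lerD2l.
Qed.

Lemma small_incrW s t E al ga al' ga' : al <= al' -> ga <= ga' ->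
  small_incr s t E al ga -> small_incr s t E al' ga'.
Proof.
move=> hal hga [hE al0 ga0 h1 h2]; split => //.
- exact: le_trans hal.
- exact: le_trans hga.
- by move=> x hx; apply: le_trans (h1 x hx) _; rewrite ler_wpM2r ?nrm_ge0.
- exact: le_trans hga.
Qed.

Lemma small_incr0 s t : 0 <= t -> small_incr s t 0 0 0.
Proof.
move=> t0; split; rewrite ?nrm0//; first exact: (At0 hX).
by move=> x _; rewrite mulr0 linear0 Normc.normc0 mul0r.
Qed.

Lemma small_incrD s t E F al ga al' ga' : 0 <= t ->
  small_incr s t E al ga -> small_incr s t F al' ga' -> small_incr s t (E + F) (al + al') (ga + ga').
Proof.
move=> t0 [hE al0 ga0 h1 h2] [hF al0' ga0' h1' h2']; split; rewrite ?addr_ge0//.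
- exact: (AtD hX).
- move=> x hx; rewrite mulrDr trD mulrDl; apply: le_trans (le_normcD _ _) _.
  by rewrite lerD ?h1 ?h1'.
- by apply: le_trans (nrmD _ _) _; rewrite lerD.
Qed.

Lemma small_incrZ s t E al ga c : 0 <= t ->
  small_incr s t E al ga -> small_incr s t (c *: E) (normc c * al) (normc c * ga).
Proof.
move=> t0 [hE al0 ga0 h1 h2]; split; rewrite ?mulr_ge0 ?normc_ge0//.
- exact: (AtZ hX).
- by move=> x hx; rewrite -scalerAr trZ Normc.normcM -mulrA ler_wpM2l ?normc_ge0// h1.
- by rewrite nrmZ ler_wpM2l ?normc_ge0.
Qed.

Lemma small_incr_sum s t (I : eqType) (r : seq I) (E : I -> A) (al ga : I -> R) : 0 <= t ->
  (forall i, i \in r -> small_incr s t (E i) (al i) (ga i)) ->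
  small_incr s t (\sum_(i <- r) E i) (\sum_(i <- r) al i) (\sum_(i <- r) ga i).
Proof.
move=> t0; elim: r => [|i r IH] h; first by rewrite !big_nil; exact: small_incr0.
rewrite !big_cons; apply: small_incrD => //; first by apply: h; rewrite mem_head.
by apply: IH => j jr; apply: h; rewrite inE jr orbT.
Qed.

Fixpoint word y (b : A) (s : seq A) : A :=
  if s is c :: s' then b * y * word y c s' else b.

Fixpoint trace_gaps (b : A) (s : seq A) : R[i] :=
  if s is c :: s' then tr b * trace_gaps c s' else 1.

Lemma word_rcons y (b : A) (s : seq A) c : word y b (rcons s c) = word y b s * y * c.
Proof. by elim: s b => [//|d s IH] b /=; rewrite IH !mulrA. Qed.

Lemma mulbd_word K y (b : A) (s : seq A) : 1 <= K -> mulbd K y -> mulbd K b -> (forall c, c \in s -> mulbd K c) ->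
  mulbd (K ^+ (size s).*2.+1) (word y b s).
Proof.
move=> K1 hy; elim: s b => [|c s IH] b hb hs; first by rewrite /= expr1.
have -> : K ^+ (size (c :: s)).*2.+1 = K * K * K ^+ (size s).*2.+1.
  by rewrite /= doubleS -mulrA -!exprS.
apply: mulbdM; first exact: mulbdM.
by apply: IH => [|d ds]; apply: hs; rewrite ?mem_head// inE ds orbT.
Qed.

Lemma At_word t y (b : A) (s : seq A) : 0 <= t -> At t y -> At t b -> (forall c, c \in s -> At t c) -> At t (word y b s).
Proof.
move=> t0 hy; elim: s b => [|c s IH] b hb hs //=.
apply: (fi_mul hX) => //; first exact: (fi_mul hX).
by apply: IH => [|d ds]; apply: hs; rewrite ?mem_head// inE ds orbT.
Qed.

(** A single constant for all bounds on an increment, so that the constants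
    for words are powers of it. *)
Definition tame K a b : Prop :=
  [/\ 1 <= K, mulbd K (X a b), m 2 (b - a) <= K ^+ 2 * (b - a), `|m 1 (b - a)| <= K * (b - a)
    & Num.sqrt (b - a) <= K].

Lemma tameW K K' a b : a <= b -> K <= K' -> tame K a b -> tame K' a b.
Proof.
move=> ab KK [K1 h1 h2 h3 h4]; split.
- exact: le_trans KK.
- exact: mulbdW h1.
- apply: le_trans h2 _; rewrite ler_wpM2r ?subr_ge0// lerXn2r// nnegrE; lra.
- by apply: le_trans h3 _; rewrite ler_wpM2r ?subr_ge0.
- exact: le_trans KK.
Qed.

Lemma tame_ex T : 0 <= T -> exists K, forall a b, 0 <= a -> a <= b -> b <= T -> tame K a b.
Proof.
move=> T0; have [K0 hK0] := X_mulbd hX T0.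
have [C1 C10 h1] := moment_linear_bound hX T (isT : 0 < 1)%N.
have [C2 C20 h2] := moment_linear_bound hX T (isT : 0 < 2)%N.
have K00 : 0 <= K0 by exact: mulbd_ge0 (hK0 0 0 (lexx 0) (lexx 0) T0).
have sT : 0 <= Num.sqrt T by exact: sqrtr_ge0.
exists (1 + K0 + C1 + C2 + Num.sqrt T) => a b a0 ab bT.
have d0 : 0 <= b - a by rewrite subr_ge0.
have dT : b - a <= T by lra.
have m1 := h1 _ d0 dT; have m2 := h2 _ d0 dT.
split.
- lra.
- by apply: mulbdW (hK0 a b a0 ab bT); lra.
- apply: le_trans (ler_norm _) _; apply: le_trans m2 _; rewrite ler_wpM2r//; nra.
- by apply: le_trans m1 _; rewrite ler_wpM2r//; lra.
- by apply: le_trans (ler_wsqrtr dT) _; lra.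
Qed.

(** Since K is at least 1, one large power dominates all the constants that
    occur. *)
Definition bad_const (K : R) q n : R := 3 * K ^+ (q + n.*2 + 10).

Lemma bad_const_ge K q n : 1 <= K -> let C := bad_const K q n in
 [/\ K * K ^+ q * K ^+ n.*2.+1 * (K ^+ 2 * K) <= C,
  forall n', n = n'.+1 -> K ^+ 2 * (2 * (K ^+ q * K * K ^+ n'.*2.+1 * K) + K * (K ^+ n'.*2.+1 * K ^+ q.+1)) * (K * K) <= C,
  forall q', q = q'.+1 -> K ^+ 2 * (2 * (K * K ^+ q) + K * K ^+ q) * (K * K) <= C &
  K * K * K * (K ^+ 2 * K) <= C].
Proof.
move=> K1 C.
have K0 : 0 <= K by exact: le_trans K1.
have pw k : (k <= q + n.*2 + 10)%N -> K ^+ k <= K ^+ (q + n.*2 + 10).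
  by move=> hk; rewrite ler_weXn2l.
have p1 k : (k <= q + n.*2 + 10)%N -> K ^+ k <= C.
  move=> /pw; rewrite /C /bad_const => h; have := exprn_ge0 (q + n.*2 + 10) K0; lra.
have p3 k : (k <= q + n.*2 + 10)%N -> 3 * K ^+ k <= C by move=> /pw h; rewrite ler_wpM2l.
split.
- rewrite (_ : K * _ * _ * _ = K ^+ (q + n.*2 + 5)); last first.
    by rewrite -exprSr -exprS -!exprD; congr (_ ^+ _); lia.
  by apply: p1; lia.
- move=> n' hn.
  rewrite (_ : K ^+ 2 * _ * _ = 3 * K ^+ (q + n'.*2 + 7)); last first.
    rewrite (_ : (q + n'.*2 + 7 = q + n'.*2.+1 + 6)%N); last by lia.
    by rewrite !exprD [K ^+ q.+1]exprS; move: (K ^+ q) (K ^+ n'.*2.+1) => u v; ring.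
  by apply: p3; lia.
- move=> q' _; rewrite (_ : K ^+ 2 * _ * _ = 3 * K ^+ (q + 5)); last by rewrite exprD; ring.
  by apply: p3; lia.
- by rewrite (_ : K * K * K * _ = K ^+ 6); [apply: p1; lia|ring].
Qed.

Section BadWords.
Context (K a b : R) (a0 : 0 <= a) (ab : a <= b) (hK : tame K a b).
Local Notation y := (X a b).
Local Notation dl := (b - a).
Local Notation ep := (Num.sqrt (b - a)).

Let K1 : 1 <= K. Proof. by case: hK. Qed.
Let K0 : 0 <= K. Proof. exact: le_trans K1. Qed.
Let d0 : 0 <= dl. Proof. by rewrite subr_ge0. Qed.
Let hy : mulbd K y. Proof. by case: hK. Qed.
Let m20 : 0 <= m 2 dl.
Proof. by rewrite -(nrm_X_sqr hX)// exprn_ge0// nrm_ge0. Qed.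
Let e0 : 0 <= ep. Proof. exact: sqrtr_ge0. Qed.

Lemma tame_nrm : nrm y <= K * ep.
Proof.
rewrite -(ler_pXn2r (n := 2)) ?nnegrE ?mulr_ge0 ?nrm_ge0//.
by rewrite (nrm_X_sqr hX)// exprMn sqr_sqrtr//; case: hK.
Qed.

Lemma tame_m2 : m 2 dl <= K ^+ 2 * dl. Proof. by case: hK. Qed.

Let At_y : At b y. Proof. exact: (fi_adapted hX). Qed.
Let b0' : 0 <= b. Proof. exact: le_trans ab. Qed.
Let up x : At a x -> At b x. Proof. exact: (fi_mono hX). Qed.

Lemma nrm_centered x : nrm (centered x) <= 2 * nrm x.
Proof.
apply: le_trans (nrmB _ _) _; rewrite nrmZ nrm1 mulr1 mulr_natl mulr2n lerD2l.
exact: tr_le_nrm1.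
Qed.

(** Splitting z into its centered part and its trace leaves in both cases a
    factor y w y with w centered, of norm O(dl), times a factor of order
    sqrt dl. *)
Lemma trace_two_ends z c P Q : At a z -> At a c -> tr c = 0 ->
  tr (y * P * y) = tr ((y * c * y) * Q) ->
  normc (tr (z * y * P * y)) <= K ^+ 2 * dl * (2 * nrm P + nrm c * nrm Q) * nrm z.
Proof.
move=> hz hc c0 hPQ.
have -> : tr (z * y * P * y) = tr ((y * centered z * y) * P) + tr z * tr ((y * c * y) * Q).
  rewrite {1}[z]centeredK; move: (centered z) => w.
  rewrite !mulrDl trD -!scalerAl mul1r trZ -hPQ; congr (_ + _).
  by rewrite tr_trace !mulrA.
apply: le_trans (le_normcD _ _) _; rewrite Normc.normcM.
have h1 : normc (tr (y * centered z * y * P)) <= m 2 dl * (2 * nrm z) * nrm P.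
  apply: le_trans (tr_le_nrm _ _) _; rewrite ler_wpM2r ?nrm_ge0//.
  rewrite (nrm_sandwich_centered hX a0 ab (At_centered hX a0 hz) (tr_centered z)).
  by rewrite ler_wpM2l// nrm_centered.
have h2 : normc (tr (y * c * y * Q)) <= m 2 dl * nrm c * nrm Q.
  apply: le_trans (tr_le_nrm _ _) _; rewrite ler_wpM2r ?nrm_ge0//.
  by rewrite (nrm_sandwich_centered hX a0 ab).
have h3 : normc (tr z) * normc (tr (y * c * y * Q)) <= nrm z * (m 2 dl * nrm c * nrm Q).
  apply: ler_pM; rewrite ?normc_ge0//; exact: tr_le_nrm1.
apply: le_trans (lerD h1 h3) _.
have -> : m 2 dl * (2 * nrm z) * nrm P + nrm z * (m 2 dl * nrm c * nrm Q) =
  m 2 dl * ((2 * nrm P + nrm c * nrm Q) * nrm z) by ring.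
rewrite -[leRHS]mulrA ler_wpM2r ?tame_m2//.
by rewrite mulr_ge0 ?addr_ge0 ?mulr_ge0 ?nrm_ge0.
Qed.

Lemma nrm_pow_le q : nrm (y ^+ q.+1) <= K ^+ q.+1 * ep.
Proof.
rewrite exprSr; apply: le_trans (mulbd_l _ (mulbdX q hy)) _.
by rewrite exprSr -mulrA ler_wpM2l ?exprn_ge0// tame_nrm.
Qed.

Lemma nrm_y_le p q (L1 L2 : R) : mulbd L1 p -> mulbd L2 q -> nrm (p * y * q) <= L1 * L2 * K * ep.
Proof.
move=> hp hq; apply: le_trans (mulbd_lr _ hp hq) _.
rewrite -[leRHS]mulrA ler_wpM2l ?mulr_ge0 ?(mulbd_ge0 hp) ?(mulbd_ge0 hq)//; exact: tame_nrm.
Qed.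

Lemma gather_bounds p x q (c P Q : A) (B B' : R) : mulbd K p -> mulbd K q -> nrm c <= K ->
  nrm P <= B * ep -> nrm Q <= B' * ep ->
  K ^+ 2 * dl * (2 * nrm P + nrm c * nrm Q) * nrm (p * x * q) <=
  K ^+ 2 * (2 * B + K * B') * (K * K) * (dl * ep) * nrm x.
Proof.
move=> hp hq hc hP hQ.
have h1 : nrm (p * x * q) <= K * K * nrm x by exact: mulbd_lr.
have h2 : 2 * nrm P + nrm c * nrm Q <= (2 * B + K * B') * ep.
  rewrite [leRHS]mulrDl -!mulrA; apply: lerD; first by rewrite ler_wpM2l.
  by apply: ler_pM; rewrite ?nrm_ge0.
have -> : K ^+ 2 * (2 * B + K * B') * (K * K) * (dl * ep) * nrm x =
  K ^+ 2 * dl * ((2 * B + K * B') * ep) * (K * K * nrm x) by ring.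
have h3 : 0 <= K ^+ 2 * dl by rewrite mulr_ge0// sqr_ge0.
apply: ler_pM; [|exact: nrm_ge0|by rewrite ler_wpM2l|by []].
by rewrite mulr_ge0// addr_ge0// mulr_ge0// nrm_ge0.
Qed.

Lemma bad_word_norm q (b0 c b2 : A) (s : seq A) : At a c -> tr c = 0 -> mulbd K b0 -> mulbd K c ->
  mulbd K b2 -> (forall d, d \in s -> mulbd K d) ->
  nrm (b0 * y ^+ q.+1 * c * y * word y b2 s) <= K * K ^+ q * K ^+ (size s).*2.+1 * (K ^+ 2 * K) * dl.
Proof.
move=> hc c0 hb0 hcK hb2 hs.
have -> : b0 * y ^+ q.+1 * c * y * word y b2 s = (b0 * y ^+ q) * (y * c * y) * word y b2 s.
  by rewrite exprSr !mulrA.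
apply: le_trans (mulbd_lr _ (mulbdM hb0 (mulbdX q hy)) (mulbd_word K1 hy hb2 hs)) _.
rewrite -[leRHS]mulrA ler_wpM2l ?mulr_ge0 ?exprn_ge0//.
rewrite (nrm_sandwich_centered hX)// mulrAC; apply: ler_pM; rewrite ?nrm_ge0 ?tame_m2//.
exact: mulbd_nrm.
Qed.

Lemma bad_word_trace_long q (b0 c b2 : A) (s : seq A) (d : A) x : At a b0 -> At a c -> At a d -> tr c = 0 ->
  mulbd K b0 -> mulbd K c -> mulbd K b2 -> mulbd K d -> (forall d, d \in s -> mulbd K d) -> At a x ->
  normc (tr (x * (b0 * y ^+ q.+1 * c * y * word y b2 (rcons s d)))) <=
   (K ^+ 2 * (2 * (K ^+ q * K * K ^+ (size s).*2.+1 * K) + K * (K ^+ (size s).*2.+1 * K ^+ q.+1))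
     * (K * K)) * (dl * ep) * nrm x.
Proof.
move=> hb0 hc hd c0 hb0K hcK hb2 hdK hs hx; set L := K ^+ (size s).*2.+1.
have hu := mulbd_word K1 hy hb2 hs; rewrite word_rcons; set u := word y b2 s in hu *.
have -> : tr (x * (b0 * y ^+ q.+1 * c * y * (u * y * d))) =
          tr ((d * x * b0) * y * (y ^+ q * c * y * u) * y).
  have -> : x * (b0 * y ^+ q.+1 * c * y * (u * y * d)) =
    (x * b0 * y * (y ^+ q * c * y * u) * y) * d by rewrite exprS !mulrA.
  by rewrite tr_trace !mulrA.
have hz : At a (d * x * b0) by do 2!apply: (fi_mul hX) => //.
apply: le_trans (trace_two_ends (Q := u * y ^+ q.+1) hz hc c0 _) _.
  have -> : y * (y ^+ q * c * y * u) * y = y ^+ q * (y * c * y * u * y).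
    by rewrite !mulrA -exprS -exprSr.
  by rewrite tr_trace exprS !mulrA.
have hP : nrm (y ^+ q * c * y * u) <= K ^+ q * K * L * K * ep.
  by apply: nrm_y_le => //; apply: mulbdM => //; exact: mulbdX.
have hQ : nrm (u * y ^+ q.+1) <= L * K ^+ q.+1 * ep.
  apply: le_trans (mulbd_l _ hu) _; rewrite -mulrA ler_wpM2l ?(mulbd_ge0 hu)//.
  exact: nrm_pow_le.
exact: (gather_bounds x hdK hb0K (mulbd_nrm hcK) hP hQ).
Qed.

Lemma bad_word_trace_short q (b0 c b2 : A) x : At a b0 -> At a c -> At a b2 -> tr c = 0 ->
  mulbd K b0 -> mulbd K c -> mulbd K b2 -> At a x ->
  normc (tr (x * (b0 * y ^+ q.+2 * c * y * b2))) <=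
   (K ^+ 2 * (2 * (K * K ^+ q.+1) + K * K ^+ q.+1) * (K * K)) * (dl * ep) * nrm x.
Proof.
move=> hb0 hc hb2 c0 hb0K hcK hb2K hx.
have -> : tr (x * (b0 * y ^+ q.+2 * c * y * b2)) =
          tr ((b2 * x * b0) * y * (y ^+ q.+1 * c) * y).
  have -> : x * (b0 * y ^+ q.+2 * c * y * b2) =
    (x * b0 * y * (y ^+ q.+1 * c) * y) * b2 by rewrite exprS !mulrA.
  by rewrite tr_trace !mulrA.
have hz : At a (b2 * x * b0) by do 2!apply: (fi_mul hX) => //.
apply: le_trans (trace_two_ends (Q := y ^+ q.+1) hz hc c0 _) _.
  have -> : y * (y ^+ q.+1 * c) * y = y ^+ q.+1 * (y * c * y).
    by rewrite !mulrA -exprS -exprSr.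
  by rewrite tr_trace.
have hP : nrm (y ^+ q.+1 * c) <= K * K ^+ q.+1 * ep.
  apply: le_trans (mulbd_r _ hcK) _; rewrite -mulrA ler_wpM2l//; exact: nrm_pow_le.
exact: (gather_bounds x hb2K hb0K (mulbd_nrm hcK) hP (nrm_pow_le q)).
Qed.

Lemma bad_word_trace_two (b0 c b2 : A) x : At a b0 -> At a c -> At a b2 -> tr c = 0 ->
  mulbd K b0 -> mulbd K c -> mulbd K b2 -> At a x ->
  normc (tr (x * (b0 * y ^+ 1 * c * y * b2))) <= (K * K * K * (K ^+ 2 * K)) * (dl * ep) * nrm x.
Proof.
move=> hb0 hc hb2 c0 hb0K hcK hb2K hx.
have -> : tr (x * (b0 * y ^+ 1 * c * y * b2)) = tr ((b2 * x * b0) * y * c * y).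
  by rewrite expr1 !mulrA tr_trace !mulrA.
have hz : At a (b2 * x * b0) by do 2!apply: (fi_mul hX) => //.
rewrite (sandwich_two hX)// Normc.normcM normcR.
have h1 : normc (tr (b2 * x * b0 * c)) <= (K * K * nrm x) * K.
  apply: le_trans (tr_le_nrm _ _) _; apply: ler_pM; [exact: nrm_ge0|exact: nrm_ge0|exact: mulbd_lr|exact: mulbd_nrm].
have h2 : `|m 1 dl ^+ 2| <= K ^+ 2 * K * (dl * ep).
  rewrite normrX; apply: (@le_trans _ _ ((K * dl) ^+ 2)).
    by rewrite ler_pXn2r// ?nnegrE ?mulr_ge0//; case: hK.
  have -> : (K * dl) ^+ 2 = K ^+ 2 * (dl * ep) * ep.
    have e2 : ep * ep = dl by rewrite -expr2 sqr_sqrtr.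
    by rewrite -!mulrA e2; ring.
  have -> : K ^+ 2 * K * (dl * ep) = K ^+ 2 * (dl * ep) * K by ring.
  by rewrite ler_wpM2l ?mulr_ge0 ?sqr_ge0//; case: hK.
apply: le_trans (ler_pM (normc_ge0 _) (normr_ge0 _) h1 h2) _.
by rewrite le_eqVlt; apply/orP; left; apply/eqP; ring.
Qed.

(** The factor y c y alone has norm O(dl). In the trace against an element
    of the past a word closes up cyclically to z y P y, where the outer
    letters surround a centered element (trace_two_ends) and a letter in P
    contributes sqrt dl; if the word has two letters only, the trace is
    computed exactly (sandwich_two). *)
Lemma bad_word_small q (b0 c b2 : A) (s : seq A) :
  At a b0 -> At a c -> At a b2 -> (forall d, d \in s -> At a d) ->
  mulbd K b0 -> mulbd K c -> mulbd K b2 -> (forall d, d \in s -> mulbd K d) -> tr c = 0 ->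
  let C := bad_const K q (size s) in
  small_incr a b (b0 * y ^+ q.+1 * c * y * word y b2 s) (C * (dl * ep)) (C * dl).
Proof.
move=> hb0 hc hb2 hs hb0K hcK hb2K hsK c0 C.
have [C1 C2 C3 C4] : [/\ K * K ^+ q * K ^+ (size s).*2.+1 * (K ^+ 2 * K) <= C,
  forall n, size s = n.+1 -> K ^+ 2 * (2 * (K ^+ q * K * K ^+ n.*2.+1 * K) + K * (K ^+ n.*2.+1 * K ^+ q.+1)) * (K * K) <= C,
  forall q', q = q'.+1 -> K ^+ 2 * (2 * (K * K ^+ q) + K * K ^+ q) * (K * K) <= C &
  K * K * K * (K ^+ 2 * K) <= C].
  exact: bad_const_ge.
clearbody C; have C0 : 0 <= C by apply: le_trans C4; rewrite !mulr_ge0 ?exprn_ge0.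
split; [|exact: mulr_ge0 (mulr_ge0 d0 e0)|exact: mulr_ge0| |].
- apply: (fi_mul hX) => //; last by apply: At_word => //; [exact: up|move=> d ds; apply: up; exact: hs].
  apply: (fi_mul hX) => //; apply: (fi_mul hX) => //; last exact: up.
  by apply: (fi_mul hX) => //; [exact: up|exact: (AtX hX)].
- move=> x hx; case/lastP: s hs hsK C1 C2 C3 C4 => [|s d] hs hsK C1 C2 C3 C4.
    case: q C1 C2 C3 C4 => [|q] C1 C2 C3 C4.
      apply: le_trans (bad_word_trace_two _ _ _ _ _ _ _ _) _ => //.
      by rewrite !ler_wpM2r ?nrm_ge0 ?mulr_ge0.
    apply: le_trans (bad_word_trace_short _ _ _ _ _ _ _ _ _) _ => //.
    by rewrite !ler_wpM2r ?nrm_ge0 ?mulr_ge0//; exact: C3.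
  apply: le_trans (bad_word_trace_long _ _ _ _ _ _ _ _ _ _ _) _ => //.
  + by apply: hs; rewrite mem_rcons mem_head.
  + by apply: hsK; rewrite mem_rcons mem_head.
  + by move=> e es; apply: hsK; rewrite mem_rcons inE es orbT.
  by rewrite !ler_wpM2r ?nrm_ge0 ?mulr_ge0//; apply: C2; rewrite size_rcons.
- apply: le_trans (bad_word_norm _ _ _ _ _ _ _) _ => //.
  by rewrite ler_wpM2r.
Qed.

End BadWords.
End Blocks.

(** * Replacing gaps by their traces *)

Section GapReplacement.
Context (R : realType) (A : tracialVNA R).
Context (At : R -> set A) (X : R -> R -> A) (m : nat -> R -> R) (kap : nat -> R).
Hypothesis hX : free_increments At X m kap.
Local Notation normc := Normc.normc.

(** One gap at a time: the centered part of b1 gives a word with a centered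
    gap, and its trace merges the letters on both sides of it. This is why
    the induction carries a power of the increment in front of the word. *)
Lemma gap_replacement_pow (K : R) n : 1 <= K -> forall q, exists2 C, 0 <= C &
  forall a b (b0 b1 : A) s, 0 <= a -> a <= b -> tame X m K a b -> size s = n ->
  At a b0 -> At a b1 -> (forall d, d \in s -> At a d) ->
  mulbd K b0 -> mulbd K b1 -> (forall d, d \in s -> mulbd K d) ->
  small_incr At a b (b0 * X a b ^+ q.+1 * word (X a b) b1 s -
      trace_gaps b1 s *: (b0 * X a b ^+ (q.+1 + size s) * last b1 s))
    (C * ((b - a) * Num.sqrt (b - a))) (C * (b - a)).
Proof.
move=> K1; have K0 : 0 <= K by exact: le_trans K1.
elim: n => [|n IH] q.
  exists 0 => // a b b0 b1 [|//] a0 ab _ _ _ _ _ _ _ _ /=.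
  rewrite addn0 scale1r subrr !mul0r; apply: (small_incr0 hX); exact: le_trans ab.
have [C C0 hC] := IH q.+1.
exists (bad_const (2 * K) q n + K * C).
  by rewrite addr_ge0 ?mulr_ge0// exprn_ge0// mulr_ge0.
move=> a b b0 b1 [//|b2 s] a0 ab hK [sn] hb0 hb1 hs hb0K hb1K hsK /=.
have hb2 : At a b2 by apply: hs; rewrite mem_head.
have hb2K : mulbd K b2 by apply: hsK; rewrite mem_head.
have hs' d : d \in s -> At a d by move=> ds; apply: hs; rewrite inE ds orbT.
have hsK' d : d \in s -> mulbd K d by move=> ds; apply: hsK; rewrite inE ds orbT.
set y := X a b.
have K2 : K <= 2 * K by lra.
have b0' : 0 <= b by exact: le_trans ab.
have hc : mulbd (2 * K) (centered b1).
  rewrite mulr_natl mulr2n /centered; apply: mulbdB => //.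
  apply: (@mulbdW _ _ (normc (tr b1) * 1)); last exact: mulbdZ (mulbd1 A).
  by rewrite mulr1; apply: le_trans (tr_le_nrm1 _) _; exact: mulbd_nrm.
have -> : b0 * y ^+ q.+1 * (b1 * y * word y b2 s) -
    (tr b1 * trace_gaps b2 s) *: (b0 * y ^+ (q.+1 + (size s).+1) * last b2 s) =
  b0 * y ^+ q.+1 * centered b1 * y * word y b2 s +
  tr b1 *: (b0 * y ^+ q.+2 * word y b2 s -
      trace_gaps b2 s *: (b0 * y ^+ (q.+2 + size s) * last b2 s)).
  rewrite scalerBr scalerA addrA -[in LHS]addSnnS; congr (_ - _).
  rewrite {1}[b1]centeredK [y ^+ q.+2]exprSr; move: (centered b1) => c.
  by rewrite !mulrDl mulrDr -!scalerAl -scalerAr mul1r !mulrA.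
rewrite ![(_ + K * C) * _]mulrDl; apply: (small_incrD hX) => //.
  have := @bad_word_small _ _ _ _ _ _ hX (2 * K) a b a0 ab (tameW ab K2 hK) q b0 (centered b1) b2 s
    hb0 (At_centered hX a0 hb1) hb2 hs' (mulbdW K2 hb0K) hc (mulbdW K2 hb2K)
    (fun d ds => mulbdW K2 (hsK' d ds)) (tr_centered b1).
  by rewrite sn.
have hI := hC a b b0 b2 s a0 ab hK sn hb0 hb2 hs' hb0K hb2K hsK'.
have trK : normc (tr b1) <= K by apply: le_trans (tr_le_nrm1 _) _; exact: mulbd_nrm.
have d0 : 0 <= b - a by rewrite subr_ge0.
apply: small_incrW (small_incrZ hX (tr b1) b0' hI); rewrite -[leRHS]mulrA ler_wpM2r//.
- by rewrite mulr_ge0// mulr_ge0// sqrtr_ge0.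
- by rewrite mulr_ge0.
Qed.

Lemma gap_replacement (K : R) n : 1 <= K -> exists2 C, 0 <= C &
  forall a b (b0 b1 : A) s, 0 <= a -> a <= b -> tame X m K a b -> size s = n ->
  At a b0 -> At a b1 -> (forall d, d \in s -> At a d) ->
  mulbd K b0 -> mulbd K b1 -> (forall d, d \in s -> mulbd K d) ->
  small_incr At a b (word (X a b) b0 (b1 :: s) -
      trace_gaps b1 s *: (b0 * X a b ^+ (size s).+1 * last b1 s))
    (C * ((b - a) * Num.sqrt (b - a))) (C * (b - a)).
Proof.
move=> K1; have [C C0 h] := gap_replacement_pow n K1 0.
by exists C.
Qed.

(** A mixed word in two successive increments Y, y contains an adjacent
    pair, and |Y y|^2 = tr Y^2 tr y^2 by freeness. Against the past only the
    moments remain, and their terms of first order cancel. *)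
Lemma cut_power_small T k : 0 <= T -> exists2 C, 0 <= C &
  forall a b c, 0 <= a -> a <= b -> b <= c -> c <= T ->
  small_incr At a c (X a c ^+ k.+1 - X a b ^+ k.+1 - X b c ^+ k.+1) (C * (c - a) ^+ 2) (C * (c - a)).
Proof.
move=> T0; have [K hK] := tame_ex hX T0.
have K1 : 1 <= K by case: (hK 0 0 (lexx 0) (lexx 0) T0).
have K0 : 0 <= K by exact: le_trans K1.
have [C1 C10 hC1] := fi_mom hX T (isT : 0 < k.+1)%N.
have [C2 C20 hC2] : exists2 C, 0 <= C & forall a b c, 0 <= a -> a <= b -> b <= c -> c <= T ->
    nrm (X a c ^+ k.+1 - X a b ^+ k.+1 - X b c ^+ k.+1) <= C * (c - a).
  elim: (k) => [|k' [C C0 hC]].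
    exists 0 => // a b c a0 ab bc cT.
    by rewrite !expr1 -(fi_add hX a0 ab bc) -addrA -opprD subrr nrm0 mul0r.
  exists (K * C + 2 * (K ^+ k' * K ^+ 2)); first by rewrite addr_ge0 ?mulr_ge0 ?exprn_ge0.
  move=> a b c a0 ab bc cT.
  have b0 := le_trans a0 ab; have bT := le_trans bc cT; have ac := le_trans ab bc.
  have aT := le_trans ab bT.
  have := hC a b c a0 ab bc cT; rewrite -(fi_add hX a0 ab bc).
  have [_ hY _ _ _] := hK a b a0 ab bT; have [_ hy _ _ _] := hK b c b0 bc cT.
  have [_ hYy _ _ _] := hK a c a0 ac cT; move: hYy; rewrite -(fi_add hX a0 ab bc).
  have nYy : nrm (X a b * X b c) <= K ^+ 2 * (c - a).
    rewrite -(ler_pXn2r (n := 2)) ?nnegrE ?mulr_ge0 ?nrm_ge0 ?sqr_ge0 ?subr_ge0//.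
    rewrite nrm_sqr starM !(fi_sa hX)//.
    have -> : tr (X b c * X a b * (X a b * X b c)) = tr (X a b ^+ 2 * X b c ^+ 2).
      by rewrite -!mulrA tr_trace !expr2 !mulrA.
    rewrite (free_prod2 hX b0 bc); last 2 first.
    - by apply: (AtX hX) => //; exact: (fi_adapted hX).
    - exact: incr_gen.
    rewrite !(fi_tr hX)// -rmorphM [X in X <= _]/=.
    have [_ _ h2 _ _] := hK a b a0 ab bT; have [_ _ h2' _ _] := hK b c b0 bc cT.
    rewrite exprMn -exprMn expr2; apply: ler_pM.
    - by rewrite -(nrm_X_sqr hX)// sqr_ge0.
    - by rewrite -(nrm_X_sqr hX)// sqr_ge0.
    - by apply: le_trans h2 _; rewrite ler_wpM2l ?sqr_ge0//; lra.
    - by apply: le_trans h2' _; rewrite ler_wpM2l ?sqr_ge0//; lra.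
  have nyY : nrm (X b c * X a b) <= K ^+ 2 * (c - a).
    by rewrite -nrm_star starM !(fi_sa hX).
  move: (X a b) (X b c) hY hy nYy nyY => Y y hY hy nYy nyY hYy hD.
  have -> : (Y + y) ^+ k'.+2 - Y ^+ k'.+2 - y ^+ k'.+2 =
     (Y + y) * ((Y + y) ^+ k'.+1 - Y ^+ k'.+1 - y ^+ k'.+1) + (Y * y ^+ k'.+1 + y * Y ^+ k'.+1).
    rewrite !mulrBr -!exprS !mulrDl -!exprS; set p := (Y + y) ^+ _.
    set q1 := Y ^+ _; set q2 := y ^+ _; set q3 := Y * _; set q4 := y * _.
    by rewrite !opprD !addrA (addrAC _ (- q2) q3) addrNK (addrAC _ (- q2) q4) addrNK.
  apply: le_trans (nrmD _ _) _; rewrite [leRHS]mulrDl; apply: lerD.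
    apply: le_trans (mulbd_l _ hYy) _; rewrite -mulrA ler_wpM2l//.
  apply: le_trans (nrmD _ _) _; rewrite -mulrA mulr_natl mulr2n; apply: lerD.
    rewrite exprS mulrA; apply: le_trans (mulbd_r _ (mulbdX k' hy)) _.
    by rewrite -mulrA ler_wpM2l// exprn_ge0.
  rewrite exprS mulrA; apply: le_trans (mulbd_r _ (mulbdX k' hY)) _.
  by rewrite -mulrA ler_wpM2l// exprn_ge0.
exists (3 * C1 + C2); first by rewrite addr_ge0 ?mulr_ge0.
move=> a b c a0 ab bc cT.
have b0 := le_trans a0 ab; have ac := le_trans ab bc; have c0 := le_trans b0 bc.
have d0 : 0 <= c - a by rewrite subr_ge0.
split.
- apply: (AtB hX) => //; first apply: (AtB hX) => //; apply: (AtX hX) => //; exact: (At_incr hX).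
- by rewrite mulr_ge0 ?sqr_ge0// addr_ge0 ?mulr_ge0.
- by rewrite mulr_ge0// addr_ge0 ?mulr_ge0.
- move=> x hx.
  have -> : tr (x * (X a c ^+ k.+1 - X a b ^+ k.+1 - X b c ^+ k.+1)) =
     tr x * (m k.+1 (c - a) - m k.+1 (b - a) - m k.+1 (c - b))%:C.
    rewrite !mulrBr !trB (free_prod2 hX a0 ac hx (incr_gen _)).
    rewrite (free_prod2 hX a0 ab hx (incr_gen _)).
    rewrite (free_prod2 hX b0 bc (fi_mono hX a0 ab hx) (incr_gen _)).
    by rewrite !(fi_tr hX)// !rmorphB !mulrBr.
  rewrite Normc.normcM normcR mulrC.
  apply: ler_pM; rewrite ?normr_ge0 ?normc_ge0//; last exact: tr_le_nrm1.
  have e1 := hC1 (c - a) d0; have e2 := hC1 (b - a); have e3 := hC1 (c - b).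
  have {e1}e1 := e1 (ltac:(lra)).
  have {e2}e2 := e2 (ltac:(lra)) (ltac:(lra)).
  have {e3}e3 := e3 (ltac:(lra)) (ltac:(lra)).
  have -> : m k.+1 (c - a) - m k.+1 (b - a) - m k.+1 (c - b) =
    (m k.+1 (c - a) - kap k.+1 * (c - a)) - (m k.+1 (b - a) - kap k.+1 * (b - a))
    - (m k.+1 (c - b) - kap k.+1 * (c - b)) by ring.
  apply: le_trans (ler_normB _ _) _; apply: le_trans (lerD (ler_normB _ _) (lexx _)) _.
  apply: le_trans (lerD (lerD e1 e2) e3) _.
  have s1 : (b - a) ^+ 2 <= (c - a) ^+ 2 by rewrite lerXn2r// ?nnegrE; lra.
  have s2 : (c - b) ^+ 2 <= (c - a) ^+ 2 by rewrite lerXn2r// ?nnegrE; lra.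
  have s3 : 0 <= (c - a) ^+ 2 by exact: sqr_ge0.
  have := ler_wpM2l C10 s1; have := ler_wpM2l C10 s2; have := mulr_ge0 C20 s3; lra.
- apply: le_trans (hC2 a b c a0 ab bc cT) _; rewrite ler_wpM2r//; lra.
Qed.

End GapReplacement.

(** * The algebra of pure tensors *)

Section TensorSquare.
Context (R : realType) (A : tracialVNA R).
Local Notation C := R[i].
Implicit Types (x y z S T Z : A) (u w : tpow 2 A).

Lemma conjM (c d : C) : Num.conj (c * d) = Num.conj c * Num.conj d.
Proof. exact: rmorphM. Qed.
Lemma conj_sum (I : Type) (r : seq I) (P : pred I) (F : I -> C) :
  Num.conj (\sum_(i <- r | P i) F i) = \sum_(i <- r | P i) Num.conj (F i).
Proof. exact: rmorph_sum. Qed.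

Lemma tens_multilinear (K : comNzRingType) n (V : lmodType K) : multilinear (@tens K n V).
Proof.
move=> v i c x y; apply: tpow_eqP => W f mf.
have lin := tlift_linear mf.
by rewrite lin !tlift_tens// mf.
Qed.

Lemma ord2_cases (i : 'I_2) : i = ord0 \/ i = ord_max.
Proof. by case: i => [[|[|//]] p]; [left|right]; apply/val_inj. Qed.

Lemma multilinear2 (W : lmodType C) (g : A -> A -> W) :
  (forall c x y z, g (c *: x + y) z = c *: g x z + g y z) ->
  (forall c x y z, g z (c *: x + y) = c *: g z x + g z y) ->
  multilinear (fun v : {ffun 'I_2 -> A} => g (v ord0) (v ord_max)).
Proof.
move=> hl hr v i c x y; rewrite !ffunE.
by have [->|->] := ord2_cases i; rewrite ?eqxx /= ?hl ?hr.
Qed.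

Lemma tlift_tens2 (W : lmodType C) (g : A -> A -> W) S T :
  multilinear (fun v : {ffun 'I_2 -> A} => g (v ord0) (v ord_max)) ->
  tlift (fun v : {ffun 'I_2 -> A} => g (v ord0) (v ord_max)) (tens2 S T) = g S T.
Proof. by move=> mg; rewrite tlift_tens// !ffunE. Qed.

Lemma tens2_linl c x y z : tens2 (c *: x + y) z = c *: tens2 x z + tens2 y z.
Proof.
have := @tens_multilinear C 2 A [ffun i => if i == ord0 then x else z] ord0 c x y.
rewrite /tens2 => h.
have e s : upd [ffun i => if i == ord0 then x else z] ord0 s = [ffun i : 'I_2 => if i == ord0 then s else z].
  by apply/ffunP => i; rewrite !ffunE; case: eqP.
by rewrite !e in h.
Qed.

Lemma tens2_linr c x y z : tens2 z (c *: x + y) = c *: tens2 z x + tens2 z y.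
Proof.
have := @tens_multilinear C 2 A [ffun i => if i == ord0 then z else x] ord_max c x y.
rewrite /tens2 => h.
have e s : upd [ffun i => if i == ord0 then z else x] ord_max s = [ffun i : 'I_2 => if i == ord0 then z else s].
  by apply/ffunP => i; rewrite !ffunE; have [->|->] := ord2_cases i.
by rewrite !e in h.
Qed.

Lemma tens2Dl x y z : tens2 (x + y) z = tens2 x z + tens2 y z.
Proof. by have := tens2_linl 1 x y z; rewrite !scale1r. Qed.
Lemma tens2Dr x y z : tens2 z (x + y) = tens2 z x + tens2 z y.
Proof. by have := tens2_linr 1 x y z; rewrite !scale1r. Qed.
Lemma tens20l z : tens2 0 z = 0.
Proof. by apply: (addrI (tens2 0 z)); rewrite -tens2Dl !addr0. Qed.
Lemma tens20r z : tens2 z 0 = 0.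
Proof. by apply: (addrI (tens2 z 0)); rewrite -tens2Dr !addr0. Qed.
Lemma tens2Zl c x z : tens2 (c *: x) z = c *: tens2 x z.
Proof. by have := tens2_linl c x 0 z; rewrite !addr0 tens20l addr0. Qed.
Lemma tens2Zr c x z : tens2 z (c *: x) = c *: tens2 z x.
Proof. by have := tens2_linr c x 0 z; rewrite !addr0 tens20r addr0. Qed.
Lemma tens2Nl x z : tens2 (- x) z = - tens2 x z.
Proof. by rewrite -[- x]scaleN1r tens2Zl scaleN1r. Qed.

Definition tsum (s : seq (A * A)) : tpow 2 A := \sum_(q <- s) tens2 q.1 q.2.

Lemma tsum_cat s t : tsum (s ++ t) = tsum s + tsum t. Proof. exact: big_cat. Qed.

Lemma tsum_ex u : exists s, u = tsum s.
Proof.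
exists (map (fun p : C * {ffun 'I_2 -> A} => (p.1 *: p.2 ord0, p.2 ord_max)) (repr u)).
rewrite /tsum big_map; apply: tpow_eqP => W f mf; have lin := tlift_linear mf.
have ts (I : Type) (r : seq I) (F : I -> tpow 2 A) : tlift f (\sum_(i <- r) F i) = \sum_(i <- r) tlift f (F i).
  apply: (big_morph (tlift f)) => [a b|]; last exact: tlift_zero.
  by have := lin 1 a b; rewrite !scale1r.
rewrite ts; apply: eq_bigr => p _; rewrite tens2Zl.
have := lin p.1 (tens2 (p.2 ord0) (p.2 ord_max)) 0; rewrite addr0 => ->.
have -> : tlift f 0 = 0 by exact: tlift_zero.
rewrite addr0 /tens2 tlift_tens//; congr (_ *: f _).
by apply/ffunP => i; rewrite !ffunE; have [->|->] := ord2_cases i.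
Qed.

(** The pairing of a tensor with an increment in the definition of the
    stochastic integral. *)
Definition act u Z : A := tlift (fun v : {ffun 'I_2 -> A} => v ord0 * Z * v ord_max) u.

Lemma act_multilinear Z : multilinear (fun v : {ffun 'I_2 -> A} => v ord0 * Z * v ord_max).
Proof.
apply: (multilinear2 (g := fun S T => S * Z * T)) => c x y z.
- by rewrite !mulrDl -!scalerAl.
- by rewrite mulrDr -scalerAr.
Qed.

Lemma act_tens2 S T Z : act (tens2 S T) Z = S * Z * T.
Proof. exact: (tlift_tens2 (g := fun S T => S * Z * T) S T (act_multilinear Z)). Qed.

Lemma actDl u w Z : act (u + w) Z = act u Z + act w Z.
Proof. by have := tlift_linear (act_multilinear Z) 1 u w; rewrite !scale1r. Qed.
Lemma act0l Z : act 0 Z = 0.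
Proof. exact: (tlift_zero (act_multilinear Z)). Qed.
Lemma actZl c u Z : act (c *: u) Z = c *: act u Z.
Proof. by have := tlift_linear (act_multilinear Z) c u 0; rewrite !addr0 [tlift _ 0]act0l addr0. Qed.
Lemma actNl u Z : act (- u) Z = - act u Z.
Proof. by rewrite -[- u]scaleN1r actZl scaleN1r. Qed.
Lemma actBl u w Z : act (u - w) Z = act u Z - act w Z.
Proof. by rewrite actDl actNl. Qed.
Lemma act_suml (I : Type) (r : seq I) (P : pred I) (F : I -> tpow 2 A) Z :
  act (\sum_(i <- r | P i) F i) Z = \sum_(i <- r | P i) act (F i) Z.
Proof. by apply: (big_morph (act^~ Z)) => [x y|]; rewrite ?actDl ?act0l. Qed.
Lemma act_tsum s Z : act (tsum s) Z = \sum_(q <- s) q.1 * Z * q.2.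
Proof. by rewrite act_suml; apply: eq_bigr => q _; rewrite act_tens2. Qed.

Lemma actDr u Z Z' : act u (Z + Z') = act u Z + act u Z'.
Proof.
have [s ->] := tsum_ex u; rewrite !act_tsum -big_split; apply: eq_bigr => q _ /=.
by rewrite mulrDr mulrDl.
Qed.
Lemma act0r u : act u 0 = 0.
Proof. by apply: (addrI (act u 0)); rewrite -actDr !addr0. Qed.
Lemma actZr c u Z : act u (c *: Z) = c *: act u Z.
Proof.
have [s ->] := tsum_ex u; rewrite !act_tsum scaler_sumr; apply: eq_bigr => q _ /=.
by rewrite -scalerAr -scalerAl.
Qed.
Lemma actNr u Z : act u (- Z) = - act u Z.
Proof. by rewrite -[- Z]scaleN1r actZr scaleN1r. Qed.
Lemma actBr u Z Z' : act u (Z - Z') = act u Z - act u Z'.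
Proof. by rewrite actDr actNr. Qed.
Lemma act_sumr u (I : Type) (r : seq I) (P : pred I) (F : I -> A) :
  act u (\sum_(i <- r | P i) F i) = \sum_(i <- r | P i) act u (F i).
Proof. by apply: (big_morph (act u)) => [x y|]; rewrite ?actDr ?act0r. Qed.

Lemma act1 u : act u 1 = tmul u.
Proof. by congr tlift; apply: funext => v; rewrite mulr1. Qed.

Lemma tmul_tens2 S T : tmul (tens2 S T) = S * T.
Proof. by rewrite -act1 act_tens2 mulr1. Qed.
Lemma tmulD u w : tmul (u + w) = tmul u + tmul w. Proof. by rewrite -!act1 actDl. Qed.
Lemma tmul0 : tmul 0 = 0 :> A. Proof. by rewrite -act1 act0l. Qed.
Lemma tmulB u w : tmul (u - w) = tmul u - tmul w. Proof. by rewrite -!act1 actBl. Qed.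
Lemma tmulZ c u : tmul (c *: u) = c *: tmul u. Proof. by rewrite -!act1 actZl. Qed.
Lemma act_bounded u : exists2 K, 0 <= K & forall Z, nrm (act u Z) <= K * nrm Z.
Proof.
have [s ->] := tsum_ex u; elim: s => [|[S T] s [K K0 IH]].
  by exists 0 => // Z; rewrite act_tsum big_nil nrm0 mul0r.
have [K1 h1] := mulbd_ex S; have [K2 h2] := mulbd_ex T.
exists (K1 * K2 + K); first by rewrite addr_ge0// mulr_ge0 ?(mulbd_ge0 h1) ?(mulbd_ge0 h2).
move=> Z; rewrite /tsum big_cons actDl act_tens2 mulrDl.
by apply: le_trans (nrmD _ _) _; rewrite lerD// mulbd_lr.
Qed.

Lemma tr_linl (c : C) x y z : tr ((c *: x + y) * z) = c * tr (x * z) + tr (y * z).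
Proof. by rewrite mulrDl -scalerAl trD trZ. Qed.
Lemma tr_linr (c : C) x y z : tr (z * (c *: x + y)) = c * tr (z * x) + tr (z * y).
Proof. by rewrite mulrDr -scalerAr trD trZ. Qed.

Lemma tdot_lift u w : tdot u w = tlift (fun v : {ffun 'I_2 -> A} =>
   \sum_(q <- repr w) Num.conj q.1 * tr (star (q.2 ord0) * v ord0) * tr (v ord_max * star (q.2 ord_max))) u.
Proof.
rewrite /tdot /tlift /feval; apply: eq_bigr => p _.
by rewrite [RHS]mulr_sumr; apply: eq_bigr => q _; rewrite !mulrA.
Qed.

Lemma tdot_semi_lin : forall c u v w, tdot (c *: u + v) w = c * tdot u w + tdot v w.
Proof.
move=> c u v w; rewrite !tdot_lift; apply: tlift_linear.
apply: (multilinear2 (W := C) (g := fun S T => \sum_(q <- repr w) Num.conj q.1 * tr (star (q.2 ord0) * S) * tr (T * star (q.2 ord_max)))) => d x y z.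
- rewrite [X in _ = X + _]mulr_sumr -big_split; apply: eq_bigr => q _ /=.
  rewrite tr_linr; ring.
- rewrite [X in _ = X + _]mulr_sumr -big_split; apply: eq_bigr => q _ /=.
  rewrite tr_linl; ring.
Qed.

Lemma tdot_herm u w : tdot w u = Num.conj (tdot u w).
Proof.
rewrite /tdot conj_sum exchange_big; apply: eq_bigr => p _ /=.
rewrite conj_sum; apply: eq_bigr => q _ /=.
by rewrite !conjM -!tr_star !starM !starK conjCK [Num.conj p.1 * q.1]mulrC.
Qed.

Lemma tdot_tens2 S T S' T' :
  tdot (tens2 S T) (tens2 S' T') = tr (star S' * S) * tr (T * star T').
Proof.
have e w : tdot (tens2 S T) w = Num.conj (tlift (fun v : {ffun 'I_2 -> A} => tr (star S * v ord0) * tr (v ord_max * star T) : C) w).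
  rewrite tdot_lift tlift_tens; last first.
    apply: (multilinear2 (W := C) (g := fun S T => \sum_(q <- repr w) Num.conj q.1 * tr (star (q.2 ord0) * S) * tr (T * star (q.2 ord_max)))) => d x y z.
    - rewrite [X in _ = X + _]mulr_sumr -big_split; apply: eq_bigr => q _ /=.
      rewrite tr_linr; ring.
    - rewrite [X in _ = X + _]mulr_sumr -big_split; apply: eq_bigr => q _ /=.
      rewrite tr_linl; ring.
  rewrite /tlift /feval conj_sum; apply: eq_bigr => q _; rewrite !ffunE/=.
  by rewrite !conjM -!tr_star !starM !starK mulrA.
rewrite e (tlift_tens2 (W := C) (g := fun x y => tr (star S * x) * tr (y * star T))).
  by rewrite conjM -!tr_star !starM !starK.
apply: (multilinear2 (W := C) (g := fun x y => tr (star S * x) * tr (y * star T))) => d x y z.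
- rewrite tr_linr [d *: _]/GRing.scale /=; ring.
- rewrite tr_linl [d *: _]/GRing.scale /=; ring.
Qed.

End TensorSquare.

(** * Positivity on the tensor square and adapted tensors *)

Section TensorPositivity.
Context (R : realType) (A : tracialVNA R).
Local Notation C := R[i].
Local Notation Re := complex.Re.
Implicit Types (x y z S T Z : A) (u w : tpow 2 A).

Definition orth x y : Prop := tr (star y * x) = 0.

Lemma orth_sym x y : orth x y -> orth y x.
Proof. by rewrite /orth => h; rewrite -[star x * y]starK starM starK tr_star h rmorph0. Qed.

Fixpoint orth_family (s : seq (A * A)) : Prop :=
  if s is q :: s' then (forall q', q' \in s' -> orth q.1 q'.1) /\ orth_family s' else True.

(** One step of Gram-Schmidt inside a tensor: subtracting multiples of the
    e_i from S moves these multiples to the right factors T_i. *)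
Lemma gram_schmidt_step (l : seq (A * A)) S T : orth_family l -> exists S' l',
  [/\ tens2 S T + tsum l = tens2 S' T + tsum l', [seq q.1 | q <- l'] = [seq q.1 | q <- l] &
      forall x, x \in [seq q.1 | q <- l] -> orth S' x].
Proof.
elim: l => [|[e Te] l IH] /=; first by exists S, [::]; split.
move=> [he ho]; have [S1 [l1 [h1 h2 h3]]] := IH ho.
pose c := tr (star e * S1) / tr (star e * e).
exists (S1 - c *: e), ((e, Te + c *: T) :: l1); split.
- rewrite /tsum !big_cons /= -!/(tsum _) tens2Dl tens2Nl tens2Zl tens2Dr tens2Zr.
  rewrite addrCA h1.
  have reorder (p q r t : tpow 2 A) : r + (p + t) = p - q + (r + q + t).
    by rewrite (addrC r q) !addrA addrNK (addrC r p).
  exact: reorder.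
- by rewrite /= h2.
- move=> x; rewrite inE => /orP[/eqP ->|xl]; rewrite /orth mulrBr trB -scalerAr trZ.
    have [e0|e0] := eqVneq (tr (star e * e)) 0.
      by rewrite e0 mulr0 subr0 (tr_faithful e0) star0 mul0r linear0.
    by rewrite /c divfK// subrr.
  have -> : tr (star x * S1) = 0 by exact: h3.
  have : orth e x by move: xl => /mapP[q ql ->]; exact: he.
  by rewrite /orth => ->; rewrite mulr0 subrr.
Qed.

Lemma gram_schmidt (s : seq (A * A)) : exists2 s', orth_family s' & tsum s = tsum s'.
Proof.
elim: s => [|[S T] s [s' ho hs]]; first by exists [::].
have [S1 [l1 [h1 h2 h3]]] := gram_schmidt_step S T ho.
exists ((S1, T) :: l1); last first.
  by rewrite /tsum !big_cons -/(tsum s) -/(tsum l1) -h1 hs.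
split => /=.
  by move=> q' ql; apply: h3; rewrite -h2; apply: map_f.
have : forall l l' : seq (A * A), [seq q.1 | q <- l] = [seq q.1 | q <- l'] -> orth_family l -> orth_family l'.
  elim=> [|q l IH] [|q' l'] //= [e1 e2] [ha hb]; split; last exact: IH.
  move=> q0 /(map_f fst); rewrite -e2 => /mapP[q1 q1l e]; rewrite -e1 /= e; exact: ha.
by move=> /(_ s' l1 (esym h2) ho).
Qed.

(** Any element is a sum of tensors with pairwise orthogonal left factors,
    and for such a sum the mixed terms vanish. *)
Lemma tdot_ge0 u : 0 <= Re (tdot u u).
Proof.
have [s ->] := tsum_ex u; have [s' ho ->] := gram_schmidt s.
have hsD (x y z : tpow 2 A) : tdot (x + y) z = tdot x z + tdot y z.
  by have := tdot_semi_lin 1 x y z; rewrite scale1r mul1r.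
have hs0 (z : tpow 2 A) : tdot 0 z = 0 by apply: (addrI (tdot 0 z)); rewrite -hsD !addr0.
have hsum (l : seq (A * A)) (z : tpow 2 A) : tdot (tsum l) z = \sum_(q <- l) tdot (tens2 q.1 q.2) z.
  by elim: l => [|q l IH]; rewrite /tsum ?big_nil ?hs0// !big_cons hsD -/(tsum l) IH.
elim: s' ho => [|[e T] l IH] /=; first by rewrite /tsum big_nil hs0.
move=> [h ho]; rewrite /tsum big_cons -/(tsum l) /=.
have cross : tdot (tsum l) (tens2 e T) = 0.
  rewrite hsum big_seq big1// => q ql; rewrite tdot_tens2.
  by have := orth_sym (h q ql); rewrite /orth => ->; rewrite mul0r.
have expand : tdot (tens2 e T + tsum l) (tens2 e T + tsum l) = tdot (tens2 e T) (tens2 e T) + tdot (tsum l) (tsum l).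
  rewrite hsD; congr (_ + _).
    by rewrite tdot_herm hsD cross addr0 -tdot_herm.
  by rewrite tdot_herm hsD (tdot_herm (tsum l) (tens2 e T)) cross rmorph0 add0r -tdot_herm.
rewrite expand ReD addr_ge0 ?IH// tdot_tens2 (tr_trace T).
have r x : 0 <= tr (star x * x) by exact: tr_ge0.
by have := mulr_ge0 (r e) (r T); rewrite lecE => /andP[].
Qed.

Lemma tdot_semi : semi_inner (@tdot R A).
Proof. by split; [exact: tdot_semi_lin|exact: tdot_herm|exact: tdot_ge0]. Qed.

Lemma tnorm2_hnorm u : tnorm2 u = hnorm (@tdot R A) u. Proof. by []. Qed.

Lemma tnorm2_ge0 u : 0 <= tnorm2 u. Proof. exact: hnorm_ge0. Qed.

Lemma tnorm2_tens2 S T : tnorm2 (tens2 S T) = nrm S * nrm T.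
Proof.
apply/eqP; rewrite -(eqrXn2 (n := 2)) ?mulr_ge0 ?nrm_ge0 ?tnorm2_ge0//.
rewrite exprMn tnorm2_hnorm (hnorm_sqr tdot_semi) tdot_tens2 !nrm_sqr (tr_trace T).
have real x : tr (star x * x) = (Re (tr (star x * x)))%:C.
  by rewrite RRe_real// realE tr_ge0.
by rewrite real Re_rM.
Qed.

End TensorPositivity.

Section AdaptedTensors.
Context (R : realType) (A : tracialVNA R).
Context (At : R -> set A) (X : R -> R -> A) (m : nat -> R -> R) (kap : nat -> R).
Hypothesis hX : free_increments At X m kap.
Local Notation Re := complex.Re.
Implicit Types (x y z Z : A) (u w : tpow 2 A) (a b t : R).

Definition adapted_at t u : Prop :=
  exists2 s : seq (A * A), {in s, forall p, At t p.1 /\ At t p.2} & u = tsum s.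

Lemma adapted_at0 t : adapted_at t 0.
Proof. by exists [::] => //; rewrite /tsum big_nil. Qed.

Lemma adapted_atD t u w : adapted_at t u -> adapted_at t w -> adapted_at t (u + w).
Proof.
move=> [s hs ->] [s' hs' ->]; exists (s ++ s'); last by rewrite tsum_cat.
by move=> p; rewrite mem_cat => /orP[/hs|/hs'].
Qed.

Lemma adapted_atZ t c u : 0 <= t -> adapted_at t u -> adapted_at t (c *: u).
Proof.
move=> t0 [s hs ->]; exists [seq (c *: q.1, q.2) | q <- s].
  by move=> p /mapP[q /hs[h1 h2] ->] /=; split => //; apply: (AtZ hX).
by rewrite /tsum big_map scaler_sumr; apply: eq_bigr => q _; rewrite tens2Zl.
Qed.

Lemma adapted_atB t u w : 0 <= t -> adapted_at t u -> adapted_at t w -> adapted_at t (u - w).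
Proof. by move=> t0 hu hw; rewrite -scaleN1r; apply: adapted_atD => //; apply: adapted_atZ. Qed.

Lemma adapted_at_sum t (I : eqType) (r : seq I) (F : I -> tpow 2 A) :
  (forall i, i \in r -> adapted_at t (F i)) -> adapted_at t (\sum_(i <- r) F i).
Proof.
elim: r => [|i r IH] h; first by rewrite big_nil; exact: adapted_at0.
rewrite big_cons; apply: adapted_atD; first by apply: h; rewrite mem_head.
by apply: IH => j jr; apply: h; rewrite inE jr orbT.
Qed.

Lemma adapted_at_tens2 t x y : At t x -> At t y -> adapted_at t (tens2 x y).
Proof.
by move=> hx hy; exists [:: (x, y)]; [move=> p; rewrite inE => /eqP ->|rewrite /tsum big_seq1].
Qed.

Lemma adapted_at_mono s t u : 0 <= s -> s <= t -> adapted_at s u -> adapted_at t u.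
Proof.
move=> s0 st [l hl ->]; exists l => // p /hl[h1 h2]; split; exact: (fi_mono hX s0 st).
Qed.

Lemma At_act t u Z : 0 <= t -> adapted_at t u -> At t Z -> At t (act u Z).
Proof.
move=> t0 [s hs ->] hZ; rewrite act_tsum big_seq; apply: (At_sum hX) => // q /hs[h1 h2].
by apply: (fi_mul hX) => //; apply: (fi_mul hX).
Qed.

Lemma At_tmul t u : 0 <= t -> adapted_at t u -> At t (tmul u).
Proof. by move=> t0 hu; rewrite -act1; apply: At_act => //; exact: (fi_one hX). Qed.

Section OneIncrement.
Context (a b : R) (a0 : 0 <= a) (ab : a <= b) (u : tpow 2 A) (hu : adapted_at a u).
Local Notation gen := (generated [set X a b]).

Lemma tr_act x Z : At a x -> gen Z -> tr (x * act u Z) = tr (x * tmul u) * tr Z.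
Proof.
case: hu => s hs -> hx hZ; rewrite act_tsum -act1 act_tsum !mulr_sumr !linear_sum /= mulr_suml.
rewrite big_seq [RHS]big_seq; apply: eq_bigr => q /hs[h1 h2].
have hx' : At a (q.2 * x * q.1) by do 2!apply: (fi_mul hX) => //.
rewrite mulr1 !mulrA tr_trace !mulrA (free_prod2 hX a0 ab hx' hZ).
by congr (_ * _); rewrite -!mulrA tr_trace !mulrA.
Qed.

(** Since tr Z = 0, freeness factorizes the trace of Z (star S * S') Z (T' *
    star T) into tr (Z^2) and the two traces which make up the form on the
    tensor square. *)
Lemma nrm_act_centered Z : gen Z -> tr Z = 0 -> star Z = Z ->
  nrm (act u Z) ^+ 2 = nrm Z ^+ 2 * tnorm2 u ^+ 2.
Proof.
case: hu => s hs eu hZ Z0 sZ.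
have key : tr (star (act u Z) * act u Z) = tr (Z * Z) * tdot u u.
  have suml (l : seq (A * A)) (z : tpow 2 A) : tdot (tsum l) z = \sum_(q <- l) tdot (tens2 q.1 q.2) z.
    exact: (Re_semi_suml (tdot_semi A)).
  have sumr (l : seq (A * A)) (z : tpow 2 A) : tdot z (tsum l) = \sum_(q <- l) tdot z (tens2 q.1 q.2).
    rewrite (semi_herm (tdot_semi A) (tsum l) z) suml conj_sum.
    by apply: eq_bigr => q _; rewrite -(semi_herm (tdot_semi A)).
  rewrite eu act_tsum star_sum mulr_suml linear_sum /= sumr mulr_sumr.
  rewrite big_seq [RHS]big_seq; apply: eq_bigr => q /hs[q1 q2].
  rewrite mulr_sumr linear_sum /= suml mulr_sumr.
  rewrite big_seq [RHS]big_seq; apply: eq_bigr => p /hs[p1 p2].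
  rewrite tdot_tens2 !starM sZ.
  have -> : tr (star q.2 * (Z * star q.1) * (p.1 * Z * p.2)) =
            tr ((p.2 * star q.2) * Z * (star q.1 * p.1) * Z).
    have -> : star q.2 * (Z * star q.1) * (p.1 * Z * p.2) =
       (star q.2 * Z * star q.1 * p.1 * Z) * p.2 by rewrite !mulrA.
    by rewrite tr_trace !mulrA.
  have sA z : At a z -> At a (star z) by exact: (fi_star hX).
  rewrite (free_prod4 hX a0 ab)//; last 2 first.
  - by apply: (fi_mul hX) => //; exact: sA.
  - by apply: (fi_mul hX) => //; exact: sA.
  by rewrite Z0 !(mulr0, mul0r, subr0, addr0) mulrC [X in _ * X = _]mulrC.
rewrite nrm_sqr key nrm_sqr sZ.
have -> : tr (Z * Z) = (Re (tr (Z * Z)))%:C.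
  by rewrite RRe_real// realE -{1}sZ tr_ge0.
by rewrite Re_rM/= tnorm2_hnorm (hnorm_sqr (tdot_semi A)).
Qed.

Lemma nrm_act_power_centered k :
  nrm (act u (centered (X a b ^+ k))) <= Num.sqrt (m (k * 2) (b - a)) * tnorm2 u.
Proof.
set Z := X a b ^+ k.
have sZ : star Z = Z by rewrite starX (fi_sa hX).
have mZ : tr Z = (m k (b - a))%:C by exact: (fi_tr hX).
have sc : star (centered Z) = centered Z.
  by rewrite /centered starB starZ star1 sZ mZ conjcE conjc_real.
rewrite -(ler_pXn2r (n := 2)) ?nnegrE ?mulr_ge0 ?nrm_ge0 ?sqrtr_ge0 ?tnorm2_ge0//.
rewrite (nrm_act_centered (generated_centered (incr_gen _)) (tr_centered _) sc).
have e1 : nrm Z ^+ 2 = m (k * 2) (b - a) by exact: (nrm_Xn_sqr hX).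
have e2 : nrm (centered Z) ^+ 2 <= nrm Z ^+ 2.
  rewrite !nrm_sqr sc sZ.
  have -> : centered Z * centered Z = Z * Z - tr Z *: Z - tr Z *: Z + (tr Z * tr Z) *: 1.
    rewrite /centered mulrBr !mulrBl -!scalerAl -!scalerAr mulr1 mul1r opprB addrA.
    by rewrite scalerA mulr1 addrAC.
  rewrite trD !trB !trZ tr_one mulr1 mZ -!rmorphM ReD !ReB /=.
  have := sqr_ge0 (m k (b - a)); nra.
have m0 : 0 <= m (k * 2) (b - a) by rewrite -e1 sqr_ge0.
by rewrite [leRHS]exprMn [Num.sqrt (m _ _) ^+ 2]sqr_sqrtr// -e1 ler_wpM2r// sqr_ge0.
Qed.

(** Centering the power removes the drift. *)
Lemma small_incr_act_centered k :
  small_incr At a b (act u (centered (X a b ^+ k))) 0 (Num.sqrt (m (k * 2) (b - a)) * tnorm2 u).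
Proof.
have b0 : 0 <= b by exact: le_trans ab.
have hub : adapted_at b u by exact: adapted_at_mono hu.
split; rewrite ?mulr_ge0 ?sqrtr_ge0 ?tnorm2_ge0//.
- apply: At_act => //; apply: (At_centered hX) => //; apply: (AtX hX) => //; exact: (fi_adapted hX).
- move=> x hx; rewrite tr_act//; last by apply: generated_centered; exact: incr_gen.
  by rewrite tr_centered mulr0 Normc.normc0 mul0r.
- exact: nrm_act_power_centered.
Qed.

Lemma act_power_split k : act u (X a b ^+ k) = act u (centered (X a b ^+ k)) + (m k (b - a))%:C *: tmul u.
Proof.
by rewrite {1}[X a b ^+ k]centeredK actDr actZr act1 (fi_tr hX).
Qed.

Lemma small_incr_act k :
  small_incr At a b (act u (X a b ^+ k)) (`|m k (b - a)| * nrm (tmul u))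
    (Num.sqrt (m (k * 2) (b - a)) * tnorm2 u + `|m k (b - a)| * nrm (tmul u)).
Proof.
have b0 : 0 <= b by exact: le_trans ab.
have hub : adapted_at b u by exact: adapted_at_mono hu.
rewrite act_power_split -[X in small_incr _ _ _ _ X _]add0r; apply: (small_incrD hX) => //.
  exact: small_incr_act_centered.
split; rewrite ?mulr_ge0 ?nrm_ge0//.
- by apply: (AtZ hX) => //; exact: At_tmul.
- move=> x hx; rewrite -scalerAr trZ Normc.normcM normcR -mulrA ler_wpM2l// mulrC.
  exact: tr_le_nrm.
- by rewrite nrmZ normcR.
Qed.

End OneIncrement.

End AdaptedTensors.

(** * Diagonal measures of intervals *)

Section Vanish.
Context (R : realType).
Implicit Types (f g : nat -> R).

Definition vanish f : Prop :=
  forall e, 0 < e -> exists N, forall n, (N <= n)%N -> f n <= e.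

Lemma vanish_le f g : (exists N, forall n, (N <= n)%N -> f n <= g n) -> vanish g -> vanish f.
Proof.
move=> [N h] hg e /hg[M hM]; exists (maxn N M) => n; rewrite geq_max => /andP[h1 h2].
exact: le_trans (h n h1) (hM n h2).
Qed.

Lemma vanish_lew f g : (forall n, f n <= g n) -> vanish g -> vanish f.
Proof. by move=> h; apply: vanish_le; exists 0%N. Qed.

Lemma vanishD f g : vanish f -> vanish g -> vanish (fun n => f n + g n).
Proof.
move=> hf hg e e0; have e2 : 0 < e / 2 by rewrite divr_gt0.
have [N hN] := hf _ e2; have [M hM] := hg _ e2.
exists (maxn N M) => n; rewrite geq_max => /andP[/hN h1 /hM h2].
by rewrite [e]splitr lerD.
Qed.

Lemma vanish0 : vanish (fun=> 0).
Proof. by move=> e e0; exists 0%N => n _; exact: ltW. Qed.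

Lemma vanishZ c f : 0 <= c -> vanish f -> vanish (fun n => c * f n).
Proof.
move=> c0 hf e e0; have c1 : 0 < c + 1 by rewrite ltr_wpDl.
have [N hN] := hf (e / (c + 1)) (divr_gt0 e0 c1).
exists N => n /hN h; apply: le_trans (ler_wpM2l c0 h) _.
by rewrite mulrCA ler_piMr ?(ltW e0)// ler_pdivrMr// mul1r lerDl.
Qed.

Lemma vanish_sqrt f : vanish f -> vanish (fun n => Num.sqrt (f n)).
Proof.
move=> hf e e0; have [N hN] := hf (e ^+ 2) (exprn_gt0 2 e0).
exists N => n /hN h; apply: le_trans (ler_wsqrtr h) _.
by rewrite sqrtr_sqr gtr0_norm.
Qed.

Lemma vanish_inv c : vanish (fun n => c / n.+1%:R).
Proof.
move=> e e0; exists (Num.trunc (`|c| / e)) => n hn.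
apply: (@le_trans _ _ (`|c| / n.+1%:R)); first by rewrite ler_wpM2r// ler_norm.
rewrite ler_pdivrMr// mulrC -ler_pdivrMr//.
have c0 : 0 <= `|c| / e by rewrite divr_ge0// ltW.
have /andP[_ h] := Num.Theory.trunc_itv c0.
by apply: le_trans (ltW h) _; rewrite ler_nat.
Qed.

Lemma vanish_sum n (f : nat -> nat -> R) : (forall i, (i < n)%N -> vanish (f i)) ->
  vanish (fun N => \sum_(i < n) f i N).
Proof.
elim: n => [|n IH] h; first by apply: vanish_lew vanish0 => N; rewrite big_ord0.
apply: (@vanish_lew _ (fun N => \sum_(i < n) f i N + f n N)).
  by move=> N; rewrite big_ord_recr.
by apply: vanishD; [apply: IH => i hi; apply: h; exact: ltnW|exact: h].
Qed.

Lemma vanish_comp (g : nat -> nat) f : (forall K, exists N, forall n, (N <= n)%N -> (K <= g n)%N) ->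
  vanish f -> vanish (f \o g).
Proof.
move=> hg hf e /hf[N hN]; have [M hM] := hg N.
by exists M => n /hM /hN.
Qed.

Lemma vanish_shift k f : vanish f -> vanish (fun n => f (n + k)%N).
Proof.
move=> hf e /hf[N hN]; exists N => n hn; apply: hN.
exact: leq_trans (leq_addr _ _).
Qed.

Lemma vanish_bound x c f : vanish f -> (exists N, forall n, (N <= n)%N -> x <= c + f n) -> x <= c.
Proof.
move=> hf [N h]; apply/ler_addgt0Pr => e e0; have [M hM] := hf e e0.
have h1 := h (maxn N M) (leq_maxl _ _); have h2 := hM (maxn N M) (leq_maxr _ _).
by apply: le_trans h1 _; rewrite lerD2l.
Qed.

Lemma vanish_cvg f : (forall n, 0 <= f n) -> vanish f -> f n @[n --> \oo] --> (0 : R).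
Proof.
move=> f0 hf; apply/cvgrPdist_le => e e0; have [N hN] := hf e e0.
near=> n; rewrite sub0r normrN ger0_norm//; apply: hN; near: n; exact: nbhs_infty_ge.
Unshelve. all: by end_near.
Qed.

Lemma cvg_vanish f : f n @[n --> \oo] --> (0 : R) -> vanish f.
Proof.
move=> /cvgrPdist_le h e e0; have := h e e0; case=> N _ hN.
exists N => n hn; have := hN n hn; rewrite /= sub0r normrN.
by apply: le_trans; exact: ler_norm.
Qed.

End Vanish.

Section DiagonalMeasures.
Context (R : realType) (A : tracialVNA R).
Context (At : R -> set A) (X : R -> R -> A) (m : nat -> R -> R) (kap : nat -> R).
Hypothesis hX : free_increments At X m kap.
Context (Delta : nat -> R -> R -> A).
Hypothesis hD : diagonal_measures X Delta.

Definition subdivision (a b : R) (pi : nat -> R) (n : nat) : Prop :=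
  [/\ pi 0%N = a, pi n = b & forall i, (i < n)%N -> pi i <= pi i.+1].

Definition power_sum k (pi : nat -> R) (n : nat) : A :=
  \sum_(i < n) X (pi i) (pi i.+1) ^+ k.

Lemma subdivision_le a b pi n : subdivision a b pi n -> forall i, (i <= n)%N -> a <= pi i /\ pi i <= b.
Proof.
case=> h0 hn hs; have up i j : (i <= j)%N -> (j <= n)%N -> pi i <= pi j.
  elim: j => [|j IH]; first by rewrite leqn0 => /eqP ->.
  rewrite leq_eqVlt => /orP[/eqP ->//|ij] jn.
  by apply: le_trans (hs j jn); apply: IH => //; exact: ltnW.
by move=> i hi; rewrite -h0 -hn; split; apply: up.
Qed.

Definition even_points (b : R) (n : nat) : nat -> R := fun i => i%:R / n%:R * b.

Lemma even_subdivision b n : 0 <= b -> (0 < n)%N -> subdivision 0 b (even_points b n) n.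
Proof.
move=> b0 n0; have nn : n%:R != 0 :> R by rewrite pnatr_eq0 -lt0n.
split; rewrite /even_points ?mul0r ?divff ?mul1r// => i _.
by rewrite ler_wpM2r// ler_wpM2r ?invr_ge0// ler_nat.
Qed.

Lemma even_step b n i : even_points b n i.+1 - even_points b n i = b / n%:R.
Proof. by rewrite /even_points -mulrBl -mulrBl -natrB// subSnn mul1r mulrC. Qed.

Lemma Delta_even k b : (0 < k)%N -> 0 <= b ->
  vanish (fun n => nrm (power_sum k (even_points b n) n - Delta k 0 b)).
Proof.
move=> k0 b0; have := hD k0 (lexx 0) b0 => /cvg_vanish; apply: vanish_lew => n.
have -> : power_sum k (even_points b n) n = diagonal_sum X k 0 b n.
  rewrite /diagonal_sum /power_sum big_add1 /= big_mkord; apply: eq_bigr => i _.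
  by rewrite /even_points !add0r !subr0.
exact: nrm_le_opnorm.
Qed.

Lemma nrm_Delta_empty k : (0 < k)%N -> nrm (Delta k 0 0) = 0.
Proof.
move=> k0; apply/eqP; rewrite eq_le nrm_ge0 andbT.
apply: (vanish_bound (Delta_even k0 (lexx 0))); exists 1%N => n n0.
have -> : power_sum k (even_points 0 n) n = 0.
  rewrite /power_sum big1// => i _; rewrite /even_points !mulr0 (X_refl hX)//.
  by rewrite expr0n eqn0Ngt k0.
by rewrite sub0r nrmN add0r.
Qed.

(** Each difference is a small increment over its cell, so that both the
    drift and the quadratic variation of the sum are of order n h^2. *)
Lemma cut_sum_small T k : 0 <= T -> (0 < k)%N -> exists2 C, 0 <= C &
  forall (pi ro : nat -> R) n h, 0 <= pi 0%N -> pi n <= T ->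
  (forall i, (i < n)%N -> [/\ pi i <= ro i, ro i <= pi i.+1 & pi i.+1 - pi i <= h]) ->
  nrm (\sum_(i < n) (X (pi i) (pi i.+1) ^+ k - X (pi i) (ro i) ^+ k - X (ro i) (pi i.+1) ^+ k))
    <= C * (n%:R * h ^+ 2) + Num.sqrt (C * (n%:R * h ^+ 2)).
Proof.
move=> T0; case: k => [//|k] _.
have [C C0 hC] := cut_power_small hX k T0.
exists (C + C ^+ 2); first by rewrite addr_ge0 ?sqr_ge0.
move=> pi ro n h p0 pT hs.
have mono i : (i < n)%N -> pi i <= pi i.+1 by move=> /hs[h1 h2 _]; exact: le_trans h2.
have sub : subdivision (pi 0%N) (pi n) pi n by [].
have bl i : (i < n)%N -> block At (pi i) (pi i.+1)
    (X (pi i) (pi i.+1) ^+ k.+1 - X (pi i) (ro i) ^+ k.+1 - X (ro i) (pi i.+1) ^+ k.+1)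
    ((C + C ^+ 2) * h ^+ 2) ((C + C ^+ 2) * h ^+ 2).
  move=> hi; have [h1 h2 h3] := hs i hi.
  have [lo _] := subdivision_le sub (ltnW hi); have [_ up] := subdivision_le sub hi.
  have pi0 := le_trans p0 lo.
  have sm := hC _ _ _ pi0 h1 h2 (le_trans up pT).
  have d0 : 0 <= pi i.+1 - pi i by rewrite subr_ge0 mono.
  have hh : (pi i.+1 - pi i) ^+ 2 <= h ^+ 2 by rewrite lerXn2r// nnegrE// (le_trans d0).
  have q1 := sqr_ge0 (pi i.+1 - pi i); have q2 := sqr_ge0 C; have q3 := sqr_ge0 h.
  apply: blockW (small_incr_block hX pi0 sm).
  - by have := ler_wpM2l C0 hh; have := mulr_ge0 q2 q3; lra.
  - by rewrite exprMn; have := ler_wpM2l q2 hh; have := mulr_ge0 C0 q3; lra.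
have [B _] := block_sum hX p0 mono bl.
have := block_nrm hX p0 B; rewrite !sumr_const card_ord -![(_ * h ^+ 2) *+ n]mulr_natl.
by rewrite !(mulrCA n%:R).
Qed.

Lemma even_pointsE b n i : even_points b n i = i%:R * (b / n%:R).
Proof. by rewrite /even_points mulrAC mulrA. Qed.

Section Interleave.
Context (a b : R) (a0 : 0 < a) (ab : a < b).

Definition left_cells (N : nat) : nat := Num.trunc (N%:R / b * a).
Local Notation M := left_cells.

Let b0 : 0 < b. Proof. exact: lt_trans ab. Qed.

Lemma left_cells_itv N : (0 < N)%N ->
  (M N)%:R * (b / N%:R) <= a /\ a < (M N).+1%:R * (b / N%:R).
Proof.
move=> N0; have Np : 0 < N%:R :> R by rewrite ltr0n.
have r0 : 0 < b / N%:R by rewrite divr_gt0.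
have nn : 0 <= N%:R / b * a by rewrite mulr_ge0 ?divr_ge0// ltW.
have /andP[h1 h2] := Num.Theory.trunc_itv nn.
have e : N%:R / b * a = a / (b / N%:R) by field; rewrite !gt_eqF// ltr0n.
by rewrite -ler_pdivlMr// -ltr_pdivrMr// -e; split.
Qed.

Lemma left_cells_lt N : (0 < N)%N -> (M N < N)%N.
Proof.
move=> N0; have [h _] := left_cells_itv N0.
have Np : 0 < N%:R :> R by rewrite ltr0n.
have : (M N)%:R * (b / N%:R) < N%:R * (b / N%:R).
  by apply: le_lt_trans h _; rewrite mulrCA divff ?gt_eqF// mulr1.
by rewrite ltr_pM2r ?divr_gt0// ltr_nat.
Qed.

Lemma left_cells_large K : exists N, forall n, (N <= n)%N -> (K <= M n)%N.
Proof.
exists (Num.trunc (K%:R / a * b)).+1 => n hn.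
have n0 : (0 < n)%N by exact: leq_trans hn.
have np : 0 < n%:R :> R by rewrite ltr0n.
have [_ h] := left_cells_itv n0.
have k0 : 0 <= K%:R / a * b by rewrite mulr_ge0 ?divr_ge0// ltW.
have /andP[_ h2] := Num.Theory.trunc_itv k0.
have h3 : K%:R / a * b < n%:R by apply: lt_le_trans h2 _; rewrite ler_nat.
have h4 : K%:R * b < a * n%:R by rewrite -ltr_pdivrMl// mulrC mulrAC; exact: h3.
have h5 : a * n%:R < (M n).+1%:R * b by rewrite -ltr_pdivlMr// -mulrA.
have : K%:R * b < (M n).+1%:R * b by exact: lt_trans h5.
by rewrite ltr_pM2r// ltr_nat ltnS.
Qed.

(** The even subdivision of [0, b) into N cells, restricted to [a, b). *)
Definition right_points (N : nat) : nat -> R :=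
  fun j => if j is j'.+1 then even_points b N (M N + j) else a.

Lemma right_subdivision N : (0 < N)%N -> subdivision a b (right_points N) (N - M N).
Proof.
move=> N0; have MN := left_cells_lt N0; have [h1 h2] := left_cells_itv N0.
have Np : 0 < N%:R :> R by rewrite ltr0n.
split => //.
- rewrite /right_points; case E : (N - M N)%N => [|j]; first by move: MN; rewrite -subn_gt0 E.
  by rewrite -E subnKC ?(ltnW MN)// /even_points divff ?gt_eqF// mul1r.
- move=> [|i] hi; rewrite /right_points.
    by rewrite even_pointsE addn1 ltW.
  by rewrite !even_pointsE ler_wpM2r ?divr_ge0 ?(ltW b0)// ler_nat leq_add2l.
Qed.

Lemma right_mesh N i : (0 < N)%N -> (i < N - M N)%N ->
  right_points N i.+1 - right_points N i <= b / N%:R.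
Proof.
move=> N0 hi; have [h1 h2] := left_cells_itv N0.
case: i hi => [|i] hi; rewrite /right_points; last by rewrite addnS even_step.
rewrite even_pointsE addn1 -natr1 mulrDl mul1r lerBlDr addrC lerD2l//.
Qed.

Let q N := even_points b N.
Let q' N := even_points a (M N).

(** With M the integer part of N a / b, the points of the even subdivisions
    of [0, b) into N cells and of [0, a) into M cells alternate up to a, so
    that each subdivision cuts in two the cells of the other that meet [0,
    a). *)
Lemma interleaved N i : (0 < N)%N -> (0 < M N)%N -> (i <= M N)%N ->
  q N i <= q' N i /\ q' N i <= q N i.+1.
Proof.
move=> N0 M0 hi; have [h1 h2] := left_cells_itv N0.
have Mp : 0 < (M N)%:R :> R by rewrite ltr0n.
rewrite /q /q' !even_pointsE.
have rr : b / N%:R <= a / (M N)%:R by rewrite ler_pdivlMr// mulrC.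
split; first by rewrite ler_wpM2l.
have : i%:R * (a / (M N)%:R - b / N%:R) <= (M N)%:R * (a / (M N)%:R - b / N%:R).
  by rewrite ler_wpM2r ?subr_ge0// ler_nat.
have -> : (M N)%:R * (a / (M N)%:R - b / N%:R) = a - (M N)%:R * (b / N%:R).
  by rewrite mulrBr mulrCA divff ?gt_eqF// mulr1.
by move: h2; rewrite -!natr1 !mulrDl !mul1r mulrBr; lra.
Qed.

Lemma interleaved_identity k N : (0 < k)%N -> (0 < N)%N -> (0 < M N)%N ->
  power_sum k (q N) N - power_sum k (q' N) (M N) - power_sum k (right_points N) (N - M N) =
  \sum_(i < (M N).+1) (X (q N i) (q N i.+1) ^+ k - X (q N i) (q' N i) ^+ k - X (q' N i) (q N i.+1) ^+ k)
  - \sum_(i < M N) (X (q' N i) (q' N i.+1) ^+ k - X (q' N i) (q N i.+1) ^+ k - X (q N i.+1) (q' N i.+1) ^+ k).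
Proof.
move=> k0 N0 M0; have MN := left_cells_lt N0.
have Mp : 0 < (M N)%:R :> R by rewrite ltr0n.
have q'M : q' N (M N) = a by rewrite /q' /even_points divff ?gt_eqF// mul1r.
have first0 : X (q N 0%N) (q' N 0%N) ^+ k = 0.
  by rewrite /q /q' /even_points !mul0r (X_refl hX)// expr0n eqn0Ngt k0.
have split1 : power_sum k (q N) N = \sum_(i < (M N).+1) X (q N i) (q N i.+1) ^+ k +
    \sum_(i < N - (M N).+1) X (q N ((M N).+1 + i)%N) (q N ((M N).+1 + i).+1) ^+ k.
  rewrite /power_sum -(big_mkord xpredT (fun i => X (q N i) (q N i.+1) ^+ k)).
  rewrite (big_cat_nat _ (n := (M N).+1))//= big_mkord; congr (_ + _).
  rewrite -{1}[(M N).+1]add0n big_addn big_mkord; apply: eq_bigr => i _.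
  by rewrite addnC.
have split2 : power_sum k (right_points N) (N - M N) = X a (q N (M N).+1) ^+ k +
    \sum_(i < N - (M N).+1) X (q N ((M N).+1 + i)%N) (q N ((M N).+1 + i).+1) ^+ k.
  have -> : (N - M N = (N - (M N).+1).+1)%N by rewrite subnS prednK// subn_gt0.
  rewrite /power_sum big_ord_recl /= /right_points addn1; congr (_ + _).
  by apply: eq_bigr => i _; rewrite /bump /= add1n !addnS !addSn.
rewrite split1 split2 !sumrB [\sum_(i < (M N).+1) X (q N i) (q' N i) ^+ k]big_ord_recl /=.
rewrite first0 add0r [\sum_(i < (M N).+1) X (q' N i) (q N i.+1) ^+ k]big_ord_recr /= q'M.
rewrite /power_sum; under [X in _ = _ - X - _ - _]eq_bigr do rewrite /bump /= add1n.
set s1 := \sum_(_ < _) _; set s2 := \sum_(_ < _) _; set s3 := \sum_(_ < _) _.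
set s4 := \sum_(_ < _) _; set s5 := \sum_(_ < _) _; set t := X a _ ^+ k.
rewrite !opprD !opprK !addrA.
rewrite (addrAC _ (- t) (- s2)) (addrAC _ (- s3) (- s2)) addrK.
rewrite (addrAC _ (- s3) s5) (addrAC _ (- t) s5) addrNK.
by rewrite (addrAC _ (- s3) s4) (addrAC _ (- t) s4) addrNK addrAC.
Qed.

Lemma left_step_le N : (0 < N)%N -> (0 < M N)%N -> a / (M N)%:R <= 2 * (b / N%:R).
Proof.
move=> N0 M0; have [h1 h2] := left_cells_itv N0.
have Mp : 0 < (M N)%:R :> R by rewrite ltr0n.
have r0 : 0 <= b / N%:R by rewrite divr_ge0// ltW.
rewrite ler_pdivrMr//; apply: le_trans (ltW h2) _.
rewrite [leRHS]mulrAC ler_wpM2r// mulr_natl mulr2n -natr1 lerD2l.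
by rewrite ler1n.
Qed.

Lemma right_limit k : (0 < k)%N ->
  vanish (fun n => nrm (power_sum k (right_points n.+1) (n.+1 - M n.+1) - (Delta k 0 b - Delta k 0 a))).
Proof.
move=> k0; have [C C0 hC] := cut_sum_small (ltW b0) k0.
pose u n := C * (4 * (b ^+ 2 / n.+1%:R)).
have hu : vanish u.
  apply: vanishZ => //; apply: vanishZ => //; exact: vanish_inv.
have hE : vanish (fun n => u n + Num.sqrt (u n)) by apply: vanishD => //; exact: vanish_sqrt.
have hN : vanish (fun n => nrm (power_sum k (q n.+1) n.+1 - Delta k 0 b)).
  have := vanish_shift 1 (Delta_even k0 (ltW b0)).
  by apply: vanish_lew => n; rewrite addn1.
have hM : vanish (fun n => nrm (power_sum k (q' n.+1) (M n.+1) - Delta k 0 a)).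
  have large K : exists N, forall n, (N <= n)%N -> (K <= M n.+1)%N.
    by have [N hK] := left_cells_large K; exists N => n hn; apply: hK; exact: leq_trans hn _.
  exact: (vanish_comp large (Delta_even k0 (ltW a0))).
apply: vanish_le (vanishD (vanishD hN hM) (vanishD hE hE)).
have [N0 hN0] := left_cells_large 1.
exists N0 => n hn; have Mp : (0 < M n.+1)%N by apply: hN0; exact: leq_trans hn _.
have np : 0 < n.+1%:R :> R by rewrite ltr0n.
have MN := left_cells_lt (isT : 0 < n.+1)%N.
have hsq (l : nat) (h : R) : (l <= n.+1)%N -> 0 <= h -> h <= 2 * (b / n.+1%:R) -> l%:R * h ^+ 2 <= 4 * (b ^+ 2 / n.+1%:R).
  move=> ln h0 hh; apply: (@le_trans _ _ (n.+1%:R * (2 * (b / n.+1%:R)) ^+ 2)).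
    apply: ler_pM; rewrite ?sqr_ge0 ?ler_nat//.
    by rewrite lerXn2r// nnegrE// (le_trans h0).
  by rewrite le_eqVlt; apply/orP; left; apply/eqP; field; rewrite gt_eqF.
have r0 : 0 <= b / n.+1%:R by rewrite divr_ge0// ltW.
have subq := even_subdivision (ltW b0) (isT : 0 < n.+1)%N.
have subq' := even_subdivision (ltW a0) Mp.
have e1 := hC (q n.+1) (q' n.+1) (M n.+1).+1 (b / n.+1%:R).
have e2 := hC (q' n.+1) (fun i => q n.+1 i.+1) (M n.+1) (a / (M n.+1)%:R).
have {}e1 : nrm (\sum_(i < (M n.+1).+1) (X (q n.+1 i) (q n.+1 i.+1) ^+ k - X (q n.+1 i) (q' n.+1 i) ^+ k - X (q' n.+1 i) (q n.+1 i.+1) ^+ k)) <= u n + Num.sqrt (u n).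
  apply: le_trans (e1 _ _ _) _.
  - by rewrite /q /even_points !mul0r.
  - by have [_] := subdivision_le subq MN.
  - move=> i hi; have [h1 h2] := interleaved (isT : 0 < n.+1)%N Mp hi.
    by split => //; rewrite even_step.
  have h : C * ((M n.+1).+1%:R * (b / n.+1%:R) ^+ 2) <= u n by rewrite ler_wpM2l// hsq// ler_peMl// ler1n.
  by rewrite lerD// ler_wsqrtr.
have {}e2 : nrm (\sum_(i < M n.+1) (X (q' n.+1 i) (q' n.+1 i.+1) ^+ k - X (q' n.+1 i) (q n.+1 i.+1) ^+ k - X (q n.+1 i.+1) (q' n.+1 i.+1) ^+ k)) <= u n + Num.sqrt (u n).
  apply: le_trans (e2 _ _ _) _.
  - by rewrite /q' /even_points !mul0r.
  - by have [_] := subdivision_le subq' (leqnn _) => /le_trans; apply; exact: ltW.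
  - move=> i hi; have [_ h2] := interleaved (isT : 0 < n.+1)%N Mp (ltnW hi).
    have [h1 _] := interleaved (isT : 0 < n.+1)%N Mp hi.
    by split => //; rewrite even_step.
  have h : C * ((M n.+1)%:R * (a / (M n.+1)%:R) ^+ 2) <= u n.
    rewrite ler_wpM2l// hsq//; [exact: ltnW|by rewrite divr_ge0// ltW|exact: left_step_le].
  by rewrite lerD// ler_wsqrtr.
(* Passing between the two subdivisions cuts cells in two, at the cost of E1
   and E2. *)
have id := interleaved_identity k0 (isT : 0 < n.+1)%N Mp.
set S := power_sum k (right_points _) _ in id *.
set S1 := power_sum k (q _) _ in id *; set S2 := power_sum k (q' _) _ in id *.
set E1 := \sum_(_ < _) _ in id e1; set E2 := \sum_(_ < _) _ in id e2.
have -> : S - (Delta k 0 b - Delta k 0 a) =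
   (S1 - Delta k 0 b) - (S2 - Delta k 0 a) - (E1 - E2).
  rewrite -id; set d1 := Delta _ _ b; set d2 := Delta _ _ a.
  rewrite !opprD !opprK !addrA.
  rewrite (addrAC _ d2 (- S1)) (addrAC _ (- S2) (- S1)) (addrAC _ (- d1) (- S1)) subrr add0r.
  by rewrite (addrAC _ d2 S2) addrNK [RHS]addrC addrA.
apply: le_trans (nrmB _ _) _; rewrite lerD//.
  by apply: le_trans (nrmB _ _) _.
by apply: le_trans (nrmB _ _) _; rewrite lerD.
Qed.

End Interleave.

(** One sequence of subdivisions serves all k, because the formula involves
    all the diagonal measures at once. *)
Definition fine_cells (a b : R) (pi : nat -> nat -> R) (sz : nat -> nat) (h : nat -> R) : Prop :=
  [/\ vanish h /\ (forall N, 0 <= h N), forall N, subdivision a b (pi N) (sz N),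
      forall N i, (i < sz N)%N -> pi N i.+1 - pi N i <= h N &
      forall k, (0 < k)%N ->
        vanish (fun N => nrm (power_sum k (pi N) (sz N) - (Delta k 0 b - Delta k 0 a)))].

(** The diagonal measures of [0, a) and [0, b) are limits along the even
    subdivisions of these intervals; interleaving the two gives their
    difference as a limit along subdivisions of [a, b). *)
Lemma fine_cells_ex a b : 0 <= a -> a <= b -> exists pi sz h, fine_cells a b pi sz h.
Proof.
move=> a0 ab; have b0 := le_trans a0 ab.
have [<-|anb] := eqVneq a b.
  exists (fun _ _ => a), (fun=> 0%N), (fun=> 0); split => //; first by split => //; exact: vanish0.
  move=> k k0; apply: vanish_lew (@vanish0 R) => N.
  by rewrite /power_sum big_ord0 subrr subrr nrm0.
have [a00|an0] := eqVneq a 0.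
  rewrite a00; exists (fun N => even_points b N.+1), (fun N => N.+1), (fun N => b / N.+1%:R).
  split; first by split; [exact: vanish_inv|move=> N; rewrite divr_ge0].
  - by move=> N; exact: even_subdivision.
  - by move=> N i _; rewrite even_step.
  move=> k k0; apply: vanish_lew (vanish_shift 1 (Delta_even k0 b0)) => N; rewrite addn1.
  rewrite opprB addrCA addrC; apply: le_trans (nrmD _ _) _.
  by rewrite nrm_Delta_empty// addr0.
have ap : 0 < a by rewrite lt_def an0.
have altb : a < b by rewrite lt_def eq_sym anb.
exists (fun N => right_points a b N.+1), (fun N => (N.+1 - left_cells a b N.+1)%N), (fun N => b / N.+1%:R).
split; first by split; [exact: vanish_inv|move=> N; rewrite divr_ge0].
- by move=> N; exact: right_subdivision.
- by move=> N i hi; exact: right_mesh.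
- by move=> k k0; exact: right_limit.
Qed.

End DiagonalMeasures.

(** * The isometry for step biprocesses *)

Section Isometry.
Context (R : realType) (A : tracialVNA R).
Context (At : R -> set A) (X : R -> R -> A) (m : nat -> R -> R) (kap : nat -> R).
Hypothesis hX : free_increments At X m kap.
Context (Delta : nat -> R -> R -> A).
Hypothesis hD : diagonal_measures X Delta.

Lemma sqrtrD_le (x y : R) : 0 <= x -> 0 <= y -> Num.sqrt (x + y) <= Num.sqrt x + Num.sqrt y.
Proof.
move=> x0 y0; rewrite -(ler_pXn2r (n := 2)) ?nnegrE ?addr_ge0 ?sqrtr_ge0//.
rewrite sqr_sqrtr ?addr_ge0// sqrrD !sqr_sqrtr// addrAC lerDl.
by rewrite mulrn_wge0// mulr_ge0 ?sqrtr_ge0.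
Qed.

Lemma subdivision_length (a b : R) pi n : subdivision a b pi n ->
  \sum_(i < n) (pi i.+1 - pi i) = b - a.
Proof.
case=> <- <- _; elim: n => [|n IH]; first by rewrite big_ord0 subrr.
by rewrite big_ord_recr /= IH addrC addrA subrK.
Qed.

Definition increment (k : nat) (a b : R) : A := Delta k 0 b - Delta k 0 a.

Lemma moment_sum_order n T : (0 < n)%N -> exists2 C, 0 <= C & forall a b pi sz h,
  0 <= a -> b <= T -> subdivision a b pi sz ->
  (forall i, (i < sz)%N -> pi i.+1 - pi i <= h) ->
  `|\sum_(j < sz) m n (pi j.+1 - pi j) - kap n * (b - a)| <= C * h * (b - a).
Proof.
move=> n0; have [C C0 hC] := fi_mom hX T n0.
exists C => // a b pi sz h a0 bT sub hh.
rewrite -(subdivision_length sub) mulr_sumr -sumrB.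
apply: le_trans (ler_norm_sum _ _ _) _; rewrite mulr_sumr; apply: ler_sum => i _.
have [lo _] := subdivision_le sub (ltnW (ltn_ord i)); have [_ up] := subdivision_le sub (ltn_ord i).
have d0 : 0 <= pi i.+1 - pi i by rewrite subr_ge0; case: sub => _ _; apply.
apply: le_trans (hC _ d0 _) _; first by have := le_trans a0 lo; lra.
by rewrite expr2 -mulrA ler_wpM2l// ler_wpM2r// hh.
Qed.

(** On a fine subdivision each cell contributes V i acting on a k-th power
    of an increment. Its centered part has orthogonal values on different
    cells and a norm given by the moment of order 2k, and its mean is the
    moment of order k; in the limit only the first orders of the moments
    remain. *)
Lemma step_integral_bound k (tau : nat -> R) n (V : nat -> tpow 2 A) : (0 < k)%N ->
  0 <= tau 0%N -> (forall i, (i < n)%N -> tau i <= tau i.+1) ->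
  (forall i, (i < n)%N -> adapted_at At (tau i) (V i)) ->
  nrm (\sum_(i < n) act (V i) (increment k (tau i) (tau i.+1))) <=
    Num.sqrt (`|kap (k * 2)%N| * \sum_(i < n) (tau i.+1 - tau i) * tnorm2 (V i) ^+ 2) +
    `|kap k| * nrm (\sum_(i < n) (tau i.+1 - tau i)%:C *: tmul (V i)).
Proof.
move=> k0 t0 mono hV.
have sub : subdivision (tau 0%N) (tau n) tau n by [].
have tge i : (i <= n)%N -> 0 <= tau i /\ tau i <= tau n.
  by move=> /(subdivision_le sub)[h1 h2]; split => //; exact: le_trans h1.
have cells (i : nat) : exists c : (nat -> nat -> R) * (nat -> nat) * (nat -> R),
    (i < n)%N -> fine_cells X Delta (tau i) (tau i.+1) c.1.1 c.1.2 c.2.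
  have [hi|hi] := ltnP i n; last by exists ((fun _ _ => 0), (fun=> 0%N), (fun=> 0)).
  have [pi [sz [h H]]] := fine_cells_ex hX hD (tge i (ltnW hi)).1 (mono i hi).
  by exists (pi, sz, h).
have [c hc] := boolp.choice cells.
pose pi i := (c i).1.1; pose sz i := (c i).1.2; pose h i := (c i).2.
have hf i : (i < n)%N -> fine_cells X Delta (tau i) (tau i.+1) (pi i) (sz i) (h i) by exact: hc.
pose d i := tau i.+1 - tau i.
pose S N := \sum_(i < n) act (V i) (power_sum X k (pi i N) (sz i N)).
pose mart N := \sum_(i < n) \sum_(j < sz i N) act (V i) (centered (X (pi i N j) (pi i N j.+1) ^+ k)).
pose mk i N := \sum_(j < sz i N) m k (pi i N j.+1 - pi i N j).
pose m2k i N := \sum_(j < sz i N) m (k * 2) (pi i N j.+1 - pi i N j).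
have d0 i : (i < n)%N -> 0 <= d i by move=> hi; rewrite subr_ge0 mono.
have SE N : S N = mart N + \sum_(i < n) (mk i N)%:C *: tmul (V i).
  rewrite /S /mart -big_split; apply: eq_bigr => i _ /=.
  rewrite /power_sum act_sumr /mk rmorph_sum scaler_suml -big_split.
  apply: eq_bigr => j _ /=.
  have [_ subN _ _] := hf i (ltn_ord i); have sN := subN N.
  have [lo _] := subdivision_le sN (ltnW (ltn_ord j)).
  have [ti _] := tge i (ltnW (ltn_ord i)).
  apply: (act_power_split hX); first exact: le_trans lo.
  by case: sN => _ _; apply.
have martB N : nrm (mart N) <= Num.sqrt (\sum_(i < n) m2k i N * tnorm2 (V i) ^+ 2).
  have bl i : (i < n)%N -> block At (tau i) (tau i.+1)
      (\sum_(j < sz i N) act (V i) (centered (X (pi i N j) (pi i N j.+1) ^+ k)))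
      0 (m2k i N * tnorm2 (V i) ^+ 2).
    move=> hi; have [_ subN _ _] := hf i hi; have sN := subN N.
    have [ti _] := tge i (ltnW hi).
    have mN j : (j < sz i N)%N -> pi i N j <= pi i N j.+1 by case: sN => _ _; apply.
    have bj j : (j < sz i N)%N -> block At (pi i N j) (pi i N j.+1)
        (act (V i) (centered (X (pi i N j) (pi i N j.+1) ^+ k))) 0
        (m (k * 2) (pi i N j.+1 - pi i N j) * tnorm2 (V i) ^+ 2).
      move=> hj; have [lo _] := subdivision_le sN (ltnW hj).
      have p0 := le_trans ti lo.
      have := small_incr_block hX p0 (small_incr_act_centered hX p0 (mN j hj)
        (adapted_at_mono hX ti lo (hV i hi)) k).
      rewrite exprMn sqr_sqrtr//.
      by rewrite -(nrm_Xn_sqr hX) ?mN// sqr_ge0.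
    have pi0 : pi i N 0%N = tau i by case: sN.
    have pin : pi i N (sz i N) = tau i.+1 by case: sN.
    have [] := block_sum hX _ mN bj; first by rewrite pi0.
    by rewrite pi0 pin -mulr_suml big1_eq.
  have [B _] := block_sum hX t0 mono bl.
  by have := block_nrm hX t0 B; rewrite big1_eq add0r.
have [C1 C10 hC1] := moment_sum_order (tau n) k0.
have k20 : (0 < k * 2)%N by rewrite muln_gt0 k0.
have [C2 C20 hC2] := moment_sum_order (tau n) k20.
pose G := \sum_(i < n) d i * tnorm2 (V i) ^+ 2.
have G0 : 0 <= G by apply: sumr_ge0 => i _; rewrite mulr_ge0 ?sqr_ge0// d0.
pose e1 N := \sum_(i < n) C2 * d i * tnorm2 (V i) ^+ 2 * h i N.
pose e2 N := \sum_(i < n) C1 * d i * nrm (tmul (V i)) * h i N.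
have hv i : (i < n)%N -> vanish (h i) by move=> hi; have [[]] := hf i hi.
have h0 i N : (i < n)%N -> 0 <= h i N by move=> hi; have [[]] := hf i hi.
have ve1 : vanish e1.
  apply: (vanish_sum (f := fun i N => C2 * d i * tnorm2 (V i) ^+ 2 * h i N)) => i hi.
  apply: vanishZ; last exact: hv.
  by rewrite mulr_ge0 ?sqr_ge0// mulr_ge0//; exact: d0.
have ve2 : vanish e2.
  apply: (vanish_sum (f := fun i N => C1 * d i * nrm (tmul (V i)) * h i N)) => i hi.
  apply: vanishZ; last exact: hv.
  by rewrite mulr_ge0 ?nrm_ge0// mulr_ge0//; exact: d0.
have e10 N : 0 <= e1 N.
  by apply: sumr_ge0 => i _; rewrite mulr_ge0 ?h0// mulr_ge0 ?sqr_ge0// mulr_ge0//; exact: d0.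
have tau0 i : (i < n)%N -> 0 <= tau i by move=> hi; have [] := tge i (ltnW hi).
have taun i : (i < n)%N -> tau i.+1 <= tau n by move=> hi; have [] := tge i.+1 hi.
have hm2 N i : (i < n)%N -> m2k i N <= `|kap (k * 2)%N| * d i + C2 * d i * h i N.
  move=> hi; have [_ subN mesh _] := hf i hi.
  have := hC2 _ _ _ _ _ (tau0 i hi) (taun i hi) (subN N) (mesh N).
  move=> /(le_trans (ler_norm _)); rewrite lerBlDl => /le_trans; apply.
  apply: lerD; first by rewrite ler_wpM2r ?ler_norm//; exact: d0.
  by rewrite -/(d i) mulrAC.
have bd1 N : nrm (mart N) <= Num.sqrt (`|kap (k * 2)%N| * G) + Num.sqrt (e1 N).
  apply: le_trans (martB N) _; apply: le_trans (sqrtrD_le _ _) => //; last by rewrite mulr_ge0.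
  apply: ler_wsqrtr; rewrite /G /e1 mulr_sumr -big_split; apply: ler_sum => i _ /=.
  apply: le_trans (ler_wpM2r (sqr_ge0 _) (hm2 N i (ltn_ord i))) _.
  by rewrite le_eqVlt; apply/orP; left; apply/eqP; ring.
have bd2 N : nrm (\sum_(i < n) (mk i N)%:C *: tmul (V i)) <=
    `|kap k| * nrm (\sum_(i < n) (d i)%:C *: tmul (V i)) + e2 N.
  have -> : \sum_(i < n) (mk i N)%:C *: tmul (V i) =
     (kap k)%:C *: (\sum_(i < n) (d i)%:C *: tmul (V i)) +
     \sum_(i < n) (mk i N - kap k * d i)%:C *: tmul (V i).
    rewrite scaler_sumr -big_split; apply: eq_bigr => i _ /=.
    by rewrite scalerA -scalerDl -rmorphM -rmorphD addrC subrK.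
  apply: le_trans (nrmD _ _) _; rewrite nrmZ normcR lerD2l.
  apply: le_trans (nrm_sum _ _ _) _; apply: ler_sum => i _; rewrite nrmZ normcR.
  have [_ subN mesh _] := hf i (ltn_ord i).
  have hh := hC1 _ _ _ _ _ (tau0 i (ltn_ord i)) (taun i (ltn_ord i)) (subN N) (mesh N).
  apply: le_trans (ler_wpM2r (nrm_ge0 _) hh) _.
  by rewrite le_eqVlt; apply/orP; left; apply/eqP; rewrite /d; ring.
have vS : vanish (fun N => nrm (\sum_(i < n) act (V i) (increment k (tau i) (tau i.+1)) - S N)).
  have hK i := act_bounded (V i).
  pose K i := projT1 (cid2 (hK i)).
  have hK' i : 0 <= K i /\ forall Z, nrm (act (V i) Z) <= K i * nrm Z.
    by rewrite /K; case: cid2.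
  apply: (@vanish_lew _ _ (fun N => \sum_(i < n) K i *
     nrm (power_sum X k (pi i N) (sz i N) - increment k (tau i) (tau i.+1)))).
    move=> N; rewrite /S -sumrB; apply: le_trans (nrm_sum _ _ _) _; apply: ler_sum => i _.
    by rewrite -actBr (nrmBC (power_sum _ _ _ _)); exact: (hK' i).2.
  apply: (vanish_sum (f := fun i N => K i * nrm (power_sum X k (pi i N) (sz i N) - increment k (tau i) (tau i.+1)))) => i hi.
  apply: vanishZ; first exact: (hK' i).1.
  by have [_ _ _ hlim] := hf i hi; exact: hlim.
apply: (vanish_bound (vanishD vS (vanishD (vanish_sqrt ve1) ve2))); exists 0%N => N _.
set J := \sum_(i < n) act _ _ in vS *.
have -> : nrm J = nrm ((J - S N) + S N) by rewrite subrK.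
apply: le_trans (nrmD _ _) _; rewrite [X in _ + nrm X]SE.
have := nrmD (mart N) (\sum_(i < n) (mk i N)%:C *: tmul (V i)).
have := bd1 N; have := bd2 N; rewrite /d -/G.
set x1 := nrm (\sum_(i < n) (mk i N)%:C *: _); set x2 := nrm (\sum_(i < n) _ *: _).
set x3 := nrm (mart N); set x4 := nrm (_ + _); set x5 := nrm (J - _).
lra.
Qed.

End Isometry.

(** * Expansion in words *)

Section Compositions.

(** The sequences of k + 1 exponents with sum n - k, listed by their first
    entry. *)
Fixpoint comps (k n : nat) : seq (seq nat) :=
  if k is k'.+1 then flatten [seq [seq j :: c | c <- comps k' (n - j.+1)] | j <- iota 0 n]
  else [:: [:: n]].

Lemma mem_comps k n c : (c \in comps k n) = (size c == k.+1) && (sumn c + k == n)%N.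
Proof.
elim: k n c => [|k IH] n c /=.
  rewrite inE addn0; apply/eqP/andP => [->|[]]; first by rewrite /= addn0 !eqxx.
  by case: c => [//|x [|//]] _ /eqP; rewrite /= addn0 => ->.
apply/flatten_mapP/andP => [[j]|[]].
  rewrite mem_iota add0n => /andP[_ jn] /mapP[c']; rewrite IH => /andP[/eqP sc /eqP sm] ->.
  by rewrite /= sc eqxx; split => //; apply/eqP; lia.
case: c => [//|j c] /=; rewrite eqSS => /eqP sc /eqP sm.
exists j; first by rewrite mem_iota add0n; lia.
by apply/mapP; exists c => //; rewrite IH sc eqxx; apply/eqP; lia.
Qed.

Lemma comps_uniq k n : uniq (comps k n).
Proof.
elim: k n => [|k IH] n //=.
elim: (iota 0 n) (iota_uniq 0 n) => [//|j s IHs] /= /andP[js us].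
rewrite cat_uniq IHs// andbT map_inj_uniq ?IH//=; last by move=> x y [].
apply/hasPn => c /flatten_mapP[j' js' /mapP[c' _ ->]].
by apply/mapP => -[c'' _ [jj _]]; move: js; rewrite -jj js'.
Qed.

Lemma comps_size k n c : c \in comps k n -> size c = k.+1.
Proof. by rewrite mem_comps => /andP[/eqP]. Qed.

Lemma comps_nil k n : (n < k)%N -> comps k n = [::].
Proof.
move=> nk; case E : (comps k n) => [//|c s].
have : c \in comps k n by rewrite E mem_head.
by rewrite mem_comps => /andP[_ /eqP]; lia.
Qed.

Definition exponents k n (i : {ffun 'I_k.+1 -> 'I_n.+1}) : seq nat :=
  [seq nat_of_ord (i j) | j <- enum 'I_k.+1].

Lemma size_exponents k n (i : {ffun 'I_k.+1 -> 'I_n.+1}) : size (exponents i) = k.+1.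
Proof. by rewrite size_map size_enum_ord. Qed.

Lemma nth_exponents k n (i : {ffun 'I_k.+1 -> 'I_n.+1}) (j : 'I_k.+1) : nth 0%N (exponents i) j = i j.
Proof. by rewrite /exponents (nth_map ord0) ?size_enum_ord// nth_ord_enum. Qed.

Lemma exponents_inj k n : injective (@exponents k n).
Proof.
move=> i i' h; apply/ffunP => j; apply/val_inj => /=.
by rewrite -!nth_exponents h.
Qed.

Lemma sumn_exponents k n (i : {ffun 'I_k.+1 -> 'I_n.+1}) : sumn (exponents i) = (\sum_j i j)%N.
Proof. by rewrite /exponents sumnE big_map big_enum. Qed.

Lemma sum_comps (V : nmodType) k n (H : seq nat -> V) :
  \sum_(i : {ffun 'I_k.+1 -> 'I_n.+1} | (\sum_j i j + k == n)%N) H (exponents i) =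
  \sum_(c <- comps k n) H c.
Proof.
pose P := [pred i : {ffun 'I_k.+1 -> 'I_n.+1} | (\sum_j i j + k == n)%N].
have -> : \sum_(i | P i) H (exponents i) = \sum_(i <- enum P) H (exponents i) by rewrite big_enum.
rewrite -(big_map (@exponents k n) xpredT H).
apply: perm_big; apply: uniq_perm.
- by rewrite map_inj_uniq ?enum_uniq//; exact: exponents_inj.
- exact: comps_uniq.
move=> c; apply/mapP/idP => [[i0]|].
  by rewrite mem_enum inE => h ->; rewrite mem_comps size_exponents eqxx sumn_exponents.
rewrite mem_comps => /andP[/eqP sc /eqP sm].
have cn j : (nth 0%N c j < n.+1)%N.
  have [jc|jc] := ltnP j (size c); last by rewrite nth_default.
  rewrite ltnS -sm; apply: leq_trans (leq_addr k _).
  elim: (c) j jc => [//|x c' IHc] [|j] /= hj; first by rewrite leq_addr.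
  by apply: leq_trans (IHc j hj) _; rewrite leq_addl.
have e : exponents [ffun j : 'I_k.+1 => inord (nth 0%N c j) : 'I_n.+1] = c.
  apply: (@eq_from_nth _ 0%N); first by rewrite size_exponents sc.
  move=> j; rewrite size_exponents => jk.
  by rewrite -[j]/(nat_of_ord (Ordinal jk)) nth_exponents ffunE inordK.
exists [ffun j : 'I_k.+1 => inord (nth 0%N c j) : 'I_n.+1]; last by rewrite e.
by rewrite mem_enum inE -sumn_exponents e sm.
Qed.

End Compositions.

Section WordExpansion.
Context (R : realType) (A : tracialVNA R).
Implicit Types (M y h l : A) (qs es : seq (A * A)) (c : seq nat).

Fixpoint lists (T : Type) (k : nat) (s : seq T) : seq (seq T) :=
  if k is k'.+1 then [seq q :: z | q <- s, z <- lists k' s] else [:: [::]].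

Lemma lists_size (T : eqType) k (s es : seq T) : es \in lists k s -> size es = k.
Proof.
elim: k es => [|k IH] es /=; first by rewrite inE => /eqP ->.
by move=> /allpairsP[[q es'] /= [_ /IH h ->]] /=; rewrite h.
Qed.

Lemma lists_mem (T : eqType) k (s es : seq T) : es \in lists k s -> {subset es <= s}.
Proof.
elim: k es => [|k IH] es /=; first by rewrite inE => /eqP ->.
move=> /allpairsP[[q es'] /= [qs /IH h ->]] x; rewrite inE => /orP[/eqP ->//|].
exact: h.
Qed.

Lemma big_lists (V : nmodType) (T : Type) k (s : seq T) (F : seq T -> V) :
  \sum_(z <- lists k.+1 s) F z = \sum_(q <- s) \sum_(z <- lists k s) F (q :: z).
Proof. by rewrite /= big_allpairs_dep. Qed.

(** The factors between the occurrences of y in the expansion of (M + h)^n,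
    h a sum of terms e.1 y e.2. *)
Fixpoint gaps M l c es : seq A :=
  match c, es with
  | i :: c', e :: es' => l * M ^+ i * e.1 :: gaps M e.2 c' es'
  | i :: _, [::] => [:: l * M ^+ i * 1]
  | [::], _ => [::]
  end.

Lemma size_gaps M l c es : size c = (size es).+1 -> size (gaps M l c es) = (size es).+1.
Proof. by elim: es l c => [|e es IH] l [|i c] //= [h]; rewrite IH. Qed.

Definition gap_word y (g : seq A) : A := word y (head 0 g) (behead g).

Lemma gap_word_cons y b g : g != [::] -> gap_word y (b :: g) = b * y * gap_word y g.
Proof. by case: g. Qed.

Definition words M y qs l k n : A :=
  \sum_(c <- comps k n) \sum_(es <- lists k qs) gap_word y (gaps M l c es).

Lemma words0 M y qs l n : words M y qs l 0 n = l * M ^+ n.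
Proof. by rewrite /words /= !big_seq1 /= /gap_word /= mulr1. Qed.

Lemma words_rec M y qs l k n : words M y qs l k.+1 n =
  \sum_(0 <= j < n) \sum_(q <- qs) l * M ^+ j * q.1 * y * words M y qs q.2 k (n - j.+1).
Proof.
rewrite /words /= big_flatten /= big_map /index_iota subn0; apply: eq_bigr => j _.
rewrite big_map; under eq_bigr do rewrite big_lists.
rewrite exchange_big; apply: eq_bigr => q _ /=.
rewrite mulr_sumr big_seq [RHS]big_seq; apply: eq_bigr => c /comps_size sc.
rewrite mulr_sumr big_seq [RHS]big_seq; apply: eq_bigr => es /lists_size se.
rewrite gap_word_cons//.
by rewrite -size_eq0 size_gaps ?sc ?se.
Qed.

Lemma words_left M y qs l k n : words M y qs l k n = l * words M y qs 1 k n.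
Proof.
case: k => [|k]; first by rewrite !words0 mul1r.
rewrite !words_rec mulr_sumr; apply: eq_bigr => j _; rewrite mulr_sumr; apply: eq_bigr => q _.
by rewrite mul1r !mulrA.
Qed.

Lemma power_telescope M h n :
  (M + h) ^+ n = M ^+ n + \sum_(0 <= j < n) M ^+ j * h * (M + h) ^+ (n - j.+1).
Proof.
elim: n => [|n IH]; first by rewrite big_geq// addr0 !expr0.
rewrite [LHS]exprS mulrDl {1}IH mulrDr -exprS big_nat_recl//= expr0 mul1r subn1 /=.
rewrite mulr_sumr -addrA; congr (_ + _); rewrite addrC; congr (_ + _).
by apply: eq_bigr => j _; rewrite subSS [M ^+ j.+1]exprS !mulrA.
Qed.

(** Expanding at the first occurrence of a letter (power_telescope) is a
    recursion on the number of letters. *)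
Lemma word_expansion M y qs n :
  (M + \sum_(q <- qs) q.1 * y * q.2) ^+ n = \sum_(0 <= k < n.+1) words M y qs 1 k n.
Proof.
set h := \sum_(q <- qs) _.
elim/ltn_ind: n => n IH; rewrite power_telescope big_nat_recl// words0 mul1r; congr (_ + _).
under [RHS]eq_bigr do rewrite words_rec.
rewrite exchange_big /=; apply: eq_big_nat => j /andP[_ jn].
rewrite IH; last by lia.
rewrite [LHS]mulr_sumr /h; under [LHS]eq_bigr => k _ do rewrite [M ^+ j * _]mulr_sumr mulr_suml.
rewrite (big_cat_nat _ (n := (n - j.+1).+1) (p := n))//=; last by lia.
rewrite [X in _ = _ + X]big1_seq ?addr0; last first.
  move=> k /andP[_]; rewrite mem_index_iota => /andP[h1 _].
  by rewrite big1// => q _; rewrite /words comps_nil ?big_nil ?mulr0//; lia.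
apply: eq_bigr => k _; apply: eq_bigr => q _.
by rewrite [in RHS]words_left !mulrA mul1r.
Qed.

(** The inner gaps are replaced by their traces, as the map id (x) phi (x)
    ... (x) phi (x) id does. *)
Definition contraction (g : seq A) : tpow 2 A :=
  trace_gaps (head 0 (behead g)) (behead (behead g)) *: tens2 (head 0 g) (last 0 g).

(** The integrand of the formula in terms of a decomposition qs of the
    biprocess into pure tensors; integrand_formula is the identification. *)
Definition contracted_derivative (p : {poly R[i]}) k M qs : tpow 2 A :=
  \sum_(n < size p) p`_n *: \sum_(c <- comps k n) \sum_(es <- lists k qs) contraction (gaps M 1 c es).

Lemma poly_increment (p : {poly R[i]}) M y qs K : (size p <= K)%N ->
  horner_alg (M + \sum_(q <- qs) q.1 * y * q.2) p - horner_alg M p =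
  \sum_(k < K) \sum_(n < size p) p`_n *: words M y qs 1 k.+1 n.
Proof.
move=> pK; rewrite exchange_big /=.
have hE a : horner_alg a p = \sum_(n < size p) p`_n *: a ^+ n.
  by rewrite /horner_alg /horner_morph /= /map_poly horner_poly; apply: eq_bigr => n _; rewrite -scalerAl mul1r.
rewrite !hE -sumrB; apply: eq_bigr => n _.
rewrite -scalerBr -scaler_sumr word_expansion big_nat_recl// words0 mul1r addrAC subrr add0r.
congr (_ *: _); rewrite -(big_mkord xpredT (fun k => words M y qs 1 k.+1 n)).
rewrite [RHS](big_cat_nat _ (n := n))//=; last by apply: leq_trans (ltnW (ltn_ord n)) _.
rewrite [X in _ = _ + X]big1_seq ?addr0// => k /andP[_]; rewrite mem_index_iota => /andP[h1 _].
by rewrite /words comps_nil ?big_nil//.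
Qed.

End WordExpansion.

(** * The integrand as a sum over words *)

Section IntegrandFormula.
Context (R : realType) (A : tracialVNA R).
Local Notation C := R[i].
Implicit Types (M : A) (qs es : seq (A * A)).

Definition pair_ffun (q : A * A) : {ffun 'I_2 -> A} := [ffun i : 'I_2 => if i == ord0 then q.1 else q.2].

Definition pair_args k es : 'I_k -> {ffun 'I_2 -> A} := fun j => pair_ffun (nth (0, 0) es j).

Definition multi_multilinear (W : lmodType C) k (F : ('I_k -> {ffun 'I_2 -> A}) -> W) : Prop :=
  forall (j : 'I_k) v, multilinear (fun x => F (fun i => if i == j then x else v i)).

Lemma fcons_args k q es : fcons (pair_ffun q) (@pair_args k es) = @pair_args k.+1 (q :: es).
Proof.
apply: funext => i; rewrite /fcons /pair_args.
by case: unliftP => [j ->|->] //=; rewrite lift0.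
Qed.

Lemma tlift_sum (W : lmodType C) n (V : lmodType C) (f : {ffun 'I_n -> V} -> W) (I : Type) (r : seq I)
  (P : pred I) (F : I -> tpow n V) : multilinear f ->
  tlift f (\sum_(i <- r | P i) F i) = \sum_(i <- r | P i) tlift f (F i).
Proof.
move=> mf; apply: (big_morph (tlift f)) => [x y|]; last exact: (tlift_zero mf).
by have := tlift_linear mf 1 x y; rewrite !scale1r.
Qed.

Lemma tliftZ (W : lmodType C) n (V : lmodType C) (f : {ffun 'I_n -> V} -> W) c (x : tpow n V) :
  multilinear f -> tlift f (c *: x) = c *: tlift f x.
Proof.
move=> mf; have := tlift_linear mf c x 0; rewrite !addr0 => ->.
by rewrite [tlift f 0](tlift_zero mf) addr0.
Qed.

Lemma multilinear_sum (W : lmodType C) n (V : lmodType C) (I : Type) (r : seq I)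
    (f : I -> {ffun 'I_n -> V} -> W) : (forall i, multilinear (f i)) ->
  multilinear (fun v => \sum_(i <- r) f i v).
Proof.
move=> hf v j c x y; rewrite scaler_sumr -big_split; apply: eq_bigr => i _ /=; exact: hf.
Qed.

(** One argument at a time, as in the definition of mlift. *)
Lemma mlift_tsum (W : lmodType C) k (F : ('I_k -> {ffun 'I_2 -> A}) -> W) qs :
  multi_multilinear F -> mlift F (fun=> tsum qs) = \sum_(es <- lists k qs) F (pair_args es).
Proof.
elim: k F => [|k IH] F hF /=.
  by rewrite big_seq1; congr F; apply: funext => -[].
have hFx x : multi_multilinear (fun v => F (fcons x v)).
  move=> j v w i c p q.
  have e z : fcons x (fun i0 : 'I_k => if i0 == j then z else v i0) =
      (fun i0 : 'I_k.+1 => if i0 == lift ord0 j then z else fcons x v i0).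
    apply: funext => i0; rewrite /fcons; case: unliftP => [j'|] ->.
      by rewrite (inj_eq lift_inj).
    by rewrite (negPf (neq_lift _ _)).
  by rewrite !e; exact: hF.
have -> : (fun x => mlift (fun v => F (fcons x v)) (fun=> tsum qs)) =
    (fun x => \sum_(es <- lists k qs) F (fcons x (pair_args es))).
  by apply: funext => x; exact: IH.
have hm : multilinear (fun x => \sum_(es <- lists k qs) F (fcons x (pair_args es))).
  apply: multilinear_sum => es v i c p q.
  have e z : fcons z (@pair_args k es) = (fun i0 : 'I_k.+1 => if i0 == ord0 then z else fcons z (@pair_args k es) i0).
    by apply: funext => i0; rewrite /fcons; case: unliftP => [j'|] ->; rewrite ?eqxx.
  have e' z z' : (fun i0 : 'I_k.+1 => if i0 == ord0 then z else fcons z (@pair_args k es) i0) =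
     (fun i0 : 'I_k.+1 => if i0 == ord0 then z else fcons z' (@pair_args k es) i0).
    by apply: funext => i0; rewrite /fcons; case: unliftP => [j'|] ->; rewrite ?eqxx.
  have hz z : fcons z (@pair_args k es) = (fun i0 : 'I_k.+1 => if i0 == ord0 then z else fcons (pair_ffun (0,0)) (@pair_args k es) i0).
    by rewrite e (e' z (pair_ffun (0,0))).
  by rewrite (hz (upd v i (c *: p + q))) (hz (upd v i p)) (hz (upd v i q)); exact: hF.
rewrite /tsum tlift_sum// -/(lists k.+1 qs) big_lists; apply: eq_bigr => q _.
rewrite tlift_tens//; apply: eq_bigr => es _; rewrite -fcons_args; congr (F (fcons _ _)).
Qed.

Lemma slot_multi k (a : {ffun 'I_k.+1 -> A}) :
  multi_multilinear (fun v => tens (finfun (slot a v))).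
Proof.
move=> j v x i c p q.
have [->|->] := ord2_cases i.
- pose s0 := finfun (slot a (fun i0 => if i0 == j then x else v i0)).
  pose L := (if unlift ord0 (lift ord_max j) is Some j' then (if j' == j then x else v j') ord_max else 1) * a (lift ord_max j).
  have e z : finfun (slot a (fun i0 : 'I_k => if i0 == j then upd x ord0 z else v i0)) =
     upd s0 (lift ord_max j) (L * z).
    apply/ffunP => i0; rewrite !ffunE /slot; cbv beta.
    have hl : (if unlift ord0 i0 is Some j0 then (if j0 == j then upd x ord0 z else v j0) ord_max else 1) =
       (if unlift ord0 i0 is Some j0 then (if j0 == j then x else v j0) ord_max else 1).
      by case: unliftP => [j0 _|//]; case: eqP => // _; rewrite ffunE.
    rewrite hl; case: eqP => [->|/eqP ne].
      by rewrite liftK eqxx ffunE eqxx /L.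
    congr (_ * _).
    case: unliftP => [j0 ei|//]; case: eqP => // e0; by rewrite ei e0 eqxx in ne.
  by rewrite !e mulrDr -scalerAr tens_multilinear.
- pose s0 := finfun (slot a (fun i0 => if i0 == j then x else v i0)).
  pose r := a (lift ord0 j) * (if unlift ord_max (lift ord0 j) is Some j' then (if j' == j then x else v j') ord0 else 1).
  have e z : finfun (slot a (fun i0 : 'I_k => if i0 == j then upd x ord_max z else v i0)) =
     upd s0 (lift ord0 j) (z * r).
    apply/ffunP => i0; rewrite !ffunE /slot; cbv beta.
    have hr : (if unlift ord_max i0 is Some j0 then (if j0 == j then upd x ord_max z else v j0) ord0 else 1) =
       (if unlift ord_max i0 is Some j0 then (if j0 == j then x else v j0) ord0 else 1).
      by case: unliftP => [j0 _|//]; case: eqP => // _; rewrite ffunE.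
    rewrite hr; case: eqP => [->|/eqP ne].
      by rewrite liftK eqxx ffunE eqxx /r mulrA.
    congr (_ * _ * _).
    case: unliftP => [j0 ei|//]; case: eqP => // e0; by rewrite ei e0 eqxx in ne.
  by rewrite !e mulrDl -scalerAl tens_multilinear.
Qed.

Lemma slot_multilinear k (v : 'I_k -> {ffun 'I_2 -> A}) :
  multilinear (fun a => tens (finfun (slot a v))).
Proof.
move=> a i c x y.
pose L := (if unlift ord0 i is Some j then v j ord_max else 1).
pose r := (if unlift ord_max i is Some j then v j ord0 else 1).
have e z : finfun (slot (upd a i z) v) = upd (finfun (slot a v)) i (L * z * r).
  apply/ffunP => i0; rewrite !ffunE /slot ffunE; case: eqP => [->|//].
  by [].
by rewrite !e mulrDr mulrDl -scalerAr -scalerAl tens_multilinear.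
Qed.

Lemma phi_mid_multilinear k : multilinear (fun v : {ffun 'I_k.+2 -> A} =>
  (\prod_(i < k.+2 | (i != ord0) && (i != ord_max)) tr (v i)) *: tens2 (v ord0) (v ord_max)).
Proof.
move=> v i c x y.
have same z : (i == ord0) || (i == ord_max) ->
  \prod_(i0 < k.+2 | (i0 != ord0) && (i0 != ord_max)) tr (upd v i z i0) =
  \prod_(i0 < k.+2 | (i0 != ord0) && (i0 != ord_max)) tr (v i0).
  move=> hi; apply: eq_bigr => i0 /andP[h1 h2]; rewrite ffunE; case: eqP => // e.
  by move: hi; rewrite -e (negPf h1) (negPf h2).
have [i0|in0] := eqVneq i ord0.
  have h z := same z (_ : (i == ord0) || (i == ord_max)).
  rewrite !h ?i0 ?eqxx// !ffunE /= tens2_linl scalerDr !scalerA; congr (_ *: _ + _).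
  exact: mulrC.
have [im|inm] := eqVneq i ord_max.
  have h z := same z (_ : (i == ord0) || (i == ord_max)).
  rewrite !h ?im ?eqxx ?orbT// !ffunE !eqxx /= tens2_linr scalerDr !scalerA; congr (_ *: _ + _).
  exact: mulrC.
have pr z : \prod_(i0 < k.+2 | (i0 != ord0) && (i0 != ord_max)) tr (upd v i z i0) =
  tr z * \prod_(i0 < k.+2 | ((i0 != ord0) && (i0 != ord_max)) && (i0 != i)) tr (v i0).
  rewrite (bigD1 i) ?in0//= ffunE eqxx; congr (_ * _); apply: eq_bigr => j /andP[_ ji].
  by rewrite ffunE (negPf ji).
rewrite !pr !ffunE ![ord0 == i]eq_sym ![ord_max == i]eq_sym (negPf in0) (negPf inm).
by rewrite trD trZ mulrDl scalerDl scalerA mulrA.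
Qed.

Lemma nth_gaps M l (c : seq nat) es i : size c = (size es).+1 -> (i <= size es)%N ->
  nth 0 (gaps M l c es) i = (if i is i'.+1 then (nth (0, 0) es i').2 else l) * M ^+ nth 0%N c i *
     (if (i < size es)%N then (nth (0, 0) es i).1 else 1).
Proof.
elim: es l c i => [|e es IH] l [|j c] //= i [sc].
  by case: i.
by case: i => [|i] //= hi; rewrite IH//; case: i hi.
Qed.

Lemma trace_gaps_prod b (s : seq A) : trace_gaps b s = \prod_(i < size s) tr (nth 0 (b :: s) i).
Proof.
elim: s b => [|c s IH] b /=; first by rewrite big_ord0.
by rewrite big_ord_recl /= IH.
Qed.

Lemma prod_inner (f : nat -> C) k :
  \prod_(i < k.+2 | (i != ord0) && (i != ord_max)) f i = \prod_(i < k) f i.+1.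
Proof.
rewrite big_mkcond big_ord_recl big_ord_recr /=.
have -> : (lift ord0 (ord_max : 'I_k.+1) == ord_max :> 'I_k.+2) by apply/eqP/val_inj.
rewrite mul1r mulr1.
apply: eq_bigr => i _; rewrite /bump add1n.
have -> // : (lift ord0 (widen_ord (leqnSn k) i) != ord_max :> 'I_k.+2).
by rewrite -val_eqE /= /bump /= add1n eqSS neq_ltn ltn_ord.
Qed.

Lemma phi_mid_slots k M (i : seq nat) es (v : {ffun 'I_k.+2 -> A}) : size i = k.+2 -> size es = k.+1 ->
  (forall j : 'I_k.+2, v j = nth 0 (gaps M 1 i es) j) ->
  phi_mid tr (tens v) = contraction (gaps M 1 i es).
Proof.
move=> si se hv; rewrite /phi_mid tlift_tens; last exact: phi_mid_multilinear.
have sg : size (gaps M 1 i es) = k.+2 by rewrite size_gaps se// si.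
have -> : \prod_(j < k.+2 | (j != ord0) && (j != ord_max)) tr (v j) =
    \prod_(j < k.+2 | (j != ord0) && (j != ord_max)) tr (nth 0 (gaps M 1 i es) j).
  by apply: eq_bigr => j _; rewrite hv.
rewrite (prod_inner (fun j => tr (nth 0 (gaps M 1 i es) j))) /contraction !hv /=.
case E : (gaps M 1 i es) sg => [|b0 [|b1 s]] //= [ss].
rewrite trace_gaps_prod ss; congr (_ *: tens2 _ _).
by rewrite -ss -[RHS](nth_last 0 (b1 :: s)).
Qed.

Lemma slot_gaps k M n (i : {ffun 'I_k.+2 -> 'I_n.+1}) es (j : 'I_k.+2) : size es = k.+1 ->
  slot [ffun j => M ^+ i j] (@pair_args k.+1 es) j = nth 0 (gaps M 1 (exponents i) es) j.
Proof.
move=> se; rewrite nth_gaps ?size_exponents ?se//; last by rewrite -ltnS.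
rewrite /slot ffunE nth_exponents; congr (_ * _ * _).
  case: unliftP => [j' ->|->] //=.
  by rewrite /pair_args /pair_ffun ffunE.
case: unliftP => [j' ->|->]; last by rewrite /= ltnn.
by rewrite lift_max ltn_ord /pair_args /pair_ffun ffunE eqxx.
Qed.

Lemma sharp_m_tens k (a : {ffun 'I_k.+1 -> A}) qs :
  sharp_m (tens a) (fun=> tsum qs) = \sum_(es <- lists k qs) tens (finfun (slot a (pair_args es))).
Proof.
rewrite /sharp_m.
have -> : (fun a0 : {ffun 'I_k.+1 -> A} => mlift (fun v => tens (finfun (slot a0 v))) (fun=> tsum qs)) =
   (fun a0 => \sum_(es <- lists k qs) tens (finfun (slot a0 (pair_args es)))).
  by apply: funext => a0; apply: mlift_tsum; exact: slot_multi.
by rewrite tlift_tens//; apply: multilinear_sum => es; exact: slot_multilinear.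
Qed.

Lemma sharp_m_multilinear k qs : multilinear (fun a : {ffun 'I_k.+1 -> A} =>
   mlift (fun v => tens (finfun (slot a v))) (fun=> tsum qs)).
Proof.
have -> : (fun a0 : {ffun 'I_k.+1 -> A} => mlift (fun v => tens (finfun (slot a0 v))) (fun=> tsum qs)) =
   (fun a0 => \sum_(es <- lists k qs) tens (finfun (slot a0 (pair_args es)))).
  by apply: funext => a0; apply: mlift_tsum; exact: slot_multi.
by apply: multilinear_sum => es; exact: slot_multilinear.
Qed.

Lemma subst_multilinear k (a : A) :
  multilinear (fun v : {ffun 'I_k -> {poly C}} => tens [ffun j => horner_alg a (v j)]).
Proof.
move=> v i c x y.
have e z : [ffun j => horner_alg a (upd v i z j)] = upd [ffun j => horner_alg a (v j)] i (horner_alg a z).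
  by apply/ffunP => j; rewrite !ffunE; case: eqP.
rewrite !e linearD linearZ /= mulr_algl.
exact: tens_multilinear.
Qed.

(** All the maps involved are multilinear, so that it suffices to compare
    the terms of one monomial and one list of summands: there the slots of
    the right action are the gaps of the word, and the factor k! of the
    derivative cancels. *)
Lemma integrand_formula (p : {poly C}) k M qs :
  k.+1`!%:R^-1 *: phi_mid tr (sharp_m (subst M (dpoly k.+1 p)) (fun=> tsum qs)) =
  contracted_derivative p k.+1 M qs.
Proof.
have fne : (k.+1`!%:R : C) != 0 by rewrite pnatr_eq0 -lt0n fact_gt0.
have mph := @phi_mid_multilinear k.
have msh := @sharp_m_multilinear k.+1 qs.
have msu := @subst_multilinear k.+2 M.
rewrite /subst /tmap /dpoly tlift_sum//.
rewrite /sharp_m tlift_sum// /phi_mid tlift_sum// scaler_sumr.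
apply: eq_bigr => n _.
rewrite (tliftZ _ _ msu) (tliftZ _ _ msu) (tliftZ _ _ msh) (tliftZ _ _ msh) (tliftZ _ _ mph) (tliftZ _ _ mph).
rewrite !scalerA mulrCA mulVf// mulr1; congr (_ *: _).
rewrite /dmono (tlift_sum _ _ _ msu) (tlift_sum _ _ _ msh) (tlift_sum _ _ _ mph).
rewrite -[RHS](sum_comps k.+1 n (fun c => \sum_(es <- lists k.+1 qs) contraction (gaps M 1 c es))).
apply: eq_bigr => i _.
rewrite (tlift_tens _ msu).
have -> : [ffun j => horner_alg M ([ffun j0 : 'I_k.+2 => 'X^(i j0) : {poly C}] j)] = [ffun j : 'I_k.+2 => M ^+ i j].
  by apply/ffunP => j; rewrite !ffunE rmorphXn /= horner_algX.
have := sharp_m_tens [ffun j : 'I_k.+2 => M ^+ i j] qs; rewrite /sharp_m => ->.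
rewrite (tlift_sum _ _ _ mph) big_seq [RHS]big_seq; apply: eq_bigr => es /lists_size se.
apply: (phi_mid_slots (k := k)) => //; first exact: size_exponents.
by move=> j; rewrite ffunE slot_gaps.
Qed.

End IntegrandFormula.

(** * Hoelder continuous processes *)

Section Holder.
Context (R : realType) (A : tracialVNA R).
Context (At : R -> set A) (X : R -> R -> A) (m : nat -> R -> R) (kap : nat -> R).
Hypothesis hX : free_increments At X m kap.
Local Notation normc := Normc.normc.
Context (a b : R) (a0 : 0 <= a) (ab : a <= b).

(** The bound on multiplication is part of the definition because it makes
    the class stable under products. *)
Definition holder (f : R -> A) : Prop := exists2 K, 0 <= K &
  (forall t, a <= t -> t <= b -> At t (f t) /\ mulbd K (f t)) /\
  (forall s t, a <= s -> s <= t -> t <= b -> nrm (f t - f s) <= K * Num.sqrt (t - s)).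

Lemma holder_cst x : At a x -> holder (fun=> x).
Proof.
move=> hx; have [K hK] := mulbd_ex x; have K0 := mulbd_ge0 hK.
exists K => //; split; first by move=> t at_ _; split => //; exact: (fi_mono hX a0 at_).
by move=> s t _ _ _; rewrite subrr nrm0 mulr_ge0 ?sqrtr_ge0.
Qed.

Lemma holderM f g : holder f -> holder g -> holder (fun t => f t * g t).
Proof.
move=> [K K0 [f1 f2]] [L L0 [g1 g2]]; exists (K * L + L * K + K * L); first by rewrite !addr_ge0 ?mulr_ge0.
have KL : K * L <= K * L + L * K + K * L by rewrite -addrA lerDl addr_ge0 ?mulr_ge0.
split=> [t h1 h2|s t h1 h2 h3].
  have [fA fK] := f1 t h1 h2; have [gA gL] := g1 t h1 h2; split.
    by apply: (fi_mul hX) => //; exact: le_trans h1.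
  by apply: mulbdW KL _; exact: mulbdM.
have -> : f t * g t - f s * g s = (f t - f s) * g t + f s * (g t - g s).
  by rewrite mulrBl mulrBr addrA subrK.
apply: le_trans (nrmD _ _) _; apply: (@le_trans _ _ ((L * K + K * L) * Num.sqrt (t - s))); last first.
  by rewrite ler_wpM2r ?sqrtr_ge0// -addrA lerDr mulr_ge0.
have [_ gL] := g1 t (le_trans h1 h2) h3; have [_ fK] := f1 s h1 (le_trans h2 h3).
rewrite [leRHS]mulrDl -!mulrA; apply: lerD.
  by apply: le_trans (mulbd_r _ gL) _; rewrite ler_wpM2l// f2.
by apply: le_trans (mulbd_l _ fK) _; rewrite ler_wpM2l// g2.
Qed.

Lemma holderX f n : holder f -> holder (fun t => f t ^+ n).
Proof.
move=> hf; elim: n => [|n IH].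
  have -> : (fun t => f t ^+ 0) = (fun=> 1) by apply: funext => t; rewrite expr0.
  by apply: holder_cst; exact: (fi_one hX).
have -> : (fun t => f t ^+ n.+1) = (fun t => f t * f t ^+ n) by apply: funext => t; rewrite exprS.
exact: holderM.
Qed.

Lemma holder_trace f : holder f -> holder (fun t => (tr (f t))%:A).
Proof.
move=> [K K0 [f1 f2]]; exists K => //; split=> [t h1 h2|s t h1 h2 h3].
  have [fA fK] := f1 t h1 h2; split; first by apply: (At_scalar hX); exact: le_trans h1.
  apply: (@mulbdW _ _ (normc (tr (f t)) * 1)); last exact: mulbdZ (mulbd1 A).
  rewrite mulr1; apply: le_trans (tr_le_nrm1 _) _; exact: mulbd_nrm.
rewrite -scalerBl -trB nrmZ nrm1 mulr1; apply: le_trans (tr_le_nrm1 _) _; exact: f2.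
Qed.

Definition holder_tensor (U : R -> tpow 2 A) : Prop :=
  (forall t, a <= t -> t <= b -> adapted_at At t (U t)) /\
  exists2 K, 0 <= K & forall s t, a <= s -> s <= t -> t <= b ->
   tnorm2 (U t - U s) <= K * Num.sqrt (t - s) /\ nrm (tmul (U t) - tmul (U s)) <= K * Num.sqrt (t - s).

Lemma holder_tensor0 : holder_tensor (fun=> 0).
Proof.
split; first by move=> t _ _; exact: adapted_at0.
exists 0 => // s t _ _ _; rewrite !subrr nrm0 mul0r tnorm2_hnorm; split => //.
by rewrite (hnorm0 (tdot_semi A)).
Qed.

Lemma holder_tensorD U V : holder_tensor U -> holder_tensor V -> holder_tensor (fun t => U t + V t).
Proof.
move=> [aU [K K0 hU]] [aV [L L0 hV]]; split.
  by move=> t h1 h2; apply: adapted_atD; [exact: aU|exact: aV].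
exists (K + L); first exact: addr_ge0.
move=> s t h1 h2 h3; have [u1 u2] := hU s t h1 h2 h3; have [v1 v2] := hV s t h1 h2 h3.
have e (V' : zmodType) (p q r w : V') : p + q - (r + w) = (p - r) + (q - w) by rewrite opprD addrACA.
rewrite !tmulD !e [(K + L) * _]mulrDl; split.
  by apply: le_trans (hnormD (tdot_semi A) _ _) _; rewrite lerD.
by apply: le_trans (nrmD _ _) _; rewrite lerD.
Qed.

Lemma holder_tensorZ c U : holder_tensor U -> holder_tensor (fun t => c *: U t).
Proof.
move=> [aU [K K0 hU]]; split.
  by move=> t h1 h2; apply: (adapted_atZ hX); [exact: le_trans h1|exact: aU].
exists (normc c * K); first by rewrite mulr_ge0 ?normc_ge0.
move=> s t h1 h2 h3; have [u1 u2] := hU s t h1 h2 h3.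
rewrite !tmulZ -!scalerBr nrmZ tnorm2_hnorm (hnormZ (tdot_semi A)) -!mulrA.
by split; rewrite ler_wpM2l ?normc_ge0.
Qed.

Lemma holder_tensor_sum (I : eqType) (r : seq I) (U : I -> R -> tpow 2 A) :
  (forall i, i \in r -> holder_tensor (U i)) -> holder_tensor (fun t => \sum_(i <- r) U i t).
Proof.
elim: r => [|i r IH] h.
  have -> : (fun t => \sum_(i <- [::]) U i t) = (fun=> 0) by apply: funext => t; rewrite big_nil.
  exact: holder_tensor0.
have -> : (fun t => \sum_(j <- i :: r) U j t) = (fun t => U i t + \sum_(j <- r) U j t).
  by apply: funext => t; rewrite big_cons.
apply: holder_tensorD; first by apply: h; rewrite mem_head.
by apply: IH => j jr; apply: h; rewrite inE jr orbT.
Qed.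

Lemma holder_tensor_tens2 f g : holder f -> holder g -> holder_tensor (fun t => tens2 (f t) (g t)).
Proof.
move=> hf hg; have [N N0 [_ h2]] := holderM hf hg.
case: hf => K K0 [f1 f2]; case: hg => L L0 [g1 g2]; split.
  by move=> t t1 t2; apply: adapted_at_tens2; [exact: (f1 t t1 t2).1|exact: (g1 t t1 t2).1].
exists (K * L + K * L + N); first by rewrite !addr_ge0 ?mulr_ge0.
move=> s t st1 st2 st3; rewrite !tmul_tens2; split; last first.
  apply: le_trans (h2 s t st1 st2 st3) _; rewrite ler_wpM2r ?sqrtr_ge0//.
  by rewrite lerDr addr_ge0 ?mulr_ge0.
have -> : tens2 (f t) (g t) - tens2 (f s) (g s) = tens2 (f t - f s) (g t) + tens2 (f s) (g t - g s).
  by rewrite tens2Dl tens2Nl tens2Dr -scaleN1r -[- g s]scaleN1r tens2Zr !scaleN1r addrA subrK.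
apply: le_trans (hnormD (tdot_semi A) _ _) _; rewrite -!tnorm2_hnorm !tnorm2_tens2.
have g3 : nrm (g t) <= L by apply: mulbd_nrm; exact: (g1 t (le_trans st1 st2) st3).2.
have f3 : nrm (f s) <= K by apply: mulbd_nrm; exact: (f1 s st1 (le_trans st2 st3)).2.
have e1 : nrm (f t - f s) * nrm (g t) <= K * Num.sqrt (t - s) * L.
  by apply: ler_pM; rewrite ?nrm_ge0 ?f2.
have e2 : nrm (f s) * nrm (g t - g s) <= K * (L * Num.sqrt (t - s)).
  by apply: ler_pM; rewrite ?nrm_ge0 ?g2.
apply: le_trans (lerD e1 e2) _.
have -> : K * Num.sqrt (t - s) * L + K * (L * Num.sqrt (t - s)) = (K * L + K * L) * Num.sqrt (t - s) by ring.
by rewrite ler_wpM2r ?sqrtr_ge0// lerDl.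
Qed.

Definition eval_at (fs : seq (R -> A)) t : seq A := [seq f t | f <- fs].

(** The entries are given as functions, so that the closure properties of
    Hoelder processes apply to each of them. *)
Definition holder_list (g : R -> seq A) n : Prop :=
  exists fs, [/\ size fs = n, forall f, List.In f fs -> holder f & forall t, g t = eval_at fs t].

Lemma gaps_holder M l (c : seq nat) (es : seq (A * A)) : holder M -> holder l ->
  (forall e, e \in es -> At a e.1 /\ At a e.2) -> size c = (size es).+1 ->
  holder_list (fun t => gaps (M t) (l t) c es) (size c).
Proof.
move=> hM; elim: es l c => [|e es IH] l [|j c] hl hes //= [sc].
  case: c sc => // _.
  exists [:: fun t => l t * M t ^+ j * 1]; split => // f [<-|//].
  apply: holderM; last by apply: holder_cst; exact: (fi_one hX).
  by apply: holderM => //; exact: holderX.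
have [e1 e2] := hes e (mem_head _ _).
have [|fs [s1 s2 s3]] := IH (fun=> e.2) c (holder_cst e2) _ sc.
  by move=> e' he'; apply: hes; rewrite inE he' orbT.
exists ((fun t => l t * M t ^+ j * e.1) :: fs); split; first by rewrite /= s1.
- move=> f [<-|]; last exact: s2.
  apply: holderM; last exact: holder_cst.
  by apply: holderM => //; exact: holderX.
- by move=> t; rewrite /= s3.
Qed.

Lemma trace_gaps_holder f fs : holder f -> (forall g, List.In g fs -> holder g) ->
  holder (fun t => (trace_gaps (f t) (eval_at fs t))%:A).
Proof.
elim: fs f => [|g fs IH] f hf hfs /=.
  by under eq_fun do rewrite scale1r; apply: holder_cst; exact: (fi_one hX).
have -> : (fun t => (tr (f t) * trace_gaps (g t) (eval_at fs t))%:A : A) =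
  (fun t => (tr (f t))%:A * (trace_gaps (g t) (eval_at fs t))%:A).
  by apply: funext => t; rewrite -scalerAl mul1r scalerA.
apply: holderM; first exact: holder_trace.
by apply: IH; [apply: hfs; left|move=> h hh; apply: hfs; right].
Qed.

Lemma contraction_holder (g : R -> seq A) n : holder_list g n.+2 -> holder_tensor (fun t => contraction (g t)).
Proof.
case=> -[|f0 [|f1 fs]] [//= [sf] hf hg].
have -> : (fun t => contraction (g t)) =
    (fun t => tens2 ((trace_gaps (f1 t) (eval_at fs t))%:A * f0 t) ((last f1 fs) t)).
  apply: funext => t; rewrite hg /contraction /= -scalerAl mul1r tens2Zl.
  by congr (_ *: tens2 _ _); elim: (fs) (f1) => [|f fs' IH] f' //=.
apply: holder_tensor_tens2.
  apply: holderM; last by apply: hf; left.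
  by apply: trace_gaps_holder; [apply: hf; right; left|move=> h hh; apply: hf; right; right].
have : List.In (last f1 fs) (f1 :: fs).
  by elim: (fs) (f1) => [|f fs' IH] f' /=; [left|right; exact: IH].
by move=> h; apply: hf; right.
Qed.

Lemma holder_list_bound (g : R -> seq A) n : holder_list g n -> exists2 K, 1 <= K &
  forall t, a <= t -> t <= b -> size (g t) = n /\ forall x, x \in g t -> At t x /\ mulbd K x.
Proof.
case=> fs [sf hf hg].
have [K K1 hK] : exists2 K, 1 <= K & forall t, a <= t -> t <= b -> forall x, x \in eval_at fs t -> At t x /\ mulbd K x.
  elim: fs hf {sf hg} => [|f fs IH] hf; first by exists 1.
  have [K K1 hK] := IH (fun h hh => hf h (or_intror hh)).
  have [L L0 [f1 _]] := hf f (or_introl erefl).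
  exists (K + L); first by rewrite ler_wpDr.
  move=> t t1 t2 x; rewrite inE => /orP[/eqP ->|hx].
    have [h1 h2] := f1 t t1 t2; split => //; apply: mulbdW h2; lra.
  have [h1 h2] := hK t t1 t2 x hx; split => //; apply: mulbdW h2; lra.
exists K => // t t1 t2; rewrite hg size_map sf; split => //; exact: hK.
Qed.

End Holder.

(** * The change of variables formula on a cell *)

Section Cell.
Context (R : realType) (A : tracialVNA R).
Context (At : R -> set A) (X : R -> R -> A) (m : nat -> R -> R) (kap : nat -> R).
Hypothesis hX : free_increments At X m kap.
Local Notation normc := Normc.normc.

Lemma act_mulbd (u : tpow 2 A) : exists2 K, 0 <= K & forall L Z, mulbd L Z -> mulbd (K * L) (act u Z).
Proof.
have [s ->] := tsum_ex u; elim: s => [|[S T] s [K K0 IH]].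
  exists 0 => // L Z hZ; rewrite act_tsum big_nil mul0r.
  by split => // x; rewrite mul0r mulr0 nrm0 mul0r.
have [K1 h1] := mulbd_ex S; have [K2 h2] := mulbd_ex T.
exists (K1 * K2 + K); first by rewrite addr_ge0// mulr_ge0 ?(mulbd_ge0 h1) ?(mulbd_ge0 h2).
move=> L Z hZ; rewrite /tsum big_cons actDl act_tens2 mulrDl; apply: mulbdD; last exact: IH.
by rewrite mulrAC; apply: mulbdM => //; exact: mulbdM.
Qed.

Context (a b : R) (a0 : 0 <= a) (ab : a <= b).

Lemma holder_integral x0 u : At a x0 -> adapted_at At a u -> holder At a b (fun t => x0 + act u (X a t)).
Proof.
move=> hx hu; have b0 : 0 <= b by exact: le_trans ab.
have [K hK] := tame_ex hX b0.
have K1 : 1 <= K by case: (hK a b a0 ab (lexx b)).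
have K0 : 0 <= K by exact: le_trans K1.
have [L hL] := mulbd_ex x0; have L0 := mulbd_ge0 hL.
have [U1 U10 hU1] := act_mulbd u; have [U2 U20 hU2] := act_bounded u.
exists (L + U1 * K + U2 * K); first by rewrite !addr_ge0 ?mulr_ge0.
split=> [t h1 h2|s t h1 h2 h3].
  have t0 := le_trans a0 h1; split.
    apply: (AtD hX) => //; first exact: (fi_mono hX a0 h1).
    apply: (At_act hX) => //; first exact: (adapted_at_mono hX a0 h1 hu).
    exact: (fi_adapted hX).
  have [_ hXt _ _ _] := hK a t a0 h1 h2.
  apply: (@mulbdW _ _ (L + U1 * K)); first by rewrite lerDl mulr_ge0.
  by apply: mulbdD => //; exact: hU1.
have s0 := le_trans a0 h1.
have -> : x0 + act u (X a t) - (x0 + act u (X a s)) = act u (X s t).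
  by rewrite -(fi_add hX a0 h1 h2) actDr opprD addrACA subrr add0r addrAC subrr add0r.
apply: le_trans (hU2 _) _; apply: (@le_trans _ _ (U2 * (K * Num.sqrt (t - s)))).
  by rewrite ler_wpM2l//; exact: (tame_nrm hX s0 h2 (hK s t s0 h2 h3)).
by rewrite mulrA ler_wpM2r ?sqrtr_ge0// lerDr addr_ge0// mulr_ge0.
Qed.

(** Over a subdivision of mesh h such errors add up to O(sqrt h), by
    block_sum. *)
Definition small_cells (E : R -> R -> A) : Prop := exists2 C, 0 <= C &
  forall s t, a <= s -> s <= t -> t <= b ->
    small_incr At s t (E s t) (C * ((t - s) * Num.sqrt (t - s))) (C * (t - s)).

Lemma small_cells_sum (I : eqType) (r : seq I) (E : I -> R -> R -> A) :
  (forall i, i \in r -> small_cells (E i)) -> small_cells (fun s t => \sum_(i <- r) E i s t).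
Proof.
elim: r => [|i r IH] h.
  exists 0 => // s t h1 h2 h3; rewrite big_nil !mul0r; apply: (small_incr0 hX).
  exact: le_trans (le_trans a0 h1) h2.
have [C C0 hC] := h i (mem_head _ _).
have [|D D0 hD] := IH; first by move=> j jr; apply: h; rewrite inE jr orbT.
exists (C + D); first exact: addr_ge0.
move=> s t h1 h2 h3; rewrite big_cons ![(C + D) * _]mulrDl; apply: (small_incrD hX).
- exact: le_trans (le_trans a0 h1) h2.
- exact: hC.
- exact: hD.
Qed.

Lemma small_cellsZ c E : small_cells E -> small_cells (fun s t => c *: E s t).
Proof.
move=> [C C0 hC]; exists (normc c * C); first by rewrite mulr_ge0 ?normc_ge0.
move=> s t h1 h2 h3; rewrite -!mulrA; apply: (small_incrZ hX); last exact: hC.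
exact: le_trans (le_trans a0 h1) h2.
Qed.

Lemma gap_word_small (g : R -> seq A) k : holder_list At a b g k.+2 ->
  small_cells (fun s t => gap_word (X s t) (g s) - act (contraction (g s)) (X s t ^+ k.+1)).
Proof.
move=> hg; have b0 : 0 <= b by exact: le_trans ab.
have [K1 hK11 hK1] := holder_list_bound hg.
have [K2 hK2] := tame_ex hX b0.
have K21 : 1 <= K2 by case: (hK2 a b a0 ab (lexx b)).
have K12 : 1 <= K1 + K2 by lra.
have [C C0 hC] := gap_replacement hX k K12.
exists C => // s t h1 h2 h3.
have s0 := le_trans a0 h1; have sb := le_trans h2 h3.
have [sg hm] := hK1 s h1 sb.
have ht : tame X m (K1 + K2) s t by apply: tameW (hK2 s t s0 h2 h3) => //; lra.
case E : (g s) sg hm => [|b1 [|b2 l]] //= [sl] hm.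
have hA x : x \in [:: b1, b2 & l] -> At s x by move=> /hm[].
have hB x : x \in [:: b1, b2 & l] -> mulbd (K1 + K2) x.
  by move=> /hm[_]; apply: mulbdW; lra.
have := hC s t b1 b2 l s0 h2 ht sl (hA _ _) (hA _ _) _ (hB _ _) (hB _ _) _.
rewrite /gap_word /contraction /= actZl act_tens2 sl; apply.
- by rewrite mem_head.
- by rewrite inE mem_head orbT.
- by move=> d dl; apply: hA; rewrite !inE dl !orbT.
- by rewrite mem_head.
- by rewrite inE mem_head orbT.
- by move=> d dl; apply: hB; rewrite !inE dl !orbT.
Qed.

Context (M : R -> A) (qs : seq (A * A)) (p : {poly R[i]}).
Hypothesis hqs : forall q, q \in qs -> At a q.1 /\ At a q.2.
Hypothesis hM : forall t, a <= t -> t <= b -> M t = M a + act (tsum qs) (X a t).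
Hypothesis hMa : At a (M a).

Lemma holder_M : holder At a b M.
Proof.
have hu : adapted_at At a (tsum qs) by exists qs.
have [K K0 [h1 h2]] := holder_integral hMa hu.
exists K => //; split=> [t t1 t2|s t t1 t2 t3].
  by rewrite hM//; exact: h1.
rewrite (hM (le_trans t1 t2) t3) (hM t1 (le_trans t2 t3)); exact: h2.
Qed.

Lemma gaps_list k n (c : seq nat) es : c \in comps k n -> es \in lists k qs ->
  holder_list At a b (fun t => gaps (M t) 1 c es) k.+1.
Proof.
move=> /comps_size sc hes; rewrite -sc.
apply: (gaps_holder hX a0 (l := fun=> 1)).
- exact: holder_M.
- by apply: (holder_cst hX) => //; exact: (fi_one hX).
- by move=> e /(lists_mem hes); exact: hqs.
- by rewrite sc (lists_size hes).
Qed.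

Lemma integrand_holder k : holder_tensor At a b (fun t => contracted_derivative p k.+1 (M t) qs).
Proof.
apply: (holder_tensor_sum (U := fun (n : 'I_(size p)) t => p`_n *: \sum_(c <- comps k.+1 n)
   \sum_(es <- lists k.+1 qs) contraction (gaps (M t) 1 c es))) => n _.
apply: (holder_tensorZ hX) => //.
apply: (holder_tensor_sum (U := fun c t => \sum_(es <- lists k.+1 qs) contraction (gaps (M t) 1 c es))) => c hc.
apply: (holder_tensor_sum (U := fun es t => contraction (gaps (M t) 1 c es))) => es hes.
apply: (contraction_holder hX a0 (g := fun t => gaps (M t) 1 c es) (n := k)).
exact: gaps_list hc hes.
Qed.

Lemma words_small k : small_cells (fun s t => \sum_(n < size p)
  (p`_n *: words (M s) (X s t) qs 1 k.+1 n) -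
  act (contracted_derivative p k.+1 (M s) qs) (X s t ^+ k.+1)).
Proof.
have h : small_cells (fun s t => \sum_(n < size p) p`_n *: \sum_(c <- comps k.+1 n)
   \sum_(es <- lists k.+1 qs) (gap_word (X s t) (gaps (M s) 1 c es) -
       act (contraction (gaps (M s) 1 c es)) (X s t ^+ k.+1))).
  apply: small_cells_sum => n _; apply: small_cellsZ; apply: small_cells_sum => c hc.
  apply: small_cells_sum => es hes; apply: (gap_word_small (g := fun t => gaps (M t) 1 c es)).
  exact: gaps_list hc hes.
case: h => C C0 hC; exists C => // s t h1 h2 h3; have := hC s t h1 h2 h3.
congr (small_incr At s t _ _ _).
rewrite /contracted_derivative act_suml -sumrB; apply: eq_bigr => n _.
rewrite actZl -scalerBr act_suml /words -sumrB; congr (_ *: _); apply: eq_bigr => c _.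
by rewrite act_suml -sumrB.
Qed.

(** On each cell of the subdivision the words in the expansion of p (M + h)
    are replaced by their contractions up to a small increment. Freezing the
    integrand at r costs another small increment, because the integrand is
    Hoelder continuous. *)
Lemma cell_formula : exists2 C, 0 <= C & forall r r' pi sz, a <= r -> r' <= b ->
  subdivision r r' pi sz ->
  block At r r' (horner_alg (M r') p - horner_alg (M r) p -
      \sum_(k < size p) act (contracted_derivative p k.+1 (M r) qs) (power_sum X k.+1 pi sz))
    (C * ((r' - r) * Num.sqrt (r' - r))) (C * (r' - r) ^+ 2).
Proof.
have b0 : 0 <= b by exact: le_trans ab.
pose G k t := contracted_derivative p k.+1 (M t) qs.
have hW : small_cells (fun s t => \sum_(k < size p) (\sum_(n < size p)
    (p`_n *: words (M s) (X s t) qs 1 k.+1 n) - act (G k s) (X s t ^+ k.+1))).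
  by apply: small_cells_sum => k _; exact: words_small.
have [C1 C10 hC1] := hW.
have hH k : exists2 K, 0 <= K & forall r s t, a <= r -> r <= s -> s <= t -> t <= b ->
    small_incr At s t (act (G k s - G k r) (X s t ^+ k.+1))
      (K * ((t - s) * Num.sqrt (s - r))) (K * (Num.sqrt (t - s) * Num.sqrt (s - r))).
  have [aG [K K0 hK]] := integrand_holder k.
  have [D1 D10 hD1] := moment_linear_bound hX b (isT : 0 < k.+1)%N.
  have [D2 D20 hD2] := moment_linear_bound hX b (isT : 0 < k.+1 * 2)%N.
  exists (D1 * K + Num.sqrt D2 * K + D1 * K * Num.sqrt b).
    by rewrite !addr_ge0 ?mulr_ge0 ?sqrtr_ge0.
  move=> r s t h1 h2 h3 h4; have r0 := le_trans a0 h1; have s0 := le_trans r0 h2.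
  have sb := le_trans h3 h4; have d0 : 0 <= t - s by rewrite subr_ge0.
  have db : t - s <= b by lra.
  have [k1 k2] := hK r s h1 h2 sb.
  have hA : adapted_at At s (G k s - G k r).
    apply: (adapted_atB hX) => //; first by apply: aG => //; exact: le_trans h2.
    by apply: (adapted_at_mono hX r0 h2); apply: aG => //; exact: le_trans sb.
  have m1 := hD1 _ d0 db; have m2 := hD2 _ d0 db.
  have k2' : nrm (tmul (G k s - G k r)) <= K * Num.sqrt (s - r) by rewrite tmulB.
  have e1 : `|m k.+1 (t - s)| * nrm (tmul (G k s - G k r)) <= D1 * K * ((t - s) * Num.sqrt (s - r)).
    rewrite (_ : D1 * K * _ = D1 * (t - s) * (K * Num.sqrt (s - r))); last by ring.
    by apply: ler_pM; rewrite ?nrm_ge0.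
  have e2 : Num.sqrt (m (k.+1 * 2) (t - s)) * tnorm2 (G k s - G k r) <=
      Num.sqrt D2 * K * (Num.sqrt (t - s) * Num.sqrt (s - r)).
    rewrite (_ : Num.sqrt D2 * K * _ = Num.sqrt D2 * Num.sqrt (t - s) * (K * Num.sqrt (s - r))); last by ring.
    apply: ler_pM; rewrite ?sqrtr_ge0 ?tnorm2_ge0// -sqrtrM//.
    by apply: ler_wsqrtr; apply: le_trans (ler_norm _) _.
  have e3 : t - s <= Num.sqrt b * Num.sqrt (t - s).
    rewrite -{1}[t - s]sqr_sqrtr// expr2 ler_wpM2r ?sqrtr_ge0//; exact: ler_wsqrtr.
  have q1 : 0 <= Num.sqrt (s - r) by exact: sqrtr_ge0.
  have q2 : 0 <= Num.sqrt (t - s) by exact: sqrtr_ge0.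
  have q3 : 0 <= Num.sqrt b by exact: sqrtr_ge0.
  have q4 : 0 <= Num.sqrt D2 by exact: sqrtr_ge0.
  apply: small_incrW (small_incr_act hX s0 h3 hA k.+1).
    apply: le_trans e1 _; rewrite ler_wpM2r ?mulr_ge0// -addrA lerDl.
    by rewrite addr_ge0 ?mulr_ge0.
  apply: le_trans (lerD e2 e1) _.
  have e4 : D1 * K * ((t - s) * Num.sqrt (s - r)) <= D1 * K * (Num.sqrt b * Num.sqrt (t - s) * Num.sqrt (s - r)).
    by rewrite ler_wpM2l ?mulr_ge0// ler_wpM2r.
  apply: le_trans (lerD (lexx _) e4) _.
  rewrite (_ : D1 * K * (_ * _ * _) = D1 * K * Num.sqrt b * (Num.sqrt (t - s) * Num.sqrt (s - r))); last by ring.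
  by rewrite -mulrDl ler_wpM2r ?mulr_ge0// -addrA lerDr mulr_ge0.
have [C2 C20 hC2] : exists2 C, 0 <= C & forall r s t, a <= r -> r <= s -> s <= t -> t <= b ->
    small_incr At s t (\sum_(k < size p) act (G k s - G k r) (X s t ^+ k.+1))
      (C * ((t - s) * Num.sqrt (s - r))) (C * (Num.sqrt (t - s) * Num.sqrt (s - r))).
  pose K k := projT1 (cid2 (hH k)).
  have hK k : 0 <= K k /\ forall r s t, a <= r -> r <= s -> s <= t -> t <= b ->
    small_incr At s t (act (G k s - G k r) (X s t ^+ k.+1))
      (K k * ((t - s) * Num.sqrt (s - r))) (K k * (Num.sqrt (t - s) * Num.sqrt (s - r))).
    by rewrite /K; case: cid2.
  exists (\sum_(k < size p) K k); first by apply: sumr_ge0 => k _; exact: (hK k).1.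
  move=> r s t h1 h2 h3 h4; rewrite !mulr_suml; apply: (small_incr_sum hX).
    exact: le_trans (le_trans (le_trans a0 h1) h2) h3.
  by move=> k _; exact: (hK k).2.
exists ((C1 + C2) + (C1 * Num.sqrt b + C2 + C1) ^+ 2).
  by rewrite addr_ge0 ?sqr_ge0// addr_ge0.
move=> r r' pi sz ar r'b sub.
have [pi0 pin pim] := sub; have r0 := le_trans a0 ar.
have rr' : r <= r' by have [] := subdivision_le sub (leqnn sz); rewrite pin.
pose D := r' - r; have D0 : 0 <= D by rewrite subr_ge0.
pose E j := horner_alg (M (pi j.+1)) p - horner_alg (M (pi j)) p -
  \sum_(k < size p) act (G k r) (X (pi j) (pi j.+1) ^+ k.+1).
have EE : horner_alg (M r') p - horner_alg (M r) p -
      \sum_(k < size p) act (G k r) (power_sum X k.+1 pi sz) = \sum_(j < sz) E j.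
  rewrite /E sumrB; congr (_ - _).
    rewrite -(big_mkord xpredT (fun j => horner_alg (M (pi j.+1)) p - horner_alg (M (pi j)) p)).
    by rewrite telescope_sumr// pi0 pin.
  rewrite exchange_big /=; apply: eq_bigr => k _.
  by rewrite /power_sum act_sumr.
rewrite EE.
have bl j : (j < sz)%N -> block At (pi j) (pi j.+1) (E j)
    ((C1 + C2) * ((pi j.+1 - pi j) * Num.sqrt D)) ((C1 * Num.sqrt b + C2 + C1) ^+ 2 * ((pi j.+1 - pi j) * D)).
  move=> hj; have [l1 l2] := subdivision_le sub (ltnW hj); have [u1 u2] := subdivision_le sub hj.
  set s := pi j; set t := pi j.+1; have st : s <= t by exact: pim.
  have as_ : a <= s by exact: le_trans l1. have tb : t <= b by exact: le_trans r'b.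
  have s0 := le_trans a0 as_; have d0 : 0 <= t - s by rewrite subr_ge0.
  have tsD : t - s <= D by rewrite /D lerB.
  have srD : s - r <= D by rewrite /D lerD2r.
  have Mt : M t = M s + \sum_(q <- qs) q.1 * X s t * q.2.
    rewrite -act_tsum (hM (le_trans as_ st) tb) (hM as_ (le_trans st tb)).
    by rewrite -addrA -actDr (fi_add hX a0 as_ st).
  have Ej : E j = \sum_(k < size p) (\sum_(n < size p)
      (p`_n *: words (M s) (X s t) qs 1 k.+1 n) - act (G k s) (X s t ^+ k.+1)) +
      \sum_(k < size p) act (G k s - G k r) (X s t ^+ k.+1).
    rewrite /E -/s -/t Mt (poly_increment _ _ _ (leqnn (size p))) -big_split -sumrB.
    by apply: eq_bigr => k _ /=; rewrite actBl addrA subrK.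
  have S1 := hC1 s t as_ st tb; have S2 := hC2 r s t ar l1 st tb.
  have t0 := le_trans s0 st.
  have q1 : Num.sqrt (t - s) <= Num.sqrt D by exact: ler_wsqrtr.
  have q2 : Num.sqrt (s - r) <= Num.sqrt D by exact: ler_wsqrtr.
  have q0 : 0 <= Num.sqrt (t - s) by exact: sqrtr_ge0.
  have qD : 0 <= Num.sqrt D by exact: sqrtr_ge0.
  have S := small_incrD hX t0 S1 S2; rewrite -Ej in S.
  have := small_incr_block hX s0 (small_incrW _ _ S).
  move=> /(_ ((C1 + C2) * ((t - s) * Num.sqrt D)) ((C1 * Num.sqrt b + C2 + C1) * (Num.sqrt (t - s) * Num.sqrt D))).
  rewrite !exprMn !sqr_sqrtr//; apply.
    by rewrite [leRHS]mulrDl lerD// ler_wpM2l// ler_wpM2l.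
  have x1 : C1 * (t - s) <= C1 * (Num.sqrt (t - s) * Num.sqrt D).
    by rewrite ler_wpM2l// -{1}[t - s]sqr_sqrtr// expr2 ler_wpM2l.
  have x2 : C2 * (Num.sqrt (t - s) * Num.sqrt (s - r)) <= C2 * (Num.sqrt (t - s) * Num.sqrt D).
    by rewrite ler_wpM2l// ler_wpM2l.
  apply: le_trans (lerD x1 x2) _; rewrite -mulrDl ler_wpM2r ?mulr_ge0//.
  have x3 : 0 <= C1 * Num.sqrt b by rewrite mulr_ge0 ?sqrtr_ge0.
  lra.
have pi00 : 0 <= pi 0%N by rewrite pi0.
have [B _] := block_sum hX pi00 pim bl.
move: B; rewrite pi0 pin -!mulr_sumr -!mulr_suml (subdivision_length sub) -/D.
have k1 : 0 <= (C1 * Num.sqrt b + C2 + C1) ^+ 2 by exact: sqr_ge0.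
have k2 : 0 <= C1 + C2 by exact: addr_ge0.
apply: blockW; rewrite ler_wpM2r ?mulr_ge0 ?sqrtr_ge0 ?sqr_ge0//.
- by rewrite lerDl.
- by rewrite expr2 lerDr.
Qed.

End Cell.

(** * Simple biprocesses and the running integral *)

Section SimpleBiprocesses.
Context (R : realType) (A : tracialVNA R).
Context (At : R -> set A) (X : R -> R -> A) (m : nat -> R -> R) (kap : nat -> R).
Hypothesis hX : free_increments At X m kap.
Implicit Types (s : seq (step A)) (U V : biprocess A) (D : R -> A).

Definition ssum D s : A := \sum_(e <- s) lft e * (D (hi e) - D (lo e)) * rgt e.

(** Strictness makes the index of a point unique. *)
Definition grid (tau : nat -> R) (n : nat) : Prop :=
  tau 0%N = 0 /\ forall i, (i < n)%N -> tau i < tau i.+1.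

Definition on_grid (tau : nat -> R) (n : nat) (x : R) : Prop := exists2 i, (i <= n)%N & tau i = x.

Definition steps_on_grid tau n s : Prop :=
  {in s, forall e, on_grid tau n (lo e) /\ on_grid tau n (hi e)}.

Lemma grid_lt tau n i j : grid tau n -> (i < j)%N -> (j <= n)%N -> tau i < tau j.
Proof.
move=> [_ h]; elim: j => [//|j IH] ij jn.
move: ij; rewrite ltnS leq_eqVlt => /orP[/eqP ->|ij]; first exact: h.
by apply: lt_trans (IH ij (ltnW jn)) (h j jn).
Qed.

Lemma grid_le tau n i j : grid tau n -> (i <= j)%N -> (j <= n)%N -> tau i <= tau j.
Proof.
move=> g; rewrite leq_eqVlt => /orP[/eqP -> //|ij] jn; exact: ltW (grid_lt g ij jn).
Qed.

Lemma grid_leE tau n i j : grid tau n -> (i <= n)%N -> (j <= n)%N -> (tau i <= tau j) = (i <= j)%N.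
Proof.
move=> g hi hj; have [ij|ij] := leqP i j; first by rewrite (grid_le g).
by apply/negbTE; rewrite -ltNge (grid_lt g).
Qed.

Lemma grid_ltE tau n i j : grid tau n -> (i <= n)%N -> (j <= n)%N -> (tau i < tau j) = (i < j)%N.
Proof. by move=> g hi hj; rewrite ltNge (grid_leE g)// -ltnNge. Qed.

Lemma grid_ge0 tau n i : grid tau n -> (i <= n)%N -> 0 <= tau i.
Proof. by move=> g hi; rewrite -g.1 (grid_le g). Qed.

Lemma grid_ex (pts : seq R) : (forall x, x \in pts -> 0 <= x) ->
  exists tau n, grid tau n /\ forall x, x \in pts -> on_grid tau n x.
Proof.
move=> h; pose ts := sort <=%O (undup (0 :: pts)).
have us : uniq ts by rewrite sort_uniq undup_uniq.
have st : sorted <%O ts by rewrite lt_sorted_uniq_le us sort_sorted//; exact: le_total.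
have mem x : (x \in ts) = (x \in 0 :: pts) by rewrite mem_sort mem_undup.
have ts0 : (0 < size ts)%N.
  by have : 0 \in ts by [rewrite mem mem_head]; case: (ts).
have on x : x \in ts -> on_grid (nth 0 ts) (size ts).-1 x.
  by move=> xt; exists (index x ts); [rewrite -ltnS prednK// index_mem|rewrite nth_index].
have lt i : (i < (size ts).-1)%N -> nth 0 ts i < nth 0 ts i.+1.
  move=> hi; have hi1 : (i.+1 < size ts)%N by rewrite -[size ts]prednK.
  by rewrite (sorted_ltn_nth lt_trans)// inE ltnW.
exists (nth 0 ts), (size ts).-1; split; last by move=> x xp; apply: on; rewrite mem inE xp orbT.
split => //; apply/eqP; rewrite eq_le; apply/andP; split.
  have z0 : 0 \in ts by rewrite mem mem_head.
  have [i hi ei] := on 0 z0.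
  have up j : (j <= (size ts).-1)%N -> nth 0 ts 0 <= nth 0 ts j.
    by elim: j => [//|j IH] hj; apply: le_trans (IH (ltnW hj)) (ltW (lt j hj)).
  by rewrite -[leRHS]ei; exact: up.
have : nth 0 ts 0 \in ts by rewrite mem_nth.
by rewrite mem inE => /orP[/eqP ->//|]; exact: h.
Qed.

Lemma steps_grid_ex s : {in s, forall e, adapted_step At e} ->
  forall pts : seq R, (forall x, x \in pts -> 0 <= x) ->
  exists tau n, [/\ grid tau n, steps_on_grid tau n s & forall x, x \in pts -> on_grid tau n x].
Proof.
move=> hs pts hp.
have pos : forall x, x \in [seq lo e | e <- s] ++ [seq hi e | e <- s] ++ pts -> 0 <= x.
  move=> x; rewrite !mem_cat => /or3P[/mapP[e /hs[h1 h2 _ _] ->]//|/mapP[e /hs[h1 h2 _ _] ->]|/hp//].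
  exact: le_trans h2.
have [tau [n [g on]]] := grid_ex pos.
exists tau, n; split => //; last by move=> x xp; apply: on; rewrite !mem_cat xp !orbT.
by move=> e es; split; apply: on; rewrite !mem_cat map_f ?orbT.
Qed.

Lemma on_grid_cell tau n x i t : grid tau n -> on_grid tau n x -> (i < n)%N ->
  tau i <= t -> t < tau i.+1 -> ((x <= t) = (x <= tau i)) * ((t < x) = (tau i < x)).
Proof.
move=> g [j jn <-] hi ti it.
have e : (tau j <= t) = (tau j <= tau i).
  apply/idP/idP => [h|h]; last exact: le_trans ti.
  rewrite (grid_leE g)//; last exact: ltnW.
  by rewrite -ltnS -(grid_ltE g)//; exact: le_lt_trans it.
by split => //; rewrite !ltNge e.
Qed.

Lemma step_sum_cell tau n s i t : grid tau n -> steps_on_grid tau n s -> (i < n)%N ->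
  tau i <= t -> t < tau i.+1 -> step_sum s t = step_sum s (tau i).
Proof.
move=> g hs hi ti it; rewrite /step_sum big_seq [RHS]big_seq; apply: eq_bigr => e /hs[h1 h2].
by rewrite (on_grid_cell g h1 hi ti it).1 (on_grid_cell g h2 hi ti it).2.
Qed.

Lemma step_sum_end tau n s t : grid tau n -> steps_on_grid tau n s -> tau n <= t -> step_sum s t = 0.
Proof.
move=> g hs ti; rewrite /step_sum big_seq big1// => e /hs[_ [j jn ej]].
by rewrite -ej [t < _]ltNge (le_trans (grid_le g jn (leqnn n)) ti) andbF.
Qed.

Lemma grid_locate tau n t : grid tau n -> 0 <= t ->
  (exists2 i, (i < n)%N & tau i <= t /\ t < tau i.+1) \/ tau n <= t.
Proof.
move=> [t0 _] ht; elim: n => [|n [[i hi h]|h]]; first by right; rewrite t0.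
  by left; exists i => //; exact: ltnW.
by have [h2|h2] := leP (tau n.+1) t; [right|left; exists n].
Qed.

Lemma telescope_window D tau n p q : grid tau n -> (p <= q)%N -> (q <= n)%N ->
  D (tau q) - D (tau p) = \sum_(i < n) (if tau p <= tau i < tau q then D (tau i.+1) - D (tau i) else 0).
Proof.
move=> g pq qn.
rewrite -(telescope_sumr (fun i => D (tau i)) pq) (big_nat_widen _ _ _ _ _ qn).
rewrite (big_nat_widenl _ 0)//= big_mkord big_mkcond; apply: eq_bigr => i _.
have -> : (tau p <= tau i < tau q) = (p <= i < q)%N.
  by rewrite (grid_leE g (leq_trans pq qn) (ltnW (ltn_ord i))) (grid_ltE g (ltnW (ltn_ord i)) qn).
by rewrite andbC.
Qed.

(** A step is a union of cells, over which its contribution telescopes. The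
    right-hand side depends on the values of U only, which is the reason for
    sint_ssum. *)
Lemma ssum_grid D s U tau n : represents At s U -> grid tau n -> steps_on_grid tau n s ->
  ssum D s = \sum_(i < n) act (U (tau i)) (D (tau i.+1) - D (tau i)).
Proof.
move=> [hs hU] g on.
have -> : \sum_(i < n) act (U (tau i)) (D (tau i.+1) - D (tau i)) =
  \sum_(i < n) \sum_(e <- s) lft e * (if lo e <= tau i < hi e then D (tau i.+1) - D (tau i) else 0) * rgt e.
  apply: eq_bigr => i _; rewrite hU ?(grid_ge0 g (ltnW (ltn_ord i)))// /step_sum act_suml.
  apply: eq_bigr => e _; case: ifP => _; first by rewrite act_tens2.
  by rewrite act0l mulr0 mul0r.
rewrite exchange_big /ssum big_seq [RHS]big_seq; apply: eq_bigr => e es /=.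
rewrite -mulr_suml -mulr_sumr.
have [[p pn ep] [q qn eq]] := on e es; have [_ lh _ _] := hs e es.
have pq : (p <= q)%N by rewrite -(grid_leE g)// ep eq.
by rewrite -ep -eq (telescope_window D g pq qn).
Qed.

Lemma represents_cat s s' U V : represents At s U -> represents At s' V ->
  represents At (s ++ s') (fun t => U t + V t).
Proof.
move=> [hs hU] [hs' hV]; split; first by move=> e; rewrite mem_cat => /orP[/hs|/hs'].
by move=> t t0; rewrite hU// hV// /step_sum big_cat.
Qed.

Lemma ssum_cat D s s' : ssum D (s ++ s') = ssum D s + ssum D s'.
Proof. exact: big_cat. Qed.

Definition opp_steps s : seq (step A) := [seq (e.1, (- lft e, rgt e)) | e <- s].

Lemma represents_opp s U : represents At s U -> represents At (opp_steps s) (fun t => - U t).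
Proof.
move=> [hs hU]; split.
  move=> e /mapP[e' /hs[h1 h2 h3 h4] ->]; split => //.
  by apply: (AtN hX).
move=> t t0; rewrite hU// /step_sum big_map -sumrN; apply: eq_bigr => e _ /=.
by rewrite /lo /hi /= /lft /rgt /=; case: ifP; rewrite ?oppr0// tens2Nl.
Qed.

Lemma ssum_opp D s : ssum D (opp_steps s) = - ssum D s.
Proof.
rewrite /ssum big_map -sumrN; apply: eq_bigr => e _ /=.
by rewrite {1}/lft /= !mulNr.
Qed.

Lemma sint_ssum D s U : represents At s U -> sint At D U = ssum D s.
Proof.
move=> hs; rewrite /sint; case: xgetP => [J _ [s' hs' ->]|].
  have [tau [n [g on _]]] := steps_grid_ex (represents_cat hs hs').1 (pts := [::]) (fun x => ltac:(by [])).
  have on1 : steps_on_grid tau n s by move=> e es; apply: on; rewrite mem_cat es.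
  have on2 : steps_on_grid tau n s' by move=> e es; apply: on; rewrite mem_cat es orbT.
  rewrite -/(ssum D s') (ssum_grid D hs g on1) (ssum_grid D hs' g on2) //.
by move=> /(_ (ssum D s)) []; exists s.
Qed.

Lemma sint_sub D s s' U V : represents At s U -> represents At s' V ->
  sint At D (fun t => U t - V t) = sint At D U - sint At D V.
Proof.
move=> hs hs'; rewrite (sint_ssum D hs) (sint_ssum D hs').
by rewrite (sint_ssum D (represents_cat hs (represents_opp hs'))) ssum_cat ssum_opp.
Qed.

Lemma represents_adapted s U t : represents At s U -> 0 <= t -> adapted_at At t (U t).
Proof.
move=> [hs hU] t0; rewrite hU// /step_sum; apply: adapted_at_sum => e es.
case: ifP => [/andP[lt _]|_]; last exact: adapted_at0.
have [l0 _ h1 h2] := hs e es.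
by apply: adapted_at_tens2; exact: (fi_mono hX l0 lt).
Qed.

Definition piece (a b : R) (u : tpow 2 A) : biprocess A := fun t => if a <= t < b then u else 0.

Lemma piece_represents a b u : 0 <= a -> a <= b -> adapted_at At a u ->
  exists2 s, represents At s (piece a b u) & forall D, ssum D s = act u (D b - D a).
Proof.
move=> a0 ab [qs hqs ->]; exists [seq ((a, b), q) | q <- qs].
  split; first by move=> e /mapP[q /hqs[h1 h2] ->].
  move=> t _; rewrite /piece /step_sum big_map /=.
  rewrite /lo /hi /=; case: ifP => _; last by rewrite big1.
  by [].
by move=> D; rewrite /ssum big_map act_tsum.
Qed.

Lemma zero_represents : represents At [::] (fun=> 0).
Proof. by split => // t _; rewrite /step_sum big_nil. Qed.

Lemma sum_represents (I : Type) (r : seq I) (F : I -> biprocess A) (G : (R -> A) -> I -> A) :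
  (forall i, exists2 s, represents At s (F i) & forall D, ssum D s = G D i) ->
  exists2 s, represents At s (fun t => \sum_(i <- r) F i t) & forall D, ssum D s = \sum_(i <- r) G D i.
Proof.
move=> h; elim: r => [|i r [s hs hD]].
  exists [::]; last by move=> D; rewrite /ssum !big_nil.
  have -> : (fun t => \sum_(i <- [::]) F i t) = (fun=> 0) by apply: funext => t; rewrite big_nil.
  exact: zero_represents.
have [s' hs' hD'] := h i; exists (s' ++ s).
  have -> : (fun t => \sum_(j <- i :: r) F j t) = (fun t => F i t + \sum_(j <- r) F j t).
    by apply: funext => t; rewrite big_cons.
  exact: represents_cat.
by move=> D; rewrite ssum_cat big_cons hD hD'.
Qed.

End SimpleBiprocesses.

Section RunningIntegral.
Context (R : realType) (A : tracialVNA R).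
Context (At : R -> set A) (X : R -> R -> A) (m : nat -> R -> R) (kap : nat -> R).
Hypothesis hX : free_increments At X m kap.
Context (U : biprocess A) (s : seq (step A)) (hs : represents At s U).
Context (tau : nat -> R) (n : nat) (g : grid tau n) (on : steps_on_grid tau n s).

Definition running t : A := sint At (X 0) (windowed 0 t U).

Lemma runningE t : 0 <= t -> running t =
  \sum_(e <- s) lft e * (X 0 (Num.min (hi e) t) - X 0 (Num.min (lo e) t)) * rgt e.
Proof.
move=> t0; case: (hs) => hst hU.
pose st := [seq ((lo e, Num.min (hi e) t), (lft e, rgt e)) : step A | e <- s & lo e < t].
have hr : represents At st (windowed 0 t U).
  split.
    move=> e /mapP[e']; rewrite mem_filter => /andP[lt /hst[h1 h2 h3 h4]] ->.
    by split => //; rewrite /lo /hi /= le_min h2 ltW.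
  move=> x x0; rewrite /windowed x0 /= /step_sum big_map big_filter /=.
  case: ltP => xt; last first.
    rewrite big1// => e _; rewrite /lo /hi /= lt_min [x < t]ltNge xt !andbF//.
  rewrite hU// /step_sum [RHS]big_mkcond; apply: eq_bigr => e _ /=.
  rewrite /lo /hi /lft /rgt /= lt_min xt andbT.
  by case: (ltP e.1.1 t) => // te; rewrite [e.1.1 <= x]leNgt (lt_le_trans xt te).
rewrite /running (sint_ssum _ hr) /ssum big_map big_filter big_mkcond /=.
apply: eq_big_seq => e es; have [_ lh _ _] := hst e es.
move: lh; rewrite /lo /hi /lft /rgt /= => lh.
have [lt|tl] := ltP e.1.1 t; first by [].
rewrite [Num.min e.1.2 t]min_r; last exact: le_trans lh.
by rewrite subrr mulr0 mul0r.
Qed.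

Lemma running0 : running 0 = 0.
Proof.
rewrite runningE// big_seq big1// => e /(hs.1)[h1 h2 _ _].
by rewrite !min_r ?(le_trans h1)// subrr mulr0 mul0r.
Qed.

Lemma running_end : running (tau n) = sint At (X 0) U.
Proof.
rewrite runningE ?(grid_ge0 g)// (sint_ssum _ hs) /ssum big_seq [RHS]big_seq.
apply: eq_bigr => e /on[[p pn ep] [q qn eq]].
by rewrite !min_l// -?ep -?eq (grid_le g).
Qed.

Lemma At_running t : 0 <= t -> At t (running t).
Proof.
move=> t0; rewrite runningE// big_seq; apply: (At_sum hX) => // e /(hs.1)[h1 h2 h3 h4].
case: (boolP (lo e <= t)) => [lt|]; last first.
  rewrite -ltNge => tl; rewrite [Num.min (hi e) t]min_r; last by apply: le_trans h2; exact: ltW.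
  by rewrite [Num.min (lo e) t]min_r ?(ltW tl)// subrr mulr0 mul0r; exact: (At0 hX).
apply: (fi_mul hX) => //; last exact: (fi_mono hX h1 lt).
apply: (fi_mul hX) => //; first exact: (fi_mono hX h1 lt).
have hi0 := le_trans h1 h2.
by apply: (AtB hX) => //; apply: (At_incr hX) => //; rewrite ?le_min ?hi0 ?h1 ?t0// ge_min lexx orbT.
Qed.

Definition active t : seq (A * A) := [seq (lft e, rgt e) | e <- s & lo e <= t < hi e].

Lemma tsum_active t : 0 <= t -> U t = tsum (active t).
Proof.
move=> t0; rewrite (hs.2)// /step_sum /tsum big_map big_filter [RHS]big_mkcond.
by apply: eq_bigr.
Qed.

Lemma At_active t q : q \in active t -> At t q.1 /\ At t q.2.
Proof.
move=> /mapP[e]; rewrite mem_filter => /andP[/andP[lt _] /(hs.1)[h1 _ h3 h4]] ->.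
by split; exact: (fi_mono hX h1 lt).
Qed.

Lemma active_cell i t : (i < n)%N -> tau i <= t -> t < tau i.+1 -> active t = active (tau i).
Proof.
move=> hi ti it; rewrite /active; congr map; apply: eq_in_filter => e /on[h1 h2].
by rewrite (on_grid_cell g h1 hi ti it).1 (on_grid_cell g h2 hi ti it).2.
Qed.

Lemma active_end t : tau n <= t -> active t = [::].
Proof.
move=> ti; rewrite /active (eq_in_filter (a2 := pred0)) ?filter_pred0// => e /on[_ [j jn ej]].
by rewrite -ej [t < _]ltNge (le_trans (grid_le g jn (leqnn n)) ti) andbF.
Qed.

(** On a cell of the grid the active steps do not change, so that the
    integral grows by their action on the increment of X. *)
Lemma running_cell i t : (i < n)%N -> tau i <= t -> t <= tau i.+1 ->
  running t = running (tau i) + act (tsum (active (tau i))) (X (tau i) t).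
Proof.
move=> hin ti it; have ti0 := grid_ge0 g (ltnW hin); have t0 := le_trans ti0 ti.
rewrite !runningE// act_tsum /active big_map big_filter [X in _ + X]big_mkcond -big_split.
apply: eq_big_seq => e es /=; have [_ lh _ _] := hs.1 e es; have [h1 h2] := on es.
have pt x : on_grid tau n x -> X 0 (Num.min x t) =
    X 0 (Num.min x (tau i)) + (if tau i < x then X (tau i) t else 0).
  move=> [j jn <-]; case: (boolP (tau i < tau j)) => h.
    have tj : t <= tau j.
      apply: le_trans it _; rewrite (grid_le g)//.
      by rewrite -(grid_ltE g)// ltnW.
    by rewrite [Num.min _ t]min_r// [Num.min _ (tau i)]min_r ?(ltW h)// (fi_add hX).
  rewrite -leNgt in h.
  by rewrite [Num.min _ t]min_l ?(le_trans h)// [Num.min _ (tau i)]min_l// addr0.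
rewrite !pt// opprD addrACA mulrDr mulrDl; congr (_ + _).
case: (boolP (tau i < lo e)) => l1; last first.
  by rewrite leNgt l1 /=; case: (tau i < hi e); rewrite ?subr0// mulr0 mul0r.
rewrite [lo e <= _]leNgt l1 /=.
by rewrite (lt_le_trans l1 lh) subrr mulr0 mul0r.
Qed.

End RunningIntegral.

(** * Integrals of Hoelder continuous functions *)

Section RealIntegrals.
Context (R : realType).
Local Notation leb := (@lebesgue_measure R).
Local Notation times := ([set` `[0%R, +oo[%R] : set R).

Definition window (a b : R) (f : R -> R) : R -> R := fun t => if a <= t < b then f t else 0.

(** Integrability and the value of the integral together, so that linearity
    has no side conditions. *)
Definition rint (f : R -> R) (v : R) : Prop :=
  leb.-integrable times (fun s => (f s)%:E) /\ Rintegral leb times f = v.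

Let mtimes : @measurable _ (measurableTypeR R) times. Proof. exact: measurable_itv. Qed.

Lemma rint_ext f g v : (forall t, 0 <= t -> f t = g t) -> rint f v -> rint g v.
Proof.
move=> h [fi fv]; split.
  apply: (eq_integrable mtimes _ _ _ fi) => t; rewrite inE /= in_itv/= andbT => t0.
  by rewrite h.
rewrite -fv; apply: eq_Rintegral => t; rewrite inE /= in_itv/= andbT => t0.
by rewrite h.
Qed.

Lemma rintD f g v w : rint f v -> rint g w -> rint (fun t => f t + g t) (v + w).
Proof.
move=> [fi <-] [gi <-]; split.
  by apply: (eq_integrable mtimes _ _ _ (integrableD mtimes fi gi)) => t _; rewrite EFinD.
exact: RintegralD.
Qed.

Lemma rintZ c f v : rint f v -> rint (fun t => c * f t) (c * v).
Proof.
move=> [fi <-]; split.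
  by apply: (eq_integrable mtimes _ _ _ (integrableZl mtimes c fi)) => t _; rewrite EFinM.
exact: RintegralZl.
Qed.

Lemma rint0 : rint (fun=> 0) 0.
Proof.
split; first exact: integrable0.
by rewrite Rintegral_cst// mul0r.
Qed.

Lemma rint_sum (I : Type) (r : seq I) (f : I -> R -> R) (v : I -> R) :
  (forall i, rint (f i) (v i)) -> rint (fun t => \sum_(i <- r) f i t) (\sum_(i <- r) v i).
Proof.
move=> h; elim: r => [|i r IH].
  by rewrite big_nil; under eq_fun do rewrite big_nil; exact: rint0.
by rewrite big_cons; under eq_fun do rewrite big_cons; exact: rintD.
Qed.

Lemma rint_unique f v w : rint f v -> rint f w -> v = w.
Proof. by move=> [_ <-] [_ <-]. Qed.

Lemma window_indic a b (f : R -> R) : window a b f = (fun t => \1_([set` `[a, b[] : set R) t * f t).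
Proof.
apply: funext => t; rewrite /window indicE mem_setE in_itv /=.
by case: ifP => _; rewrite ?mul1r ?mul0r.
Qed.

Lemma rint_window_cst a b c : 0 <= a -> a <= b -> rint (window a b (fun=> c)) (c * (b - a)).
Proof.
move=> a0 ab; rewrite window_indic.
have mI : @measurable _ (measurableTypeR R) [set` `[a, b[] by exact: measurable_itv.
have base : rint (fun t => \1_([set` `[a, b[] : set R) t) (b - a).
  split.
    apply: (integrableS measurableT) => //.
    exact: (@integrable_indic_itv R a b true true).
  rewrite /Rintegral integral_indic// setIidl; last first.
    by move=> x /=; rewrite !in_itv/= andbT => /andP[ax _]; exact: le_trans ax.
  transitivity (fine (leb [set` `[a, b[%R])); first by [].
  rewrite lebesgue_measure_itv /= lte_fin; case: ltP => // ba.
  have -> : a = b by apply/eqP; rewrite eq_le ab ba.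
  by rewrite /= subrr.
by apply: rint_ext (rintZ c base) => t _; rewrite mulrC.
Qed.

Lemma rint_abs_le f g v w : rint f v -> rint g w -> (forall t, 0 <= t -> `|f t| <= g t) -> `|v| <= w.
Proof.
move=> [fi <-] [gi <-] h.
have T0 t : times t -> 0 <= t by rewrite /= in_itv/= andbT.
rewrite ler_norml; apply/andP; split.
  rewrite lerNl -mulN1r -RintegralZl//; apply: le_Rintegral => //.
    by apply: (eq_integrable mtimes _ _ _ (integrableZl mtimes (-1) fi)) => t _ /=; rewrite EFinM.
  by move=> t /T0/h; rewrite mulN1r ler_norml lerNl => /andP[].
by apply: le_Rintegral => // t /T0/h; rewrite ler_norml => /andP[].
Qed.

Definition hoelder_on (a b K : R) (f : R -> R) : Prop :=
  forall s t, a <= s -> s <= t -> t <= b -> `|f t - f s| <= K * Num.sqrt (t - s).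

(** Extending f by its boundary values outside [a, b] gives a continuous,
    hence measurable function. *)
Lemma window_measurable a b K f : a <= b -> 0 <= K -> hoelder_on a b K f -> measurable_fun setT (window a b f).
Proof.
move=> ab K0 hf; pose cl (t : R) := Num.min (Num.max t a) b.
have clE t : a <= cl t /\ cl t <= b.
  by rewrite /cl ge_min lexx orbT le_min le_max lexx orbT ab.
have cl_mono s t : s <= t -> cl s <= cl t /\ cl t - cl s <= t - s.
  move=> st; rewrite /cl; have [sa|sa] := leP s a; have [ta|ta] := leP t a.
  - by rewrite subrr lexx subr_ge0.
  - by rewrite [Num.min a b]min_l//; have [tb|tb] := leP t b; lra.
  - by lra.
  by have [sb|sb] := leP s b; have [tb|tb] := leP t b; lra.
have hcl s t : s <= t -> `|f (cl t) - f (cl s)| <= K * Num.sqrt (t - s).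
  move=> st; have [c1 c2] := cl_mono s t st; have [s1 s2] := clE s; have [t1 t2] := clE t.
  apply: le_trans (hf _ _ s1 c1 t2) _; rewrite ler_wpM2l//; exact: ler_wsqrtr.
have cont : continuous (f \o cl).
  move=> x; apply/cvgrPdist_le => e e0.
  pose d := (e / (K + 1)) ^+ 2.
  have K1 : 0 < K + 1 by rewrite ltr_wpDl.
  have ek : 0 < e / (K + 1) by rewrite divr_gt0.
  have dd : 0 < d by rewrite exprn_gt0.
  have key s t : s <= t -> t - s <= d -> `|f (cl t) - f (cl s)| <= e.
    move=> st h; apply: le_trans (hcl s t st) _.
    apply: (@le_trans _ _ (K * (e / (K + 1)))).
      rewrite ler_wpM2l//; apply: le_trans (ler_wsqrtr h) _.
      by rewrite /d sqrtr_sqr gtr0_norm.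
    by rewrite mulrCA ler_piMr ?(ltW e0)// ler_pdivrMr// mul1r lerDl.
  near=> y.
  have yx : `|x - y| <= d.
    by near: y; apply: cvgr_dist_le => //; exact: cvg_id.
  have [xy|yx'] := leP x y.
    rewrite distrC; apply: key => //; move: yx; rewrite distrC ger0_norm ?subr_ge0//.
  by apply: key; [exact: ltW|move: yx; rewrite ger0_norm ?subr_ge0// ltW].
rewrite (_ : window a b f = (fun t => \1_([set` `[a, b[] : set R) t * (f \o cl) t)).
  apply: measurable_funM; first by apply: measurable_indic; exact: measurable_itv.
  exact: continuous_measurable_fun.
rewrite window_indic; apply: funext => t; rewrite indicE mem_setE in_itv /=.
case: (boolP (a <= t < b)) => [/andP[at_ tb]|_]; last by rewrite !mul0r.
by congr (_ * f _); rewrite /cl max_l// min_l// ltW.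
Unshelve. all: by end_near.
Qed.

Lemma window_integrable a b K f : 0 <= a -> a <= b -> 0 <= K -> hoelder_on a b K f ->
  exists v, rint (window a b f) v.
Proof.
move=> a0 ab K0 hf; exists (Rintegral leb times (window a b f)); split => //.
have mw := window_measurable ab K0 hf.
pose B := `|f a| + K * Num.sqrt (b - a).
have B0 : 0 <= B by rewrite addr_ge0// mulr_ge0 ?sqrtr_ge0.
have [gi _] := rint_window_cst B a0 ab.
apply: (le_integrable mtimes _ _ gi).
  by apply/measurable_EFinP; apply: measurable_funS mw.
move=> t _; rewrite !abse_EFin lee_fin /window; case: ifP => [/andP[at_ tb]|_]; last by [].
rewrite (ger0_norm B0) -[f t](subrK (f a)) addrC; apply: le_trans (ler_normD _ _) _.
rewrite lerD2l; apply: le_trans (hf a t (lexx a) at_ (ltW tb)) _.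
by rewrite ler_wpM2l// ler_wsqrtr// lerD2r ltW.
Qed.

Lemma window_subdivision a b pi n (f : R -> R) t : subdivision a b pi n ->
  window a b f t = \sum_(j < n) window (pi j) (pi j.+1) f t.
Proof.
case=> <- <- ; elim: n => [|n IH] hs.
  by rewrite big_ord0 /window; case: ifP => // /andP[h1 /(le_lt_trans h1)]; rewrite ltxx.
rewrite big_ord_recr /= -IH; last by move=> i hi; apply: hs; exact: ltnW.
have h0 : pi 0%N <= pi n.
  have sub : subdivision (pi 0%N) (pi n) pi n by split => // i hi; apply: hs; exact: ltnW.
  by have [] := subdivision_le sub (leqnn n).
have hn := hs n (ltnSn n).
rewrite /window; have [t1|t1] := boolP (t < pi n).
  by rewrite (lt_le_trans t1 hn) [pi n <= t]leNgt t1 /= addr0.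
rewrite -leNgt in t1; by rewrite (le_trans h0 t1) andbF add0r t1.
Qed.

(** On each cell f differs from its value at the left end point by at most K
    sqrt h. *)
Lemma riemann_sum_rate a b K f pi n h v : 0 <= a -> 0 <= K -> hoelder_on a b K f ->
  subdivision a b pi n -> (forall j, (j < n)%N -> pi j.+1 - pi j <= h) ->
  rint (window a b f) v ->
  `|v - \sum_(j < n) f (pi j) * (pi j.+1 - pi j)| <= K * Num.sqrt h * (b - a).
Proof.
move=> a0 K0 hf sub hh hv.
have ab : a <= b by have [] := subdivision_le sub (leqnn n); case: (sub) => _ ->.
have stp : rint (fun t => \sum_(j < n) window (pi j) (pi j.+1) (fun=> f (pi j)) t)
   (\sum_(j < n) f (pi j) * (pi j.+1 - pi j)).
  apply: rint_sum => j; apply: rint_window_cst; last by case: sub => _ _; apply.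
  by apply: le_trans a0 _; have [] := subdivision_le sub (ltnW (ltn_ord j)).
have df := rintD hv (rintZ (-1) stp).
have := rint_abs_le df (rint_window_cst (K * Num.sqrt h) a0 ab).
rewrite !mulN1r; apply => t t0; rewrite mulN1r.
rewrite !(window_subdivision _ _ sub) -sumrB.
apply: le_trans (ler_norm_sum _ _ _) _; apply: ler_sum => j _; rewrite /window.
case: ifP => [/andP[t1 t2]|_]; last by rewrite subrr normr0.
have [l1 l2] := subdivision_le sub (ltnW (ltn_ord j)).
have [u1 u2] := subdivision_le sub (ltn_ord j).
apply: le_trans (hf _ _ l1 t1 (le_trans (ltW t2) u2)) _.
rewrite ler_wpM2l//; apply: ler_wsqrtr; apply: le_trans (hh j (ltn_ord j)).
by rewrite lerD2r ltW.
Qed.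

End RealIntegrals.

Section SquareIntegrals.
Context (R : realType).
Local Notation leb := (@lebesgue_measure R).
Local Notation times := ([set` `[0%R, +oo[%R] : set R).

Lemma rint_integral (f : R -> R) v : rint f v -> (\int[leb]_(s in times) (f s)%:E)%E = v%:E.
Proof.
move=> [fi <-]; rewrite /Rintegral fineK//; exact: integrable_fin_num.
Qed.

Lemma integral_rint (f : R -> R) v : measurable_fun times f -> (forall t, 0 <= f t) ->
  (\int[leb]_(s in times) (f s)%:E)%E = v%:E -> rint f v.
Proof.
move=> mf f0 fv; split; last by rewrite /Rintegral fv.
apply/integrableP; split; first exact/measurable_EFinP.
under eq_integral do rewrite gee0_abs ?lee_fin//.
by rewrite fv ltry.
Qed.

Lemma rint_dominated (f g : R -> R) w : measurable_fun ([set` `[0%R, +oo[%R] : set R) f ->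
  (forall t, 0 <= t -> 0 <= f t /\ f t <= g t) -> rint g w ->
  exists v, [/\ rint f v, 0 <= v & v <= w].
Proof.
move=> mf h hg; have mt : @measurable _ (measurableTypeR R) [set` `[0%R, +oo[%R] by exact: measurable_itv.
have fi : rint f (Rintegral (@lebesgue_measure R) [set` `[0%R, +oo[%R] f).
  split => //; have [gi _] := hg; apply: (le_integrable mt _ _ gi); first exact/measurable_EFinP.
  move=> t; rewrite /= in_itv /= andbT => /h[h1 h2].
  by rewrite lee_fin !ger0_norm// (le_trans h1).
exists (Rintegral (@lebesgue_measure R) [set` `[0%R, +oo[%R] f); split => //.
  by apply: Rintegral_ge0 => t; rewrite /= in_itv /= andbT => /h[].
apply: le_trans (ler_norm _) _; apply: rint_abs_le fi hg _ => t /h[h1 h2].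
by rewrite ger0_norm.
Qed.

End SquareIntegrals.

(** * Weak integrals in L2 *)

Section CellPoints.
Context (R : realType).

Definition cell_points (a b : R) n i : R := a + even_points (b - a) n i.

Lemma cell_subdivision a b n : a <= b -> (0 < n)%N -> subdivision a b (cell_points a b n) n.
Proof.
move=> ab n0; have [h0 hn hs] : subdivision 0 (b - a) (even_points (b - a) n) n.
  by apply: even_subdivision; rewrite ?subr_ge0.
split; rewrite /cell_points ?h0 ?hn ?addr0//; first by rewrite addrC subrK.
by move=> i hi; rewrite lerD2l hs.
Qed.

Lemma cell_step a b n i : cell_points a b n i.+1 - cell_points a b n i = (b - a) / n%:R.
Proof. by rewrite /cell_points opprD addrACA subrr add0r even_step. Qed.

Lemma cell_points_start (a b : R) N : cell_points a b N.+1 0 = a.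
Proof. by rewrite /cell_points /even_points !mul0r addr0. Qed.

Lemma cell_points_end (a b : R) N : cell_points a b N.+1 N.+1 = b.
Proof.
by rewrite /cell_points /even_points divff ?pnatr_eq0// mul1r addrC subrK.
Qed.

End CellPoints.

Section WeakIntegral.
Context (R : realType) (A : tracialVNA R) (L : L2completion A).
Local Notation Re := complex.Re.
Local Notation dL := (L2dot L).
Local Notation hd := (dot_semi_inner dL).
Implicit Types (f g : R -> L) (xi eta : L).

Lemma hnorm_L2emb x : hnorm dL (L2emb L x) = nrm x.
Proof. by rewrite /nrm /hnorm /trd L2emb_dot. Qed.

Lemma weak_integral_ext f g xi : (forall t, 0 <= t -> f t = g t) ->
  is_L2_integral f xi -> is_L2_integral g xi.
Proof. by move=> h hf eta; apply: rint_ext (hf eta) => t t0; rewrite h. Qed.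

Lemma weak_integral0 : is_L2_integral (fun=> 0 : L) 0.
Proof.
move=> eta; rewrite (semi0l hd) /=.
exact: rint0.
Qed.

Lemma weak_integralD f g xi eta : is_L2_integral f xi -> is_L2_integral g eta ->
  is_L2_integral (fun t => f t + g t) (xi + eta).
Proof.
move=> hf hg z; rewrite (semiDl hd) ReD; apply: rint_ext (rintD (hf z) (hg z)) => t _.
by rewrite (semiDl hd) ReD.
Qed.

Lemma weak_integralN f xi : is_L2_integral f xi -> is_L2_integral (fun t => - f t) (- xi).
Proof.
move=> hf z; rewrite (semiNl hd) ReN -mulN1r; apply: rint_ext (rintZ (-1) (hf z)) => t _.
by rewrite (semiNl hd) ReN mulN1r.
Qed.

Lemma weak_integral_sum (I : Type) (r : seq I) (f : I -> R -> L) (xi : I -> L) :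
  (forall i, is_L2_integral (f i) (xi i)) ->
  is_L2_integral (fun t => \sum_(i <- r) f i t) (\sum_(i <- r) xi i).
Proof.
move=> h; elim: r => [|i r IH].
  rewrite big_nil; apply: weak_integral_ext weak_integral0 => t _; by rewrite big_nil.
rewrite big_cons; apply: weak_integral_ext (weak_integralD (h i) IH) => t _; by rewrite big_cons.
Qed.

Lemma weak_integral_unique f xi eta : is_L2_integral f xi -> is_L2_integral f eta -> xi = eta.
Proof. by move=> h h'; apply: dot_inj => z; exact: rint_unique (h z) (h' z). Qed.

Lemma weak_integral_window_cst a b x : 0 <= a -> a <= b ->
  is_L2_integral (fun t => if a <= t < b then x else 0 : L) ((b - a)%:C *: x).
Proof.
move=> a0 ab z; rewrite (semiZl hd) Re_rM mulrC.
apply: rint_ext (rint_window_cst (Re (dL x z)) a0 ab) => t _.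
by rewrite /window; case: ifP => // _; rewrite (semi0l hd).
Qed.

Definition riemann_sum (g : R -> A) (pi : nat -> R) n : A :=
  \sum_(j < n) (pi j.+1 - pi j)%:C *: g (pi j).

Section Hoelder.
Context (a b K : R) (g : R -> A) (a0 : 0 <= a) (ab : a <= b) (K0 : 0 <= K).
Hypothesis hg : forall s t, a <= s -> s <= t -> t <= b -> nrm (g t - g s) <= K * Num.sqrt (t - s).

Let pairing_hoelder eta : hoelder_on a b (K * hnorm dL eta) (fun t => Re (dL (L2emb L (g t)) eta)).
Proof.
move=> s t h1 h2 h3; rewrite -ReB -(semiNl hd) -(semiDl hd) -linearB.
apply: le_trans (cauchy_schwarz_Re hd _ _) _; rewrite hnorm_L2emb mulrAC.
by rewrite ler_wpM2r ?hnorm_ge0// hg.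
Qed.

Let pairing_integral eta := cid (window_integrable a0 ab (mulr_ge0 K0 (hnorm_ge0 dL eta)) (@pairing_hoelder eta)).
Let v eta := projT1 (pairing_integral eta).

Let v_rint eta : rint (window a b (fun t => Re (dL (L2emb L (g t)) eta))) (v eta).
Proof. exact: (projT2 (pairing_integral eta)). Qed.

Let v_rate eta pi n h : subdivision a b pi n -> (forall j, (j < n)%N -> pi j.+1 - pi j <= h) ->
  `|v eta - Re (dL (L2emb L (riemann_sum g pi n)) eta)| <= K * hnorm dL eta * Num.sqrt h * (b - a).
Proof.
move=> sub hh; have e0 := hnorm_ge0 dL eta.
have := riemann_sum_rate a0 (mulr_ge0 K0 e0) (@pairing_hoelder eta) sub hh (v_rint eta).
congr (`|_ - _| <= _); rewrite /riemann_sum linear_sum (Re_semi_suml hd) Re_sum.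
by apply: eq_bigr => j _; rewrite linearZ (semiZl hd) Re_rM mulrC.
Qed.

Let riemann_close pi n h pi' n' h' :
  subdivision a b pi n -> (forall j, (j < n)%N -> pi j.+1 - pi j <= h) ->
  subdivision a b pi' n' -> (forall j, (j < n')%N -> pi' j.+1 - pi' j <= h') ->
  hnorm dL (L2emb L (riemann_sum g pi n) - L2emb L (riemann_sum g pi' n')) <=
    K * (Num.sqrt h + Num.sqrt h') * (b - a).
Proof.
move=> s1 h1 s2 h2; set x := L2emb L _; set y := L2emb L (riemann_sum _ pi' _).
pose eta := x - y; have r1 := v_rate eta s1 h1; have r2 := v_rate eta s2 h2.
have e0 := hnorm_ge0 dL eta.
have [e00|en] := eqVneq (hnorm dL eta) 0.
  by rewrite e00 !mulr_ge0 ?subr_ge0// addr_ge0 ?sqrtr_ge0.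
rewrite -(ler_pM2r (x := hnorm dL eta)) ?lt_def ?en// -expr2 (hnorm_sqr hd).
have -> : dL eta eta = dL x eta - dL y eta by rewrite -(semiNl hd) -(semiDl hd).
rewrite ReB.
move: r1 r2; rewrite -/x -/y !ler_norml => /andP[r1 r1'] /andP[r2 r2'].
rewrite (_ : K * _ * _ * _ = K * hnorm dL eta * Num.sqrt h * (b - a) + K * hnorm dL eta * Num.sqrt h' * (b - a)); last by ring.
lra.
Qed.

(** The Riemann sums converge weakly at a rate which is uniform on the unit
    ball. Testing the difference of two of them against itself shows that
    they form a Cauchy family in norm, and their limit is the integral. *)
Lemma weak_integral_window : exists2 xi,
  is_L2_integral (fun t => L2emb L (if a <= t < b then g t else 0)) xi &
  forall pi n h, subdivision a b pi n -> (forall j, (j < n)%N -> pi j.+1 - pi j <= h) ->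
    hnorm dL (xi - L2emb L (riemann_sum g pi n)) <= K * Num.sqrt h * (b - a).
Proof.
pose S N := L2emb L (riemann_sum g (cell_points a b N.+1) N.+1).
pose h N := (b - a) / N.+1%:R.
have sub N : subdivision a b (cell_points a b N.+1) N.+1 by exact: cell_subdivision.
have mesh N j : (j < N.+1)%N -> cell_points a b N.+1 j.+1 - cell_points a b N.+1 j <= h N.
  by move=> _; rewrite cell_step.
have vh : vanish (fun N => K * Num.sqrt (h N) * (b - a)).
  apply: (@vanish_lew _ _ (fun N => (K * (b - a)) * Num.sqrt (h N))) => [N|].
    by rewrite mulrAC.
  apply: vanishZ; first by rewrite mulr_ge0// subr_ge0.
  by apply: vanish_sqrt; exact: vanish_inv.
have [xi hxi] : exists xi, hcvg dL S xi.
  apply: L2_complete => e e0; have e3 : 0 < e / 3 by rewrite divr_gt0.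
  have [N hN] := vh _ e3; exists N => i j hi hj.
  apply: le_lt_trans (riemann_close (sub i) (mesh i) (sub j) (mesh j)) _.
  have := hN i hi; have := hN j hj; rewrite [K * _ * _]mulrAC mulrDr.
  rewrite (mulrAC K _ (b - a)) (mulrAC K _ (b - a)); lra.
have vxi := cvg_vanish hxi.
exists xi.
  move=> eta.
  have -> : Re (dL xi eta) = v eta.
    have e0 := hnorm_ge0 dL eta.
    apply/eqP; rewrite -subr_eq0 -normr_le0.
    apply: (vanish_bound (vanishD (vanishZ e0 vxi) (vanishZ e0 vh))); exists 0%N => N _.
    have := v_rate eta (sub N) (mesh N); rewrite -/(S N) => r.
    have := cauchy_schwarz_Re hd (S N - xi) eta; rewrite (semiDl hd) (semiNl hd) ReB => r'.
    rewrite add0r; apply: (@le_trans _ _ (`|Re (dL (S N) eta) - Re (dL xi eta)| + `|v eta - Re (dL (S N) eta)|)).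
      rewrite (_ : Re (dL xi eta) - v eta = - ((Re (dL (S N) eta) - Re (dL xi eta)) + (v eta - Re (dL (S N) eta)))); last by ring.
      by rewrite normrN ler_normD.
    apply: lerD; first by rewrite mulrC.
    apply: le_trans r _; rewrite le_eqVlt; apply/orP; left; apply/eqP; ring.
  apply: rint_ext (v_rint eta) => t _; rewrite /window; case: ifP => // _.
  by rewrite linear0 (semi0l hd).
move=> pi n h0 sp hh; apply: (vanish_bound (vanishD vxi vh)); exists 0%N => N _.
apply: le_trans (hnorm_triangle3 hd (S N) _ _) _; rewrite (hnormBC hd).
have := riemann_close (sub N) (mesh N) sp hh; rewrite -/(S N).
rewrite (_ : K * (_ + _) * _ = K * Num.sqrt (h N) * (b - a) + K * Num.sqrt h0 * (b - a)); last by ring.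
lra.
Qed.

End Hoelder.
End WeakIntegral.

(** * Refining a grid *)

Section GridWindows.
Context (R : realType).
Implicit Types (tau : nat -> R) (t : R).

Lemma grid_windows (Y : zmodType) (tau : nat -> R) n (F : R -> Y) t : grid tau n -> 0 <= t ->
  (tau n <= t -> F t = 0) ->
  F t = \sum_(i < n) (if tau i <= t < tau i.+1 then F t else 0).
Proof.
move=> g t0 Fe; have [[i hi [h1 h2]]|h] := grid_locate g t0; last first.
  by rewrite Fe// big1// => i _; case: ifP.
rewrite (bigD1 (Ordinal hi))//= h1 h2 big1 ?addr0// => j ji.
case: ifP => // /andP[h3 h4]; move: ji; rewrite -val_eqE /= neq_ltn => /orP[ji|ij].
  by have := grid_le g ji (ltnW hi); rewrite leNgt (le_lt_trans h1 h4).
by have := grid_le g ij (ltnW (ltn_ord j)); rewrite leNgt (le_lt_trans h3 h2).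
Qed.

Lemma grid_sum_map (Y Z : zmodType) (F : Y -> Z) tau n (a : nat -> Y) t : grid tau n -> 0 <= t -> F 0 = 0 ->
  F (\sum_(i < n) (if tau i <= t < tau i.+1 then a i else 0)) =
  \sum_(i < n) (if tau i <= t < tau i.+1 then F (a i) else 0).
Proof.
move=> g t0 F0.
have one (V : zmodType) (b : nat -> V) i : (i < n)%N -> tau i <= t -> t < tau i.+1 ->
    \sum_(j < n) (if tau j <= t < tau j.+1 then b j else 0) = b i.
  move=> hi h1 h2; rewrite (bigD1 (Ordinal hi))//= h1 h2 big1 ?addr0// => j ji.
  case: ifP => // /andP[h3 h4]; move: ji; rewrite -val_eqE /= neq_ltn => /orP[ji|ij].
    by have := grid_le g ji (ltnW hi); rewrite leNgt (le_lt_trans h1 h4).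
  by have := grid_le g ij (ltnW (ltn_ord j)); rewrite leNgt (le_lt_trans h3 h2).
have [[i hi [h1 h2]]|h] := grid_locate g t0.
  by rewrite (one _ a i hi h1 h2) (one _ (fun j => F (a j)) i hi h1 h2).
have out (j : 'I_n) : (tau j <= t < tau j.+1) = false.
  by apply/negbTE; rewrite negb_and -!leNgt (le_trans (grid_le g (ltn_ord j) (leqnn n)) h) orbT.
by rewrite !big1 => [|j _|j _]; rewrite ?out.
Qed.

End GridWindows.

Section Refinement.
Context (R : realType).
Implicit Types (tau : nat -> R).

(** Each cell of the grid tau is cut into N + 1 equal parts. *)
Definition refined tau N l : R :=
  cell_points (tau (l %/ N.+1)%N) (tau (l %/ N.+1).+1) N.+1 (l %% N.+1).

Lemma refined_next tau N l : refined tau N l.+1 =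
  cell_points (tau (l %/ N.+1)%N) (tau (l %/ N.+1).+1) N.+1 (l %% N.+1).+1.
Proof.
have h := divn_eq l N.+1; have := ltn_pmod l (isT : 0 < N.+1)%N.
rewrite {1}/refined leq_eqVlt ltnS => /orP[/eqP e|lt].
  have e2 : l.+1 = ((l %/ N.+1).+1 * N.+1)%N by rewrite mulSn addnC {1}h -addnS e.
  by rewrite e cell_points_end e2 mulnK// modnMl cell_points_start.
have e2 : l.+1 = (l %/ N.+1 * N.+1 + (l %% N.+1).+1)%N by rewrite addnS -h.
have lt' : ((l %% N.+1).+1 < N.+1)%N by [].
by rewrite e2 divnMDl// modnMDl (divn_small lt') addn0 (modn_small lt').
Qed.

Lemma refined_step tau N l : refined tau N l.+1 - refined tau N l =
  (tau (l %/ N.+1).+1 - tau (l %/ N.+1)%N) / N.+1%:R.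
Proof. by rewrite refined_next cell_step. Qed.

Lemma refined_cell tau n N l : (l < n * N.+1)%N -> (l %/ N.+1 < n)%N.
Proof. by rewrite ltn_divLR. Qed.

Lemma refined_grid tau n N : grid tau n -> grid (refined tau N) (n * N.+1).
Proof.
move=> [t0 ht]; split; first by rewrite /refined div0n mod0n cell_points_start.
move=> l /(refined_cell tau) hl; rewrite -subr_gt0 refined_step divr_gt0// subr_gt0; exact: ht.
Qed.

Lemma refined_end tau n N : refined tau N (n * N.+1) = tau n.
Proof. by rewrite /refined mulnK// modnMl cell_points_start. Qed.

Lemma refined_mesh tau n N l : grid tau n -> (l < n * N.+1)%N ->
  refined tau N l.+1 - refined tau N l <= tau n / N.+1%:R.
Proof.
move=> g /(refined_cell tau) hl; rewrite refined_step ler_wpM2r ?invr_ge0//.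
have h1 := grid_ge0 g (ltnW hl); have h2 := grid_le g hl (leqnn n); lra.
Qed.

Lemma refined_sub tau n N l : grid tau n -> (l < n * N.+1)%N ->
  tau (l %/ N.+1)%N <= refined tau N l /\ refined tau N l.+1 <= tau (l %/ N.+1).+1.
Proof.
move=> g /(refined_cell tau) hl; have ht := ltW (g.2 _ hl).
have sub := cell_subdivision ht (isT : 0 < N.+1)%N; rewrite refined_next; split.
  by have [] := subdivision_le sub (ltnW (ltn_pmod l (isT : 0 < N.+1)%N)).
by have [] := subdivision_le sub (ltn_pmod l (isT : 0 < N.+1)%N).
Qed.

End Refinement.

(** * Continuity of the stochastic integral *)

Section Estimate.
Context (R : realType) (A : tracialVNA R) (L : L2completion A).
Context (At : R -> set A) (X : R -> R -> A) (m : nat -> R -> R) (kap : nat -> R).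
Hypothesis hX : free_increments At X m kap.
Context (Delta : nat -> R -> R -> A).
Hypothesis hD : diagonal_measures X Delta.

(** On a common grid V - V' is a step biprocess, to which
    step_integral_bound applies. Its L2 norm and the integral of its product
    are those of the difference of V - W and V' - W. *)
Lemma sint_difference k (V V' W : biprocess A) x y (xi eta : L) :
  simple At V -> simple At V' ->
  rint (fun t => tnorm2 (V t - W t) ^+ 2) x -> rint (fun t => tnorm2 (V' t - W t) ^+ 2) y ->
  is_L2_integral (fun t => L2emb L (tmul (V t - W t))) xi ->
  is_L2_integral (fun t => L2emb L (tmul (V' t - W t))) eta ->
  nrm (sint At (Delta k.+1 0) V - sint At (Delta k.+1 0) V') <=
    Num.sqrt (`|kap (k.+1 * 2)%N| * (2 * (x + y))) + `|kap k.+1| * hnorm (L2dot L) (xi - eta).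
Proof.
move=> [s hs] [s' hs'] hx hy hxi heta.
pose d : biprocess A := fun t => V t - V' t.
have hd : represents At (s ++ opp_steps s') d by exact: represents_cat hs (represents_opp hX hs').
have [tau [n [g on _]]] := steps_grid_ex hd.1 (pts := [::]) (fun x => ltac:(by [])).
rewrite -(sint_sub hX _ hs hs') (sint_ssum _ hd) (ssum_grid _ hd g on).
have mono i : (i < n)%N -> tau i <= tau i.+1 by move=> hi; rewrite (grid_le g).
have tau0 i : (i < n)%N -> 0 <= tau i by move=> hi; rewrite (grid_ge0 g)// ltnW.
have adp i : (i < n)%N -> adapted_at At (tau i) (d (tau i)).
  by move=> hi; apply: (represents_adapted hX hd); exact: tau0.
have t00 : 0 <= tau 0%N by rewrite g.1.
apply: le_trans (step_integral_bound hX hD (isT : 0 < k.+1)%N t00 mono adp) _.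
have wcell (Y : zmodType) (F : tpow 2 A -> Y) t : F 0 = 0 -> 0 <= t ->
    F (d t) = \sum_(i < n) (if tau i <= t < tau i.+1 then F (d (tau i)) else 0).
  move=> F0 tt; have /= -> := grid_windows (F := F \o d) g tt; last first.
    by move=> h; rewrite hd.2// (step_sum_end g on).
  apply: eq_bigr => i _; case: ifP => // /andP[h1 h2].
  by rewrite !hd.2 ?tau0// (step_sum_cell g on (ltn_ord i) h1 h2).
have i1 : rint (fun t => tnorm2 (d t) ^+ 2) (\sum_(i < n) tnorm2 (d (tau i)) ^+ 2 * (tau i.+1 - tau i)).
  apply: (rint_ext (f := fun t => \sum_(i < n) window (tau i) (tau i.+1) (fun=> tnorm2 (d (tau i)) ^+ 2) t)).
    move=> t tt; rewrite (wcell _ (fun u => tnorm2 u ^+ 2))//.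
    by rewrite tnorm2_hnorm (hnorm0 (tdot_semi A)) expr0n.
  by apply: rint_sum => i; apply: rint_window_cst; rewrite ?tau0 ?mono.
have i2 : is_L2_integral (fun t => L2emb L (tmul (d t)))
    (L2emb L (\sum_(i < n) (tau i.+1 - tau i)%:C *: tmul (d (tau i)))).
  rewrite linear_sum.
  apply: (weak_integral_ext (f := fun t => \sum_(i < n) (if tau i <= t < tau i.+1 then L2emb L (tmul (d (tau i))) else 0))).
    by move=> t tt; rewrite (wcell _ (fun u => L2emb L (tmul u)))// tmul0 linear0.
  apply: weak_integral_sum => i; rewrite linearZ.
  by apply: weak_integral_window_cst; rewrite ?tau0 ?mono.
have i3 : is_L2_integral (fun t => L2emb L (tmul (d t))) (xi - eta).
  apply: weak_integral_ext (weak_integralD hxi (weak_integralN heta)) => t _.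
  by rewrite -linearB -tmulB opprB addrA subrK.
apply: lerD; last by rewrite -(hnorm_L2emb L) (weak_integral_unique i2 i3).
apply: ler_wsqrtr; rewrite ler_wpM2l//.
have := rint_abs_le i1 (rintZ 2 (rintD hx hy)).
move=> /(_ _)/(le_trans (ler_norm _)) h; rewrite (eq_bigr _ (fun i _ => mulrC _ _)); apply: h => t _.
rewrite ger0_norm ?sqr_ge0//; have := hnormB_sqr_le (tdot_semi A) (V t - W t) (V' t - W t).
by rewrite opprB addrA subrK.
Qed.

End Estimate.

(** * Integrals of piecewise Hoelder biprocesses *)

Section Discretization.
Context (R : realType) (A : tracialVNA R) (L : L2completion A).
Context (At : R -> set A) (X : R -> R -> A) (m : nat -> R -> R) (kap : nat -> R).
Hypothesis hX : free_increments At X m kap.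
Implicit Types (tau : nat -> R) (G : nat -> biprocess A) (W : biprocess A) (K : R).
Local Notation times := ([set` `[0%R, +oo[%R] : set R).

(** W may jump at the points of the grid; G i is its Hoelder continuous
    version up to the right end of the i-th cell. *)
Record piecewise_hoelder tau n G K W : Prop := PiecewiseHoelder {
  ph_grid : grid tau n;
  ph_K : 0 <= K;
  ph_end : forall t, tau n <= t -> W t = 0;
  ph_cell : forall i t, (i < n)%N -> tau i <= t -> t < tau i.+1 -> W t = G i t;
  ph_adapted : forall t, 0 <= t -> adapted_at At t (W t);
  ph_hoelder : forall i s t, (i < n)%N -> tau i <= s -> s <= t -> t <= tau i.+1 ->
    tnorm2 (G i t - G i s) <= K * Num.sqrt (t - s) /\
    nrm (tmul (G i t) - tmul (G i s)) <= K * Num.sqrt (t - s) }.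

Lemma piecewise_hoelder_refined tau n G K W N : piecewise_hoelder tau n G K W ->
  piecewise_hoelder (refined tau N) (n * N.+1) (fun l => G (l %/ N.+1)%N) K W.
Proof.
case=> g K0 he hc ha hh; split => //; first exact: refined_grid.
- by move=> t; rewrite refined_end; exact: he.
- move=> l t hl h1 h2; have [s1 s2] := refined_sub g hl.
  by apply: hc; rewrite ?(refined_cell tau hl) ?(le_trans s1)// (lt_le_trans h2).
- move=> l s t hl h1 h2 h3; have [s1 s2] := refined_sub g hl.
  by apply: hh; rewrite ?(refined_cell tau hl) ?(le_trans s1)// (le_trans h3).
Qed.

Definition discretize tau n W : biprocess A := fun t =>
  \sum_(i < n) piece (tau i) (tau i.+1) (W (tau i)) t.

Section Cells.
Context (tau : nat -> R) (n : nat) (G : nat -> biprocess A) (K : R) (W : biprocess A).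
Hypothesis hW : piecewise_hoelder tau n G K W.

Let g := ph_grid hW.
Let K0 := ph_K hW.
Let tau_ge0 i : (i < n)%N -> 0 <= tau i. Proof. by move=> hi; apply: (grid_ge0 g); exact: ltnW. Qed.
Let tau_le i : (i < n)%N -> tau i <= tau i.+1. Proof. by move=> hi; exact: ltW (g.2 i hi). Qed.

Lemma discretize_represents : exists2 s, represents At s (discretize tau n W) &
  forall D, ssum D s = \sum_(i < n) act (W (tau i)) (D (tau i.+1) - D (tau i)).
Proof.
apply: (sum_represents (index_enum _) (F := fun i : 'I_n => piece (tau i) (tau i.+1) (W (tau i)))
  (G := fun D (i : 'I_n) => act (W (tau i)) (D (tau i.+1) - D (tau i)))) => i.
by apply: piece_represents; rewrite ?tau_ge0 ?tau_le//; apply: (ph_adapted hW); exact: tau_ge0.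
Qed.

Let error t : 0 <= t -> discretize tau n W t - W t =
  \sum_(i < n) (if tau i <= t < tau i.+1 then G i (tau i) - G i t else 0).
Proof.
move=> t0; rewrite (grid_windows (F := W) g t0); last exact: (ph_end hW).
rewrite -sumrB; apply: eq_bigr => i _; rewrite /piece; case: ifP => [/andP[h1 h2]|_]; last exact: subrr.
by rewrite (ph_cell hW (ltn_ord i) (lexx _)) ?g.2// (ph_cell hW (ltn_ord i) h1 h2).
Qed.

Let error_map (Y : zmodType) (F : tpow 2 A -> Y) t : 0 <= t -> F 0 = 0 ->
  F (discretize tau n W t - W t) =
  \sum_(i < n) (if tau i <= t < tau i.+1 then F (G i (tau i) - G i t) else 0).
Proof.
by move=> t0 F0; rewrite error// (@grid_sum_map _ _ _ F tau n (fun i => G i (tau i) - G i t) t g t0 F0).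
Qed.

Let tnorm20 : tnorm2 (0 : tpow 2 A) = 0. Proof. exact: (hnorm0 (tdot_semi A)). Qed.

Lemma discretize_measurable : measurable_fun times (fun t => tnorm2 (discretize tau n W t - W t)).
Proof.
pose f (i : 'I_n) := window (tau i) (tau i.+1) (fun t => tnorm2 (G i (tau i) - G i t)).
apply: (eq_measurable_fun (fun t => \sum_(i < n) f i t)).
  move=> t; rewrite inE /= in_itv /= andbT => t0.
  by rewrite (@error_map _ (@tnorm2 R A) _ t0 tnorm20).
apply: measurable_sum => i; apply: measurable_funTS.
apply: (window_measurable (K := K)); rewrite ?tau_le// => s t h1 h2 h3.
apply: le_trans (ler_hnormB (tdot_semi A) _ _) _.
rewrite opprB addrC addrA subrK -tnorm2_hnorm tnorm2_hnorm (hnormBC (tdot_semi A)).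
by have [] := ph_hoelder hW (ltn_ord i) h1 h2 h3.
Qed.

(** On each cell the error is at most K sqrt h. It vanishes at the left end
    point, so the Riemann sum with a single point bounds its weak integral. *)
Lemma discretize_close h : 0 <= h -> (forall i, (i < n)%N -> tau i.+1 - tau i <= h) ->
  exists x xi, [/\ rint (fun t => tnorm2 (discretize tau n W t - W t) ^+ 2) x,
    0 <= x /\ x <= K ^+ 2 * h * tau n,
    is_L2_integral (fun t => L2emb L (tmul (discretize tau n W t - W t))) xi &
    hnorm (L2dot L) xi <= K * Num.sqrt h * tau n].
Proof.
move=> h0 hh.
have len : \sum_(i < n) (tau i.+1 - tau i) = tau n.
  have sub : subdivision (tau 0%N) (tau n) tau n by split => // i hi; exact: tau_le.
  by rewrite (subdivision_length sub) g.1 subr0.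
have hs i t : (i < n)%N -> tau i <= t -> t < tau i.+1 -> Num.sqrt (t - tau i) <= Num.sqrt h.
  by move=> hi h1 h2; apply: ler_wsqrtr; apply: le_trans (hh i hi); rewrite lerD2r ltW.
have [x [rx x0 xle]] : exists x, [/\ rint (fun t => tnorm2 (discretize tau n W t - W t) ^+ 2) x,
    0 <= x & x <= \sum_(i < n) (K ^+ 2 * h) * (tau i.+1 - tau i)].
  apply: (rint_dominated (g := fun t => \sum_(i < n) window (tau i) (tau i.+1) (fun=> K ^+ 2 * h) t)).
  - by apply: measurable_funX; exact: discretize_measurable.
  - move=> t t0; split; first exact: sqr_ge0.
    rewrite (@error_map _ (fun u => tnorm2 u ^+ 2) _ t0) ?tnorm20 ?expr0n//.
    apply: ler_sum => i _; rewrite /window; case: ifP => // /andP[h1 h2].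
    have [e _] := ph_hoelder hW (ltn_ord i) (lexx _) h1 (ltW h2).
    rewrite tnorm2_hnorm (hnormBC (tdot_semi A)) -tnorm2_hnorm -(sqr_sqrtr h0) -exprMn.
    rewrite lerXn2r ?nnegrE ?tnorm2_ge0 ?mulr_ge0 ?sqrtr_ge0//.
    by apply: le_trans e _; rewrite ler_wpM2l// hs.
  by apply: rint_sum => i; apply: rint_window_cst; rewrite ?tau_ge0 ?tau_le.
have cell i : exists xi, (i < n)%N ->
    is_L2_integral (fun t => L2emb L (if tau i <= t < tau i.+1 then tmul (G i (tau i) - G i t) else 0)) xi /\
    hnorm (L2dot L) xi <= K * Num.sqrt h * (tau i.+1 - tau i).
  have [hi|hi] := ltnP i n; last by exists 0.
  have hg s t : tau i <= s -> s <= t -> t <= tau i.+1 ->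
      nrm (tmul (G i (tau i) - G i t) - tmul (G i (tau i) - G i s)) <= K * Num.sqrt (t - s).
    move=> h1 h2 h3; rewrite !tmulB opprB addrC addrA subrK nrmBC.
    by have [] := ph_hoelder hW hi h1 h2 h3.
  have [xi xi1 xi2] := weak_integral_window L (tau_ge0 hi) (tau_le hi) K0 hg.
  exists xi => _; split => //.
  pose pi j := if j is 0%N then tau i else tau i.+1.
  have sub : subdivision (tau i) (tau i.+1) pi 1 by split => //; case=> // _; exact: tau_le.
  have mesh j : (j < 1)%N -> pi j.+1 - pi j <= h by case: j => // _; exact: hh.
  have := xi2 pi 1%N h sub mesh.
  by rewrite /riemann_sum big_ord1 /= subrr tmul0 scaler0 linear0 subr0.
have [xi hxi] := boolp.choice cell.
exists x, (\sum_(i < n) xi i); split => //.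
- by split => //; rewrite -len mulr_sumr.
- apply: (weak_integral_ext (f := fun t => \sum_(i < n)
     L2emb L (if tau i <= t < tau i.+1 then tmul (G i (tau i) - G i t) else 0))).
    move=> t t0; rewrite (@error_map _ (fun u => tmul u) _ t0 (tmul0 A)).
    by rewrite linear_sum.
  by apply: weak_integral_sum => i; have [] := hxi i (ltn_ord i).
apply: le_trans (hnorm_sum (dot_semi_inner (L2dot L)) _ _ _) _.
rewrite -len mulr_sumr; apply: ler_sum => i _.
by have [] := hxi i (ltn_ord i).
Qed.

End Cells.

Section Integral.
Context (Delta : nat -> R -> R -> A).
Hypothesis hD : diagonal_measures X Delta.
Context (tau : nat -> R) (n : nat) (G : nat -> biprocess A) (K : R) (W : biprocess A).
Hypothesis hW : piecewise_hoelder tau n G K W.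

Definition refined_sum k N : A := \sum_(l < n * N.+1)
  act (W (refined tau N l)) (increment Delta k (refined tau N l) (refined tau N l.+1)).

Let Wn N := discretize (refined tau N) (n * N.+1) W.
Let hWn N := piecewise_hoelder_refined N hW.
Let h N := tau n / N.+1%:R.

Let sint_Wn k N : sint At (Delta k 0) (Wn N) = refined_sum k N.
Proof. by have [s hs hsum] := discretize_represents (hWn N); rewrite (sint_ssum _ hs) hsum. Qed.

Let simple_Wn N : simple At (Wn N).
Proof. by have [s hs _] := discretize_represents (hWn N); exists s. Qed.

Let tn0 : 0 <= tau n. Proof. exact: (grid_ge0 (ph_grid hW)). Qed.

Let close N : exists c : R * L, [/\ rint (fun t => tnorm2 (Wn N t - W t) ^+ 2) c.1,
    0 <= c.1 /\ c.1 <= K ^+ 2 * h N * tau n,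
    is_L2_integral (fun t => L2emb L (tmul (Wn N t - W t))) c.2 &
    hnorm (L2dot L) c.2 <= K * Num.sqrt (h N) * tau n].
Proof.
have h0 : 0 <= h N by rewrite divr_ge0.
have mesh l : (l < n * N.+1)%N -> refined tau N l.+1 - refined tau N l <= h N.
  exact: refined_mesh (ph_grid hW).
have [x [xi H]] := discretize_close (hWn N) h0 mesh; rewrite refined_end in H.
by exists (x, xi).
Qed.

Let x N := (projT1 (cid (close N))).1.
Let xi N := (projT1 (cid (close N))).2.
Let closeP N : [/\ rint (fun t => tnorm2 (Wn N t - W t) ^+ 2) (x N),
    0 <= x N /\ x N <= K ^+ 2 * h N * tau n,
    is_L2_integral (fun t => L2emb L (tmul (Wn N t - W t))) (xi N) &
    hnorm (L2dot L) (xi N) <= K * Num.sqrt (h N) * tau n].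
Proof. exact: (projT2 (cid (close N))). Qed.

Let vanish_x : vanish x.
Proof.
apply: (@vanish_lew _ _ (fun N => K ^+ 2 * tau n * h N)) => [N|].
  by have [_ [_ +] _ _] := closeP N; rewrite mulrAC.
by apply: vanishZ; [rewrite mulr_ge0 ?sqr_ge0|exact: vanish_inv].
Qed.

Let vanish_xi : vanish (fun N => hnorm (L2dot L) (xi N)).
Proof.
apply: (@vanish_lew _ _ (fun N => K * tau n * Num.sqrt (h N))) => [N|].
  by have [_ _ _ +] := closeP N; rewrite mulrAC.
by apply: vanishZ; [rewrite mulr_ge0 ?(ph_K hW)|apply: vanish_sqrt; exact: vanish_inv].
Qed.

Lemma discretize_approximates : approximates At L Wn W.
Proof.
split => //.
- by move=> N; exact: discretize_measurable (hWn N).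
- have -> : (fun N => \int[@lebesgue_measure R]_(s in times) (tnorm2 (Wn N s - W s) ^+ 2)%:E)%E = EFin \o x.
    by apply: funext => N /=; apply: rint_integral; have [] := closeP N.
  apply: cvg_EFin; first by near=> N.
  by apply: vanish_cvg vanish_x => N; have [_ []] := closeP N.
exists xi; first by move=> N; have [] := closeP N.
rewrite /hcvg; under eq_fun do rewrite subr0.
by apply: vanish_cvg vanish_xi => N; exact: hnorm_ge0.
Unshelve. all: by end_near.
Qed.

Let bound k (y : R) (eta : R) := Num.sqrt (`|kap (k.+1 * 2)%N| * (2 * y)) + `|kap k.+1| * eta.

Let vanish_bound_terms k y eta : vanish y -> vanish eta -> vanish (fun N => bound k (y N) (eta N)).
Proof.
move=> hy he; apply: vanishD; last exact: vanishZ.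
by apply: vanish_sqrt; apply: vanishZ => //; exact: vanishZ.
Qed.

(** By sint_difference the integrals of two approximations of W are close to
    each other. Hence the sums over the refined grids form a Cauchy
    sequence, and any other approximating sequence has the same limit. *)
Lemma is_sint_ex k : exists2 J : L, is_sint At (Delta k.+1 0) W J &
  vanish (fun N => hnorm (L2dot L) (L2emb L (refined_sum k.+1 N) - J)).
Proof.
have hL := dot_semi_inner (L2dot L).
have [J hJ] : exists J, hcvg (L2dot L) (fun N => L2emb L (refined_sum k.+1 N)) J.
  apply: L2_complete => e e0; have e3 : 0 < e / 3 by rewrite divr_gt0.
  have [N hN] := vanish_bound_terms k vanish_x vanish_xi e3; exists N => i j hi hj.
  rewrite -linearB hnorm_L2emb -!sint_Wn.
  have [ri [xi0 _] wi _] := closeP i; have [rj [xj0 _] wj _] := closeP j.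
  apply: le_lt_trans (sint_difference hX hD k (simple_Wn i) (simple_Wn j) ri rj wi wj) _.
  have bi := hN i hi; have bj := hN j hj.
  have split_sqrt : Num.sqrt (`|kap (k.+1 * 2)%N| * (2 * (x i + x j))) <=
      Num.sqrt (`|kap (k.+1 * 2)%N| * (2 * x i)) + Num.sqrt (`|kap (k.+1 * 2)%N| * (2 * x j)).
    by rewrite !mulrDr; apply: sqrtrD_le; rewrite mulr_ge0// mulr_ge0.
  have split_norm := ler_wpM2l (normr_ge0 (kap k.+1)) (hnormB hL (xi i) (xi j)).
  rewrite mulrDr in split_norm; move: bi bj; rewrite /bound; lra.
exists J; last exact: cvg_vanish.
split.
- by move=> t t0; have [s hs1 hs2] := ph_adapted hW t0; exists s.
- by exists Wn; exact: discretize_approximates.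
move=> V [sV mV iV [eta weta veta]].
have := iV => /fine_cvgP[finV cV].
pose y N := fine (\int[@lebesgue_measure R]_(s in times) (tnorm2 (V N s - W s) ^+ 2)%:E)%E.
have vy : vanish y by exact: cvg_vanish.
have ve : vanish (fun N => hnorm (L2dot L) (eta N)).
  by have := cvg_vanish veta; apply: vanish_lew => N; rewrite subr0.
apply: vanish_cvg; first by move=> N; exact: hnorm_ge0.
have [N0 _ hN0] := finV.
apply: vanish_le (vanishD (vanish_bound_terms k (vanishD vy vanish_x) (vanishD ve vanish_xi)) (cvg_vanish hJ)).
exists N0 => N hN; apply: le_trans (hnorm_triangle3 hL (L2emb L (refined_sum k.+1 N)) _ _) _.
rewrite lerD2r -linearB hnorm_L2emb -sint_Wn.
have [rx _ wx _] := closeP N.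
have ry : rint (fun t => tnorm2 (V N t - W t) ^+ 2) (y N).
  apply: integral_rint; first by apply: measurable_funX; exact: mV.
    by move=> t; exact: sqr_ge0.
  by rewrite fineK//; exact: hN0.
apply: le_trans (sint_difference hX hD k (sV N) (simple_Wn N) ry rx (weta N) wx) _.
by rewrite lerD2l ler_wpM2l// hnormB.
Qed.

End Integral.

End Discretization.

(** * The change of variables formula *)

Lemma uniform_bound (R : realType) (P : nat -> R -> Prop) r : (forall i x y, x <= y -> P i x -> P i y) ->
  (forall i, (i < r)%N -> exists2 x, 0 <= x & P i x) ->
  exists2 x, 0 <= x & forall i, (i < r)%N -> P i x.
Proof.
move=> mono; elim: r => [|r IH] h; first by exists 0.
have [|x x0 hx] := IH; first by move=> i hi; apply: h; exact: ltnW.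
have [y y0 hy] := h r (ltnSn r).
exists (x + y); first exact: addr_ge0.
move=> i; rewrite ltnS leq_eqVlt => /orP[/eqP ->|hi].
  by apply: mono hy; rewrite lerDr.
by apply: mono (hx i hi); rewrite lerDl.
Qed.

Section ItoFormula.
Context (R : realType) (A : tracialVNA R).
Context (At : R -> set A) (X : R -> R -> A) (m : nat -> R -> R) (kap : nat -> R).
Hypothesis hX : free_increments At X m kap.
Context (Delta : nat -> R -> R -> A).
Hypothesis hD : diagonal_measures X Delta.
Context (U : biprocess A) (s : seq (step A)) (hs : represents At s U).
Context (tau : nat -> R) (n : nat) (g : grid tau n) (on : steps_on_grid tau n s).
Context (p : {poly R[i]}).
Local Notation Mt := (running At X U).

Definition integrand k : biprocess A := fun t =>
  k.+1`!%:R^-1 *: phi_mid tr (sharp_m (subst (Mt t) (dpoly k.+1 p)) (fun=> U t)).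

Lemma integrandE k t : 0 <= t ->
  integrand k t = contracted_derivative p k.+1 (Mt t) (active s t).
Proof.
move=> t0; rewrite -integrand_formula /integrand.
by rewrite -(tsum_active hs t0).
Qed.

Let cellG k i : biprocess A := fun t => contracted_derivative p k.+1 (Mt t) (active s (tau i)).

Let tau_ge0 i : (i < n)%N -> 0 <= tau i. Proof. by move=> hi; apply: (grid_ge0 g); exact: ltnW. Qed.
Let tau_le i : (i < n)%N -> tau i <= tau i.+1. Proof. by move=> hi; exact: ltW (g.2 i hi). Qed.

Let cell_holder k i : (i < n)%N -> holder_tensor At (tau i) (tau i.+1) (cellG k i).
Proof.
move=> hi; apply: (integrand_holder hX) => //.
- exact: tau_ge0.
- exact: tau_le.
- by move=> q /(At_active hX hs).
- by move=> t h1 h2; exact: (running_cell hX hs g on).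
- by apply: (At_running hX hs); exact: tau_ge0.
Qed.

Lemma integrand_piecewise k : exists K, piecewise_hoelder At tau n (cellG k) K (integrand k).
Proof.
have [|i hi|K K0 hK] := @uniform_bound R (fun i K => forall s' t, tau i <= s' -> s' <= t -> t <= tau i.+1 ->
    tnorm2 (cellG k i t - cellG k i s') <= K * Num.sqrt (t - s') /\
    nrm (tmul (cellG k i t) - tmul (cellG k i s')) <= K * Num.sqrt (t - s')) n.
- move=> i x y xy h s' t h1 h2 h3; have [e1 e2] := h s' t h1 h2 h3.
  by split; [apply: le_trans e1 _|apply: le_trans e2 _]; rewrite ler_wpM2r ?sqrtr_ge0.
- exact: (cell_holder k hi).2.
have cE i t : (i < n)%N -> tau i <= t -> t < tau i.+1 -> integrand k t = cellG k i t.
  move=> hi h1 h2; rewrite integrandE ?(le_trans (tau_ge0 hi))//.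
  by rewrite (active_cell g on hi h1 h2).
have eE t : tau n <= t -> integrand k t = 0.
  move=> h; rewrite integrandE; last exact: le_trans (grid_ge0 g (leqnn n)) h.
  rewrite (active_end g on h) /contracted_derivative big1// => i _.
  by rewrite big1 ?scaler0// => c _; rewrite big_nil.
exists K; split => //; last by move=> i s' t hi; exact: hK.
move=> t t0; have [[i hi [h1 h2]]|h] := grid_locate g t0.
  by rewrite (cE i)//; apply: (cell_holder k hi).1 => //; exact: ltW.
by rewrite eE//; exact: adapted_at0.
Qed.

Lemma integrand0 k : (size p <= k)%N -> forall t, 0 <= t -> integrand k t = 0.
Proof.
move=> hk t t0; rewrite integrandE// /contracted_derivative big1// => i _.
by rewrite comps_nil ?big_nil ?scaler0//; apply: leq_trans (ltn_ord i) (leqW hk).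
Qed.

(** By cell_formula the errors on the cells of the refined grid compose to
    O(sqrt h). The formula holds for arbitrarily fine subdivisions of these
    cells, so the sums of powers may be replaced by the increments of the
    diagonal measures before N tends to infinity. *)
Lemma ito_refined : vanish (fun N => nrm (horner_alg (Mt (tau n)) p - horner_alg (Mt 0) p -
  \sum_(k < size p) refined_sum Delta tau n (integrand k) k.+1 N)).
Proof.
pose T := tau n; have T0 : 0 <= T by exact: (grid_ge0 g).
have [|i hi|C C0 hC] := @uniform_bound R (fun i C => forall r r' pi sz, tau i <= r -> r' <= tau i.+1 ->
    subdivision r r' pi sz ->
    block At r r' (horner_alg (Mt r') p - horner_alg (Mt r) p -
      \sum_(k < size p) act (cellG k i r) (power_sum X k.+1 pi sz))
    (C * ((r' - r) * Num.sqrt (r' - r))) (C * (r' - r) ^+ 2)) n.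
- move=> i x y xy h r r' pi sz h1 h2 sub.
  have rr : 0 <= r' - r by case: (sub) => _ <- _; rewrite subr_ge0; have [] := subdivision_le sub (leqnn sz).
  apply: blockW (h r r' pi sz h1 h2 sub); rewrite ler_wpM2r ?sqr_ge0//.
  by rewrite mulr_ge0 ?sqrtr_ge0.
- apply: (cell_formula hX (tau_ge0 hi) (tau_le hi)).
  + by move=> q /(At_active hX hs).
  + by move=> t h1 h2; exact: (running_cell hX hs g on).
  + by apply: (At_running hX hs); exact: tau_ge0.
pose h N := T / N.+1%:R.
have vh : vanish h by exact: vanish_inv.
apply: (@vanish_lew _ _ (fun N => C * T * Num.sqrt (h N) + Num.sqrt (C * T * h N))); last first.
  apply: vanishD; last apply: vanish_sqrt.
    by apply: vanishZ; [rewrite mulr_ge0|exact: vanish_sqrt].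
  by apply: vanishZ => //; rewrite mulr_ge0.
move=> N; pose sg := refined tau N; pose nn := (n * N.+1)%N.
have gs : grid sg nn by exact: refined_grid.
have sg0 l : (l <= nn)%N -> 0 <= sg l by exact: grid_ge0.
have sgle l : (l < nn)%N -> sg l <= sg l.+1 by move=> hl; exact: ltW (gs.2 l hl).
have cells l : exists c : (nat -> nat -> R) * (nat -> nat) * (nat -> R),
    (l < nn)%N -> fine_cells X Delta (sg l) (sg l.+1) c.1.1 c.1.2 c.2.
  have [hl|hl] := ltnP l nn; last by exists ((fun _ _ => 0), (fun=> 0%N), (fun=> 0)).
  have [pi [sz [h' H]]] := fine_cells_ex hX hD (sg0 l (ltnW hl)) (sgle l hl).
  by exists (pi, sz, h').
have [c hc] := boolp.choice cells.
pose pi l := (c l).1.1; pose sz l := (c l).1.2.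
pose F N' l := horner_alg (Mt (sg l.+1)) p - horner_alg (Mt (sg l)) p -
  \sum_(k < size p) act (integrand k (sg l)) (power_sum X k.+1 (pi l N') (sz l N')).
have d0 l : (l < nn)%N -> 0 <= sg l.+1 - sg l by move=> hl; rewrite subr_ge0 sgle.
have bl N' l : (l < nn)%N -> block At (sg l) (sg l.+1) (F N' l)
    (C * ((sg l.+1 - sg l) * Num.sqrt (sg l.+1 - sg l))) (C * (sg l.+1 - sg l) ^+ 2).
  move=> hl; have [_ sub _ _] := hc l hl; have [l1 l2] := refined_sub g hl.
  have hq := refined_cell tau hl.
  have h1 : sg l < tau (l %/ N.+1).+1 by apply: lt_le_trans (gs.2 l hl) l2.
  have e k : integrand k (sg l) = cellG k (l %/ N.+1) (sg l).
    by rewrite integrandE ?sg0 ?(ltnW hl)// (active_cell g on hq l1 h1).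
  rewrite /F; under eq_bigr do rewrite e.
  exact: (hC _ hq _ _ _ _ l1 l2 (sub N')).
have len : \sum_(l < nn) (sg l.+1 - sg l) = T.
  have sub : subdivision (sg 0%N) (sg nn) sg nn by split => // i hi; exact: sgle.
  by rewrite (subdivision_length sub) gs.1 subr0 /sg refined_end.
have bound N' : nrm (\sum_(l < nn) F N' l) <= C * T * Num.sqrt (h N) + Num.sqrt (C * T * h N).
  have t00 : 0 <= sg 0%N by rewrite gs.1.
  have [B _] := block_sum hX t00 sgle (bl N').
  apply: le_trans (block_nrm hX t00 B) _; rewrite -len; apply: lerD.
    rewrite mulrAC mulr_sumr; apply: ler_sum => l _; rewrite mulrAC -mulrA ler_wpM2l//.
    by rewrite ler_wpM2l ?d0// ler_wsqrtr// refined_mesh.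
  apply: ler_wsqrtr; rewrite mulrAC mulr_sumr; apply: ler_sum => l _.
  rewrite -mulrA ler_wpM2l// expr2 ler_wpM2r ?d0// refined_mesh//.
have hK l k := act_bounded (integrand k (sg l)).
pose K l k := projT1 (cid2 (hK l k)).
have hK' l k : 0 <= K l k /\ forall Z, nrm (act (integrand k (sg l)) Z) <= K l k * nrm Z.
  by rewrite /K; case: cid2.
pose err l k N' := nrm (power_sum X k.+1 (pi l N') (sz l N') - increment Delta k.+1 (sg l) (sg l.+1)).
apply: (@vanish_bound _ _ _ (fun N' => \sum_(l < nn) \sum_(k < size p) K l k * err l k N')).
  apply: (vanish_sum (f := fun l N' => \sum_(k < size p) K l k * err l k N')) => l hl.
  apply: (vanish_sum (f := fun k N' => K l k * err l k N')) => k _.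
  by apply: vanishZ; [exact: (hK' l k).1|have [_ _ _] := hc l hl; apply].
exists 0%N => N' _.
have -> : horner_alg (Mt (tau n)) p - horner_alg (Mt 0) p -
    \sum_(k < size p) refined_sum Delta tau n (integrand k) k.+1 N =
    \sum_(l < nn) F N' l + \sum_(l < nn) \sum_(k < size p) act (integrand k (sg l))
      (power_sum X k.+1 (pi l N') (sz l N') - increment Delta k.+1 (sg l) (sg l.+1)).
  rewrite -big_split /= (eq_bigr (fun l : 'I_nn => (horner_alg (Mt (sg l.+1)) p - horner_alg (Mt (sg l)) p) -
    \sum_(k < size p) act (integrand k (sg l)) (increment Delta k.+1 (sg l) (sg l.+1)))); last first.
    move=> l _; rewrite /F -addrA; congr (_ + _); rewrite addrC -sumrB -sumrN; apply: eq_bigr => k _.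
    by rewrite actBr addrAC subrr add0r.
  rewrite sumrB exchange_big /=; congr (_ - _).
  rewrite -(big_mkord xpredT (fun l => horner_alg (Mt (sg l.+1)) p - horner_alg (Mt (sg l)) p)).
  by rewrite (telescope_sumr (fun l => horner_alg (Mt (sg l)) p))// gs.1 /sg refined_end.
apply: le_trans (nrmD _ _) _; apply: lerD; first exact: bound.
apply: le_trans (nrm_sum _ _ _) _; apply: ler_sum => l _.
apply: le_trans (nrm_sum _ _ _) _; apply: ler_sum => k _.
exact: (hK' l k).2.
Qed.

End ItoFormula.

Theorem corollary1 (R : realType) (A : tracialVNA R) (L : L2completion A)
    (At : R -> set A) (HAt : filtration At)
    (mu : probability (measurableTypeR R) R)
    (mu_compact : compactly_supported mu)
    (mu_fid : freely_infinitely_divisible mu)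
    (mu_var : ('V_mu[(fun x : R => x) : measurableTypeR R -> R] = 1)%E)
    (r : nat -> R) (Hr : has_free_cumulants mu r)
    (mut : R -> probability (measurableTypeR R) R)
    (Hmut : free_convolution_semigroup mut r)
    (X : R -> R -> A) (HX : free_stochastic_measure At mut X)
    (Delta : nat -> R -> R -> A) (HDelta : diagonal_measures X Delta)
    (U : biprocess A) (HU : simple At U)
    (p : {poly R[i]}) :
  let M := sint At (X 0) U in
  let Mt t := sint At (X 0) (windowed 0 t U) in
  let integrand k : biprocess A := fun t =>
    k.+1`!%:R^-1 *:
      phi_mid tr (sharp_m (subst (Mt t) (dpoly k.+1 p)) (fun=> U t)) in
  exists J : nat -> L,
    (forall k, is_sint At (Delta k.+1 0) (integrand k) (J k)) /\
    hcvg (L2dot L) (fun n => \sum_(k < n) J k)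
      (L2emb L (horner_alg M p - (p.[0])%:A)).
Proof.
move=> M Mt integrand.
have [m [kap hX]] := free_stochastic_measure_increments HAt Hmut HX.
have [s hs] := HU.
have [tau [n [g on _]]] := steps_grid_ex hs.1 (pts := [::]) (fun x => ltac:(by [])).
have hL := dot_semi_inner (L2dot L).
have sint_ex k : exists J : L, is_sint At (Delta k.+1 0) (integrand k) J /\
    vanish (fun N => hnorm (L2dot L) (L2emb L (refined_sum Delta tau n (integrand k) k.+1 N) - J)).
  have [K hK] := integrand_piecewise hX hs g on p k.
  by have [J h1 h2] := is_sint_ex L hX HDelta hK k; exists J.
have [J hJ] := boolp.choice sint_ex; exists J; split; first by move=> k; have [] := hJ k.
have J0 k : (size p <= k)%N -> J k = 0.
  move=> hk; apply/hnorm_eq0/eqP; rewrite eq_le hnorm_ge0 andbT.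
  apply: (vanish_bound (hJ k).2); exists 0%N => N _; rewrite add0r.
  rewrite /refined_sum big1 ?linear0 ?sub0r ?(hnormN hL)// => l _.
  rewrite (_ : integrand k _ = 0) ?act0l//; apply: (integrand0 X hs hk).
  by apply: (grid_ge0 (refined_grid N g)); exact: ltnW.
have eM : M = running At X U (tau n) by rewrite (running_end X hs g on).
(* The running integral vanishes at time 0. *)
have e0 : (p.[0])%:A = horner_alg (running At X U 0) p.
  by rewrite (running0 X hs) -(rmorph0 (in_alg A)) /= /horner_alg /horner_morph horner_map.
have total : \sum_(k < size p) J k = L2emb L (horner_alg M p - (p.[0])%:A).
  apply/eqP; rewrite -subr_eq0; apply/eqP/(hnorm_eq0 (d := L2dot L))/eqP; rewrite eq_le hnorm_ge0 andbT.
  have v1 := ito_refined hX HDelta hs g on p.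
  have v2 := vanish_sum (n := size p) (fun k _ => (hJ k).2).
  apply: (vanish_bound (vanishD v1 v2)); exists 0%N => N _; rewrite add0r (hnormBC hL) eM e0.
  set S := \sum_(k < size p) refined_sum _ _ _ _ _ _.
  apply: le_trans (hnorm_triangle3 hL (L2emb L S) _ _) _.
  rewrite -linearB hnorm_L2emb lerD2l /S linear_sum -sumrB.
  exact: (hnorm_sum hL).
apply: vanish_cvg; first by move=> N; exact: hnorm_ge0.
apply: vanish_le (@vanish0 R); exists (size p) => N hN.
have -> : \sum_(k < N) J k = \sum_(k < size p) J k.
  rewrite -(subnKC hN) big_split_ord /= [X in _ + X]big1 ?addr0// => k _.
  by rewrite J0// leq_addr.
by rewrite -total subrr (hnorm0 hL).
Qed.
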